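(* Let $x$ be an arbitrary function in $L^2(\mathbb{R}^{+})$ and let $\mathscr{F}_{\mathbb{R}^{+}}x$ be its truncated Fourier--Plancherel transform. Write $Ux=\begin{bmatrix} y_{+}\\ y_{-}\end{bmatrix}$ and $U\mathscr{F}_{\mathbb{R}^{+}}x=\begin{bmatrix} z_{+}\\ z_{-}\end{bmatrix}$. Then \[ (U\mathscr{F}_{\mathbb{R}^{+}}x)(\mu)=F(\mu)\,(Ux)(\mu),\quad \mu\in\mathbb{R}^{+},\qquad F(\mu)=\begin{bmatrix}0&F_{+-}(\mu)\\ F_{-+}(\mu)&0\end{bmatrix}, \] i.e. $z_{+}(\mu)=F_{+-}(\mu)\,y_{-}(\mu)$ and $z_{-}(\mu)=F_{-+}(\mu)\,y_{+}(\mu)$ for $\mu\in\mathbb{R}^{+}$, where \[ F_{+-}(\mu)=\frac{1}{\sqrt{2\pi}}\,e^{i\pi/4}e^{-\frac{\pi}{2}\mu}\,\Gamma\big(\tfrac12+i\mu\big),\qquad F_{-+}(\mu)=\frac{1}{\sqrt{2\pi}}\,e^{i\pi/4}e^{\frac{\pi}{2}\mu}\,\Gamma\big(\tfrac12-i\mu\big),\qquad \mu\in\mathbb{R}^{+}. \]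
   Context: The truncated Fourier--Plancherel operator on $L^2(\mathbb{R}^{+})$ is $(\mathscr{F}_{\mathbb{R}^{+}}x)(t)=\frac{1}{\sqrt{2\pi}}\int_{\mathbb{R}^{+}}x(\xi)e^{it\xi}\,d\xi$, $t\in\mathbb{R}^{+}$. The model space $\mathfrak{M}$ is the space of $2\times1$ columns $\begin{bmatrix}\varphi_{+}\\ \varphi_{-}\end{bmatrix}$ with $\varphi_{\pm}\in L^2(\mathbb{R}^{+})$, with inner product $\langle\varphi_{+},\psi_{+}\rangle_{L^2(\mathbb{R}^{+})}+\langle\varphi_{-},\psi_{-}\rangle_{L^2(\mathbb{R}^{+})}$. For $x\in L^2(\mathbb{R}^{+})$ with $\int_{\mathbb{R}^{+}}|x(\xi)|\xi^{-1/2}d\xi<\infty$, define $Ux=\begin{bmatrix}(Ux)_{+}\\(Ux)_{-}\end{bmatrix}$ by $(Ux)_{\pm}(\mu)=\frac{1}{\sqrt{2\pi}}\int_{\mathbb{R}^{+}}x(\xi)\,\xi^{-1/2}\xi^{\pm i\mu}\,d\xi$, $\mu\in\mathbb{R}^{+}$ (with $\xi^{\zeta}=e^{\zeta\ln\xi}$, $\ln\xi$ real); this is isometric on this dense subspace and $U$ denotes its continuous extension to all of $L^2(\mathbb{R}^{+})$, which is a unitary map of $L^2(\mathbb{R}^{+})$ onto $\mathfrak{M}$ (a Mellin transform on the line $\operatorname{Re}\zeta=1/2$, split into $\mu>0$ and $\mu<0$ halves). *)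

(* Defs.v *)
From HB Require Import structures.
From mathcomp Require Import all_boot all_order all_algebra.
From mathcomp Require Import all_classical all_reals all_analysis.
From mathcomp Require Import complex.
Set Implicit Arguments. Unset Strict Implicit. Unset Printing Implicit Defensive.
Import Order.TTheory GRing.Theory Num.Theory.
Import numFieldNormedType.Exports.
Local Open Scope classical_set_scope.
Local Open Scope ring_scope.
Local Open Scope complex_scope.

Section Defs.
Variable R : realType.
Local Notation C := R[i].
Local Notation mu := (@lebesgue_measure R).

Definition Rp : set R := `]0%R, +oo[%classic.

Definition cre (z : C) : R := complex.Re z.
Definition cim (z : C) : R := complex.Im z.
Definition cnorm2 (z : C) : R := cre z ^+ 2 + cim z ^+ 2.
Definition cmk (a b : R) : C := a +i* b.

Definition expi (a : R) : C := cmk (cos a) (sin a).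

Definition cint (D : set R) (f : R -> C) : C :=
  cmk (Rintegral mu D (fun t => cre (f t))) (Rintegral mu D (fun t => cim (f t))).

Definition cmeasurable (D : set R) (f : R -> C) : Prop :=
  measurable_fun D (fun t => cre (f t)) /\ measurable_fun D (fun t => cim (f t)).

Definition L2p (f : R -> C) : Prop :=
  cmeasurable Rp f /\ mu.-integrable Rp (fun t => (cnorm2 (f t))%:E).

Definition L1p (f : R -> C) : Prop :=
  cmeasurable Rp f /\ mu.-integrable Rp (fun t => (Num.sqrt (cnorm2 (f t)))%:E).

Definition L2dist2 (f g : R -> C) : R :=
  Rintegral mu Rp (fun t => cnorm2 (f t - g t)).

Definition L2conv (fs : nat -> R -> C) (g : R -> C) : Prop :=
  (fun n => L2dist2 (fs n) g) @ \oo --> 0.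

Definition csqrt2pi_inv : C := ((Num.sqrt (2 * pi))^-1)%:C.

(* truncated Fourier-Plancherel integral, meaningful for x in L^1 /\ L^2 *)
Definition FRp_int (x : R -> C) (t : R) : C :=
  csqrt2pi_inv * cint Rp (fun xi => x xi * expi (t * xi)).

(* y = F_{R^+} x, where F_{R^+} is the continuous (Plancherel) extension of
   FRp_int from the dense subspace L^1 /\ L^2 to L^2(R^+). *)
Definition IsFRp (x y : R -> C) : Prop :=
  L2p x /\ L2p y /\
  exists xs : nat -> R -> C,
    (forall n, L2p (xs n) /\ L1p (xs n)) /\ L2conv xs x /\
    L2conv (fun n => FRp_int (xs n)) y.

(* dense domain of the defining Mellin integral *)
Definition DomU (x : R -> C) : Prop :=
  L2p x /\ mu.-integrable Rp
    (fun xi => (Num.sqrt (cnorm2 (x xi)) * powR xi (- 2^-1))%:E).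

(* (Ux)_{+} (sgn = true) and (Ux)_{-} (sgn = false) on DomU;
   xi^{-1/2} xi^{+- i mu} = xi^{-1/2} e^{+- i mu ln xi} *)
Definition U_int (sgn : bool) (x : R -> C) (m : R) : C :=
  csqrt2pi_inv * cint Rp (fun xi =>
    x xi * (powR xi (- 2^-1))%:C * expi ((if sgn then m else - m) * ln xi)).

(* U x = [wp; wm] where U is the continuous (unitary) extension of U_int
   from DomU to L^2(R^+) with values in the model space M = L^2(R^+)^2. *)
Definition IsU (x wp wm : R -> C) : Prop :=
  L2p x /\ L2p wp /\ L2p wm /\
  exists xs : nat -> R -> C,
    (forall n, DomU (xs n)) /\ L2conv xs x /\
    L2conv (fun n => U_int true (xs n)) wp /\
    L2conv (fun n => U_int false (xs n)) wm.

(* Euler Gamma function for Re z > 0: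
   Gamma z = int_0^oo t^{z-1} e^{-t} dt, t^{z-1} = t^{Re z - 1} e^{i Im z ln t} *)
Definition cGamma (z : C) : C :=
  cint Rp (fun t => (powR t (cre z - 1) * expR (- t))%:C * expi (cim z * ln t)).

Definition Fpm (m : R) : C :=
  csqrt2pi_inv * expi (pi / 4) * (expR (- (pi / 2) * m))%:C
    * cGamma (cmk (2^-1) m).

Definition Fmp (m : R) : C :=
  csqrt2pi_inv * expi (pi / 4) * (expR ((pi / 2) * m))%:C
    * cGamma (cmk (2^-1) (- m)).

End Defs.

(* Main.v *)
Require Import Defs.
From HB Require Import structures.
From mathcomp Require Import all_boot all_order all_algebra.
From mathcomp Require Import all_classical all_reals all_analysis.
From mathcomp Require Import complex.
From mathcomp Require Import ring lra measurable_realfun.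
Import Order.TTheory GRing.Theory Num.Theory.
Import numFieldNormedType.Exports.
Local Open Scope classical_set_scope.
Local Open Scope ring_scope.

(** Write [<f, g>] for the bilinear pairing, [U_s] for the two halves of [U] and
[U_s^t] for the transpose of [U_s].  Expanding the square and damping by
[exp (- e m)] turns the energy of an oscillatory integral with phase [phi] into a
double integral against the Poisson kernel [e / (e^2 + (phi - phi')^2)], and
Schur's test bounds it; this makes [F] (phase [xi]) and [U] (phase [ln xi])
bounded on their dense domains, hence all the limits in the definitions are
harmless, and [U_s^t g] is in L^2 by duality.  For [g] in L^2 with compact support
in the open half line, [<U_s F x, g> = <F x, G>] with [G = U_s^t g], and this is the
limit of [<x, F (G e^(- d t))>] as [d] tends to [0].  By Fubini,
[F (G e^(- d t)) (xi)] is an integral of [g] against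
[int t^(- 1/2 + i m) e^(- (d - i xi) t) dt = Gamma (1/2 + i m) (d - i xi)^(- 1/2 - i m)],
so it converges pointwise, dominated by [C xi^(- 1/2)], to the transpose of the
other half of [U] applied to the multiplier times [g].  Density of the domain of
[U] then identifies the limit, and [g] is taken to be the conjugate of the
difference of the two sides. *)

(** * Integration on the real line *)

(** The obstacle is that [fx], [yp], [ym], [zp], [zm] are only L^2 limits, so no side of the
    identity has a pointwise formula; testing against [g] moves every operator onto explicit
    integrals of [g]. Operator bounds may be lossy, since the limits ask only for finite constants.
    Two weak estimates shape the argument. Pointwise, [G] is only known to be [O(t^(- 1/2))], which
    is not integrable at infinity; the damping supplies the missing integrability and also keeps
    [d - i xi] off the imaginary axis, where Euler's integral stops converging absolutely. And
    [C xi^(- 1/2)] is an integrable majorant only after multiplication by a function in the domain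
    of [U], not by an arbitrary [x] in L^2. The halves are exchanged because the Fourier transform
    sends [t^(- 1/2 + i m)] to a multiple of [xi^(- 1/2 - i m)]; the factor [(- i)^(- 1/2 - i m) =
    e^(i pi / 4) e^(- pi m / 2)] is the elementary part of [F]. The support of [g] is compact
    because Gamma is bounded here uniformly in [m], without decay, while [e^(pi m / 2)] grows. *)

Section RealIntegrals.
Context {R : realType}.
Local Notation mu := (@lebesgue_measure R).
Local Notation itg D f := (mu.-integrable D (EFin \o (f : R -> R))).
Local Notation rint D f := (Rintegral mu D f).
Implicit Types (D : set R) (f g u v F : R -> R).

Lemma itg_meas D f : itg D f -> measurable_fun D f.
Proof. by move=> /measurable_int/measurable_EFinP. Qed.

Lemma itg_dominated D f g : measurable D -> measurable_fun D f ->
  (forall x, D x -> `|f x| <= g x) -> itg D g -> itg D f.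
Proof.
move=> mD mf fg ig; apply: (@le_integrable _ _ _ mu _ mD _ (EFin \o g)) => //; first exact/measurable_EFinP.
move=> x Dx /=; rewrite lee_fin (le_trans (fg x Dx))//; exact: ler_norm.
Qed.

Lemma itgD D f g : measurable D -> itg D f -> itg D g ->
  itg D (fun x => f x + g x).
Proof. by move=> mD hf hg; have := @integrableD _ _ _ mu D mD _ _ hf hg. Qed.

Lemma itgB D f g : measurable D -> itg D f -> itg D g ->
  itg D (fun x => f x - g x).
Proof. by move=> mD hf hg; have := @integrableB _ _ _ mu D mD _ _ hf hg. Qed.

Lemma itgZl D (k : R) f : measurable D -> itg D f -> itg D (fun x => k * f x).
Proof. by move=> mD hf; have := @integrableZl _ _ _ mu D mD k _ hf. Qed.

Lemma eq_itg D f g : measurable D -> (forall x, D x -> f x = g x) ->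
  itg D f -> itg D g.
Proof.
move=> mD fg; apply: eq_integrable => // x; rewrite inE => Dx /=.
by rewrite fg.
Qed.

Lemma itgS (D E : set R) f : measurable D -> measurable E -> D `<=` E ->
  itg E f -> itg D f.
Proof. by move=> mD mE DE; apply: integrableS. Qed.

Lemma itg_restrict D (E : set R) f : measurable D -> measurable E ->
  itg (D `&` E) f -> itg D (f \_ E).
Proof.
move=> mD mE jf; rewrite -restrict_EFin.
by apply/(@integrable_restrict _ _ _ mu E mE D mD).
Qed.

Lemma eq_rint D f g : (forall x, D x -> f x = g x) -> rint D f = rint D g.
Proof. by move=> fg; apply: eq_Rintegral => x; rewrite inE => /fg. Qed.

Lemma EFin_rint D f : measurable D -> itg D f ->
  (rint D f)%:E = (\int[mu]_(x in D) (f x)%:E)%E.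
Proof. by move=> mD hf; rewrite /Rintegral fineK//; apply: integrable_fin_num. Qed.

Lemma rint_le D f g : measurable D -> itg D f -> itg D g ->
  (forall x, D x -> f x <= g x) -> rint D f <= rint D g.
Proof. by move=> mD hf hg fg; apply: le_Rintegral. Qed.

Lemma rintD D f g : measurable D -> itg D f -> itg D g ->
  rint D (fun x => f x + g x) = rint D f + rint D g.
Proof. by move=> mD hf hg; apply: RintegralD. Qed.

Lemma rintB D f g : measurable D -> itg D f -> itg D g ->
  rint D (fun x => f x - g x) = rint D f - rint D g.
Proof. by move=> mD hf hg; apply: RintegralB. Qed.

Lemma rintZl D (k : R) f : measurable D -> itg D f ->
  rint D (fun x => k * f x) = k * rint D f.
Proof. by move=> mD hf; apply: RintegralZl. Qed.

Lemma rintZr D (k : R) f : measurable D -> itg D f ->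
  rint D (fun x => f x * k) = rint D f * k.
Proof. by move=> mD hf; apply: RintegralZr. Qed.

Lemma itgZr D (k : R) f : measurable D -> itg D f -> itg D (fun x => f x * k).
Proof.
by move=> mD hf; apply: eq_itg (itgZl _ k _ mD hf) => // x _; rewrite mulrC.
Qed.

Lemma rint_norm_le D f g : measurable D -> measurable_fun D f -> itg D g ->
  (forall x, D x -> `|f x| <= g x) -> `|rint D f| <= rint D g.
Proof.
move=> mD mf ig fg.
have jf : itg D f by exact: (itg_dominated _ _ g).
apply: le_trans (@le_normr_Rintegral _ _ _ mu D f mD jf) _.
apply: rint_le => //; exact: integrable_norm.
Qed.

Lemma itg_ge0_finite D f : measurable D -> measurable_fun D f ->
  (forall x, D x -> 0 <= f x) -> (\int[mu]_(x in D) (f x)%:E < +oo)%E ->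
  itg D f.
Proof.
move=> mD mf f0 fin; apply/integrableP; split; first exact/measurable_EFinP.
suff -> : (\int[mu]_(x in D) `|(EFin \o f) x| = \int[mu]_(x in D) (f x)%:E)%E by [].
by apply: eq_integral => x; rewrite inE => Dx /=; rewrite ger0_norm// f0.
Qed.

Lemma itg_bounded D f (M : R) : measurable D -> (mu D < +oo)%E ->
  measurable_fun D f -> (forall x, D x -> `|f x| <= M) -> itg D f.
Proof.
move=> mD muD mf fM; apply: (@measurable_bounded_integrable _ _ _ mu) => //.
exists M; split; first exact: num_real.
by move=> y My x Dx /=; rewrite (le_trans (fM x Dx))// ltW.
Qed.

Lemma rdct D (fs : nat -> R -> R) f g : measurable D ->
  (forall n, measurable_fun D (fs n)) -> itg D g ->
  (forall n x, D x -> `|fs n x| <= g x) ->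
  (forall x, D x -> (fun n => fs n x) @ \oo --> f x) ->
  itg D f /\ (fun n => rint D (fs n)) @ \oo --> rint D f.
Proof.
move=> mD mfs ig fsg fsf.
have mf : measurable_fun D f by exact: (measurable_fun_cvg mfs).
have [] := @dominated_convergence _ _ _ mu D mD (fun n => EFin \o fs n) (EFin \o f)
  (EFin \o g).
- by move=> n; apply/measurable_EFinP; exact: mfs.
- by apply/measurable_EFinP; exact: mf.
- by apply: aeW => x Dx; apply/fine_cvgP; split; [exact: nearW|exact: fsf].
- exact: ig.
- by apply: aeW => x n Dx /=; rewrite lee_fin fsg.
move=> jf _ cv; split => //.
apply: fine_cvg; rewrite -/(Rintegral mu D f).
by move: cv; rewrite -EFin_rint.
Qed.

Lemma meas2_fst (D1 D2 : set R) f : measurable D1 -> measurable D2 ->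
  measurable_fun D1 f ->
  measurable_fun (D1 `*` D2) (fun p : R * R => f p.1).
Proof.
move=> m1 m2 mf; apply: (@measurable_comp _ _ _ _ _ _ D1 f) => //.
- by move=> _ [[x y] [/= ? ?] <-].
- by apply: measurable_funTS; exact: measurable_fst.
Qed.

Lemma meas2_snd (D1 D2 : set R) f : measurable D1 -> measurable D2 ->
  measurable_fun D2 f ->
  measurable_fun (D1 `*` D2) (fun p : R * R => f p.2).
Proof.
move=> m1 m2 mf; apply: (@measurable_comp _ _ _ _ _ _ D2 f) => //.
- by move=> _ [[x y] [/= ? ?] <-].
- by apply: measurable_funTS; exact: measurable_snd.
Qed.

Lemma meas2_row (D1 D2 : set R) (f : R -> R -> R) x : measurable D1 -> measurable D2 ->
  measurable_fun (D1 `*` D2) (fun p : R * R => f p.1 p.2) -> D1 x ->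
  measurable_fun D2 (f x).
Proof.
move=> m1 m2 mf D1x.
apply: (@measurable_comp _ _ _ _ _ _ (D1 `*` D2) (fun p : R * R => f p.1 p.2) _ (pair x)).
- exact: measurableX.
- by move=> _ [y D2y <-].
- exact: mf.
- exact/measurable_funTS/measurable_pair1.
Qed.

Lemma meas2_col (D1 D2 : set R) (f : R -> R -> R) y : measurable D1 -> measurable D2 ->
  measurable_fun (D1 `*` D2) (fun p : R * R => f p.1 p.2) -> D2 y ->
  measurable_fun D1 (f ^~ y).
Proof.
move=> m1 m2 mf D2y.
apply: (@measurable_comp _ _ _ _ _ _ (D1 `*` D2) (fun p : R * R => f p.1 p.2) _ (pair^~ y)).
- exact: measurableX.
- by move=> _ [x D1x <-].
- exact: mf.
- exact/measurable_funTS/measurable_pair2.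
Qed.

Lemma itgM_bounded1 D f g : measurable D -> itg D f -> measurable_fun D g ->
  (forall x, `|g x| <= 1) -> itg D (fun x => f x * g x).
Proof.
move=> mD jf mg g1; apply: (itg_dominated _ _ (fun x => `|f x|)) => //.
- by apply: measurable_funM => //; exact: itg_meas.
- by move=> x _; rewrite normrM ler_piMr.
- exact: integrable_norm.
Qed.

(** * Tonelli and Fubini for real-valued integrals over rectangles *)

Section TwoVariables.
Variables (D1 D2 : set R) (f : R -> R -> R).
Hypothesis (mD1 : measurable D1) (mD2 : measurable D2).
Hypothesis mf : measurable_fun (D1 `*` D2) (fun p : R * R => f p.1 p.2).

(** Extension by zero to the whole plane, so that the theorems for product measures apply and the
    two domains reappear as indicators of rows and columns. *)
Let h (p : R * R) : \bar R := (((fun p => f p.1 p.2) \_ (D1 `*` D2)) p)%:E.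

Let mh : measurable_fun setT h.
Proof.
apply/measurable_EFinP.
exact: (proj1 (measurable_restrictT _ (measurableX mD1 mD2)) mf).
Qed.

Let mfub (k : R * R -> \bar R) : measurable_fun setT k -> (forall p, 0 <= k p)%E ->
  measurable_fun setT (fun x : R => \int[mu]_y k (x, y))%E.
Proof.
move=> mk k0.
exact: (@measurable_fun_fubini_tonelli_F _ _ (measurableTypeR R)
  (measurableTypeR R) R mu k mk k0).
Qed.

Let h1 x : (\int[mu]_y h (x, y) =
  (if x \in D1 then \int[mu]_(y in D2) (f x y)%:E else 0))%E.
Proof.
case: ifPn => xD.
  rewrite [RHS]integral_mkcond; apply: eq_integral => y _.
  by rewrite /h !patchE in_setX xD /=; case: ifP.
by rewrite integral0_eq// => y _; rewrite /h patchE in_setX (negbTE xD).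
Qed.

Let h2 y : (\int[mu]_x h (x, y) =
  (if y \in D2 then \int[mu]_(x in D1) (f x y)%:E else 0))%E.
Proof.
case: ifPn => yD.
  rewrite [RHS]integral_mkcond; apply: eq_integral => x _.
  by rewrite /h !patchE in_setX yD /= andbT; case: ifP.
by rewrite integral0_eq// => x _; rewrite /h patchE in_setX (negbTE yD) andbF.
Qed.

Lemma rint_measurable : measurable_fun D1 (fun x => rint D2 (f x)).
Proof.
have : measurable_fun D1 (fun x => fine (fubini_F mu h x)).
  apply: measurable_funTS; apply: measurableT_comp => //.
  rewrite (_ : fubini_F mu h = fun x =>
      (\int[mu]_y h^\+ (x, y) - \int[mu]_y h^\- (x, y))%E); last first.
    apply/funext => x; rewrite /fubini_F integralE.
    by under eq_integral do rewrite funepos_comp/=;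
      under [X in (_ - X = _)%E]eq_integral do rewrite funeneg_comp/=.
  apply: emeasurable_funB.
  - by apply: (mfub h^\+%E) => //; exact: measurable_funepos.
  - by apply: (mfub h^\-%E) => //; exact: measurable_funeneg.
apply: eq_measurable_fun => x xD; rewrite /fubini_F h1 xD//.
Qed.

(** [Rintegral] sends an infinite integral to 0, so positivity alone does not give the exchange:
    integrability of rows, of columns and of one iterated integral keeps every value finite.
    Integrability of the other iterated integral is then a conclusion. *)
Lemma rtonelli : (forall x y, D1 x -> D2 y -> 0 <= f x y) ->
  (forall x, D1 x -> itg D2 (f x)) -> (forall y, D2 y -> itg D1 (f ^~ y)) ->
  itg D2 (fun y => rint D1 (f ^~ y)) ->
  itg D1 (fun x => rint D2 (f x)) /\
  rint D1 (fun x => rint D2 (f x)) = rint D2 (fun y => rint D1 (f ^~ y)).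
Proof.
move=> f0 row1 row2 i2.
have h0 p : (0 <= h p)%E.
  rewrite /h patchE; case: ifP => // /set_mem[p1 p2]; rewrite lee_fin; exact: f0.
have swap : (\int[mu]_(x in D1) (rint D2 (f x))%:E =
             \int[mu]_(y in D2) (rint D1 (f ^~ y))%:E)%E.
  have := @fubini_tonelli _ _ _ _ _ mu mu h mh h0.
  under eq_integral do rewrite h1.
  move=> fub; transitivity (\int[mu]_x
      (if x \in D1 then \int[mu]_(y in D2) (f x y)%:E else 0))%E.
    rewrite integral_mkcond; apply: eq_integral => x _.
    rewrite patchE; case: ifP => // /set_mem D1x.
    by rewrite EFin_rint//; exact: row1.
  rewrite fub [RHS]integral_mkcond; apply: eq_integral => y _.
  rewrite h2 patchE; case: ifP => // /set_mem D2y.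
  by rewrite EFin_rint//; exact: row2.
split; last by rewrite /Rintegral swap.
apply: itg_ge0_finite => //; first exact: rint_measurable.
  by move=> x D1x; apply: Rintegral_ge0 => y D2y; exact: f0.
by rewrite swap -EFin_rint// ltry.
Qed.

Variables u v : R -> R.
Hypotheses (iu : itg D1 u) (iv : itg D2 v).
Hypothesis fuv : forall x y, D1 x -> D2 y -> `|f x y| <= u x * v y.

(** A majorant in product form makes the double integral of the absolute value factor into two
    finite integrals. All kernels met later are bounded phases, so such a majorant is always at
    hand. [U] and [V] take absolute values because [u] and [v] have no assumed sign. *)
Let ih : (mu \x mu)%E.-integrable setT h.
Proof.
apply/(@integrable12ltyP _ _ _ _ _ mu mu h mh).
pose U := (fun x => `|u x|) \_ D1; pose V := (fun x => `|v x|) \_ D2.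
have iU : itg setT U.
  by rewrite /U -restrict_EFin; apply/integrable_restrict => //; rewrite setTI;
    exact: integrable_norm.
have iV : itg setT V.
  by rewrite /V -restrict_EFin; apply/integrable_restrict => //; rewrite setTI;
    exact: integrable_norm.
have U0 x : 0 <= U x by rewrite /U patchE; case: ifP.
have V0 x : 0 <= V x by rewrite /V patchE; case: ifP.
have hUV x y : (`|h (x, y)| <= (U x)%:E * (V y)%:E)%E.
  rewrite /h /U /V !patchE in_setX /=.
  case: ifPn => [/andP[xD yD]|]; last first.
    by rewrite normr0 -EFinM lee_fin => _; do 2?case: ifP => _; rewrite ?mulr0 ?mul0r.
  rewrite xD yD -EFinM lee_fin -normrM.
  by rewrite (le_trans (fuv _ _ _ _))// ?ler_norm//; exact: set_mem.
apply: (@le_lt_trans _ _ (\int[mu]_x ((U x)%:E * \int[mu]_y (V y)%:E))%E).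
  apply: ge0_le_integral => //.
  - by move=> x _; apply: integral_ge0.
  - apply: (mfub (fun p => `|h p|%E)) => //; exact: measurableT_comp.
  - rewrite -(EFin_rint setT V) //.
    apply/measurable_EFinP; apply: measurable_funM => //; exact: itg_meas iU.
  - move=> x _; rewrite -ge0_integralZl_EFin//.
    + apply: ge0_le_integral => //.
      * apply: measurableT_comp => //; apply: (measurableT_comp mh) => //.
      * by apply: emeasurable_funM => //; apply/measurable_EFinP; exact: itg_meas iV.
    + by move=> y _; rewrite lee_fin.
    + by apply/measurable_EFinP; exact: itg_meas iV.
have -> : (\int[mu]_x ((U x)%:E * \int[mu]_y (V y)%:E) =
          (rint setT (fun x => U x * rint setT V))%:E)%E.
  rewrite EFin_rint//; last first.
    by apply: eq_itg (itgZl setT (rint setT V) _ _ iU) => // x _; rewrite mulrC.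
  by apply: eq_integral => x _; rewrite -(EFin_rint setT V).
exact: ltry.
Qed.

Lemma rfubini : rint D1 (fun x => rint D2 (f x)) =
  rint D2 (fun y => rint D1 (f ^~ y)).
Proof.
have fub : (\int[mu]_x (if x \in D1 then \int[mu]_(y in D2) (f x y)%:E else 0) =
            \int[mu]_y (if y \in D2 then \int[mu]_(x in D1) (f x y)%:E else 0))%E.
  have := @Fubini _ _ _ _ _ mu mu h ih.
  by under eq_integral do rewrite h1; move=> ->; apply: eq_integral => y _; rewrite h2.
have row1 x : D1 x -> itg D2 (f x).
  move=> D1x; apply: (itg_dominated _ _ (fun y => u x * v y)) => //.
  - by apply: (meas2_row D1 D2).
  - by move=> y D2y; exact: fuv.
  - exact: itgZl.
have row2 y : D2 y -> itg D1 (f ^~ y).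
  move=> D2y; apply: (itg_dominated _ _ (fun x => v y * u x)) => //.
  - by apply: (meas2_col D1 D2).
  - by move=> x D1x; rewrite mulrC; exact: fuv.
  - exact: itgZl.
rewrite /Rintegral; transitivity (fine (\int[mu]_x
    (if x \in D1 then \int[mu]_(y in D2) (f x y)%:E else 0))%E).
  congr fine; rewrite integral_mkcond; apply: eq_integral => x _.
  rewrite patchE; case: ifP => // /set_mem D1x.
  by rewrite -EFin_rint//; exact: row1.
rewrite fub; congr fine; rewrite [RHS]integral_mkcond; apply: eq_integral => y _.
rewrite patchE; case: ifP => // /set_mem D2y.
by rewrite -EFin_rint//; exact: row2.
Qed.

End TwoVariables.

End RealIntegrals.

(** * The half line *)

Section HalfLine.
Context {R : realType}.
Local Notation mu := (@lebesgue_measure R).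
Local Notation itg D f := (mu.-integrable D (EFin \o (f : R -> R))).
Local Notation rint D f := (Rintegral mu D f).
Local Notation Rp := (@Rp R).
Implicit Types (D : set R) (f g u v F : R -> R).

Lemma RpE (x : R) : Rp x = (0 < x) :> Prop.
Proof. by rewrite /Defs.Rp /= in_itv /= andbT. Qed.

Lemma measurable_Rp : measurable (Rp : set R).
Proof. exact: measurable_itv. Qed.
Hint Resolve measurable_Rp : core.

(** The shift by 2 makes every interval nondegenerate, already for [k = 0]. The same intervals serve
    for improper integrals, for matching the damping rate, and as supports of test functions. *)
Definition compact_exhaustion (k : nat) : set R := `[(k.+2%:R)^-1, k.+2%:R]%classic.
Local Notation Ik := compact_exhaustion.

Lemma measurable_Ik k : measurable (Ik k : set R).
Proof. exact: measurable_itv. Qed.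
Hint Resolve measurable_Ik : core.

Lemma Ik_gt0 k (x : R) : Ik k x -> 0 < x.
Proof.
by rewrite /Ik /= in_itv /= => /andP[h _]; apply: lt_le_trans h; rewrite invr_gt0.
Qed.

Lemma Ik_sub k : Ik k `<=` Rp.
Proof. by move=> x /Ik_gt0; rewrite RpE. Qed.

Lemma mu_Ik k : (mu (Ik k) < +oo)%E.
Proof.
by rewrite /Ik lebesgue_measure_itv /=; case: ifP => _; rewrite -?EFinB ltry.
Qed.

Lemma near_Ik (x : R) : 0 < x -> \forall n \near \oo, Ik n x.
Proof.
move=> x0; near=> n; rewrite /Ik /= in_itv /=; apply/andP; split.
  rewrite -[leRHS]invrK lef_pV2 ?posrE ?invr_gt0//.
  apply: (@le_trans _ _ n%:R); last by rewrite ler_nat; exact: leqW (leqnSn n).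
  by near: n; exact: nbhs_infty_ger.
apply: (@le_trans _ _ n%:R); last by rewrite ler_nat; exact: leqW (leqnSn n).
by near: n; exact: nbhs_infty_ger.
Unshelve. all: by end_near. Qed.

Lemma nondecreasing_Ik : nondecreasing_seq (Ik : nat -> set R).
Proof.
move=> m n mn; apply/subsetPset => x; rewrite /Ik /= !in_itv /= => /andP[a b].
apply/andP; split.
  by apply: le_trans a; rewrite lef_pV2 ?posrE// ler_nat.
by apply: (le_trans b); rewrite ler_nat.
Qed.

Lemma bigcup_Ik : \bigcup_k Ik k = Rp.
Proof.
apply/seteqP; split; first by move=> x [k _]; exact: Ik_sub.
move=> x; rewrite RpE => /near_Ik [N _ /(_ N (leqnn N))] h.
by exists N.
Qed.

(** Monotone convergence; integrability on the half line is part of the conclusion, so a bound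
    uniform in [k] is enough to prove membership in L^2. *)
Lemma itg_Rp_exhaust f M : measurable_fun Rp f -> (forall x : R, 0 < x -> 0 <= f x) ->
  (forall k, itg (Ik k) f) -> (forall k, rint (Ik k) f <= M) ->
  itg Rp f /\ rint Rp f <= M.
Proof.
move=> mf f0 jf fM.
have lim : (\int[mu]_(x in Rp) (f x)%:E <= M%:E)%E.
  rewrite -bigcup_Ik.
  have cv : ((fun i => \int[mu]_(x in Ik i) (f x)%:E) @ \oo -->
      \int[mu]_(x in \bigcup_i Ik i) (f x)%:E)%E.
    apply: ge0_nondecreasing_set_cvg_integral => //.
    - exact: nondecreasing_Ik.
    - by move=> i; exact: measurable_Ik.
    - by move=> i; exact: (measurable_int mu (jf i)).
    - by move=> i x /Ik_gt0 x0; rewrite lee_fin f0.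
  rewrite -(cvg_lim _ cv)//; apply: lime_le; first exact: cvgP cv.
  by apply: nearW => i; rewrite -EFin_rint// lee_fin.
have jRp : itg Rp f.
  apply: itg_ge0_finite => //; last exact: le_lt_trans lim (ltry _).
  by move=> x; rewrite RpE; exact: f0.
by split => //; rewrite -lee_fin EFin_rint.
Qed.

Lemma measurable_fun_Rp_continuous f : (forall x : R, 0 < x -> {for x, continuous f}) ->
  measurable_fun Rp f.
Proof.
move=> cf; apply: open_continuous_measurable_fun; first exact: interval_open.
by move=> x; rewrite inE RpE => /cf.
Qed.

Lemma rint_FTC (a b : R) F f : a < b ->
  (forall x, a <= x <= b -> is_derive x 1 F (f x)) ->
  (forall x, a <= x <= b -> {for x, continuous f}) ->
  itg `[a, b] f /\ rint `[a, b] f = F b - F a.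
Proof.
move=> ab dF cf.
have wcf : {within `[a, b], continuous f}.
  apply/subspace_continuousP => z /=; rewrite in_itv /= => zab.
  by apply: cvg_within_filter; exact: cf.
have jf : itg `[a, b] f.
  by apply: continuous_compact_integrable => //; exact: segment_compact.
have cF x : a <= x <= b -> {for x, continuous F}.
  by move=> /dF h; apply: differentiable_continuous; apply/derivable1_diffP; exact: ex_derive.
split => //.
rewrite /Rintegral (@continuous_FTC2 _ f F a b) //.
- split.
  + by move=> x /[!in_itv]/= /andP[ax xb]; have := dF x; rewrite !ltW// => /(_ isT) h; exact: ex_derive.
  + by apply: cvg_at_right_filter; apply: cF; rewrite lexx ltW.
  + by apply: cvg_at_left_filter; apply: cF; rewrite lexx ltW.
- move=> x /[!in_itv]/= /andP[ax xb]; have := dF x; rewrite !ltW// => /(_ isT) h.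
  by rewrite derive1E; exact: derive_val.
Qed.

Lemma Ik_lt k : (k.+2%:R)^-1 < k.+2%:R :> R.
Proof.
apply: (@lt_trans _ _ 1); first by rewrite invf_lt1// ltr1n.
by rewrite ltr1n.
Qed.

(** The integrand may change sign, so integrability is a hypothesis: dominated convergence along the
    exhaustion then reduces the integral to the limits of [F] along the two sequences of
    endpoints. *)
Lemma rint_FTC_Rp F f (l0 l1 : R) :
  (forall x : R, 0 < x -> is_derive x 1 F (f x)) ->
  (forall x : R, 0 < x -> {for x, continuous f}) -> itg Rp f ->
  (fun n : nat => F n.+2%:R^-1) @ \oo --> l0 ->
  (fun n : nat => F n.+2%:R) @ \oo --> l1 ->
  rint Rp f = l1 - l0.
Proof.
move=> dF cf jf F0 F1.
have ft k : rint (Ik k) f = F k.+2%:R - F k.+2%:R^-1.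
  apply: (proj2 (@rint_FTC _ _ F f (Ik_lt k) _ _)).
  - by move=> x xk; apply: dF; apply: (@Ik_gt0 k); rewrite /Ik /= in_itv.
  - by move=> x xk; apply: cf; apply: (@Ik_gt0 k); rewrite /Ik /= in_itv.
have [||||_] := @rdct R Rp (fun n => f \_ (Ik n)) f (fun x => `|f x|) measurable_Rp.
- move=> n; apply/measurable_restrict => //.
  by apply: measurable_funS (itg_meas _ _ jf) => //; exact: subIsetl.
- exact: integrable_norm.
- by move=> n x _; rewrite patchE; case: ifP => // _; rewrite normr0.
- move=> x; rewrite RpE => /near_Ik nx.
  apply: cvg_near_cst; apply: filterS nx => n nx.
  by rewrite patchE mem_set.
move=> cv; apply: (cvg_unique _ cv) => //.
rewrite (_ : (fun n => _) = fun n => F n.+2%:R - F n.+2%:R^-1); first exact: cvgB.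
apply/funext => n; rewrite -ft -Rintegral_mkcondr; congr Rintegral.
by apply: setIidr; exact: Ik_sub.
Qed.

(** For a nonnegative integrand a bound on the increments of the antiderivative replaces its limits
    and yields integrability as well. It is used with exponential and arctangent antiderivatives;
    the range of the latter is where [pi] comes from. *)
Lemma rint_FTC_Rp_ge0 F f M :
  (forall x : R, 0 < x -> is_derive x 1 F (f x)) ->
  (forall x : R, 0 < x -> {for x, continuous f}) ->
  (forall x : R, 0 < x -> 0 <= f x) ->
  (forall x y : R, 0 < x -> 0 < y -> F y - F x <= M) ->
  itg Rp f /\ rint Rp f <= M.
Proof.
move=> dF cf f0 FM.
have ft k : itg (Ik k) f /\ rint (Ik k) f = F k.+2%:R - F k.+2%:R^-1.
  apply: rint_FTC; first exact: Ik_lt.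
  - by move=> x xk; apply: dF; apply: (@Ik_gt0 k); rewrite /Ik /= in_itv.
  - by move=> x xk; apply: cf; apply: (@Ik_gt0 k); rewrite /Ik /= in_itv.
apply: itg_Rp_exhaust => //.
- exact: measurable_fun_Rp_continuous.
- by move=> k; have [] := ft k.
- by move=> k; have [_ ->] := ft k; apply: FM; rewrite ?invr_gt0.
Qed.

End HalfLine.
#[export] Hint Resolve measurable_Rp measurable_Ik : core.

(** * Special integrals *)

Section DerivativeRules.
Context {R : realType}.
Implicit Types (f g : R -> R) (x df dg k : R).

Lemma dvcst k x : is_derive x 1 (fun _ : R => k) (0 : R).
Proof. exact: is_derive_cst. Qed.

Lemma dvid x : is_derive x 1 (fun y : R => y) (1 : R).
Proof. exact: is_derive_id. Qed.

Lemma dvD f g x df dg : is_derive x 1 f df -> is_derive x 1 g dg ->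
  is_derive x 1 (fun y => f y + g y) (df + dg).
Proof. by move=> hf hg; exact: is_deriveD. Qed.

Lemma dvN f x df : is_derive x 1 f df -> is_derive x 1 (fun y => - f y) (- df).
Proof. by move=> hf; exact: is_deriveN. Qed.

Lemma dvM f g x df dg : is_derive x 1 f df -> is_derive x 1 g dg ->
  is_derive x 1 (fun y => f y * g y) (f x * dg + g x * df).
Proof. by move=> hf hg; exact: is_deriveM. Qed.

Lemma dvcomp (h : R -> R) f x df dh : is_derive (f x) 1 h dh -> is_derive x 1 f df ->
  is_derive x 1 (fun y => h (f y)) (dh * df).
Proof. by move=> hh hf; exact: is_derive1_comp. Qed.

Lemma dvexp f x df : is_derive x 1 f df ->
  is_derive x 1 (fun y => expR (f y)) (expR (f x) * df).
Proof. exact: dvcomp. Qed.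

Lemma dvsin f x df : is_derive x 1 f df ->
  is_derive x 1 (fun y => sin (f y)) (cos (f x) * df).
Proof. exact: dvcomp. Qed.

Lemma dvcos f x df : is_derive x 1 f df ->
  is_derive x 1 (fun y => cos (f y)) (- sin (f x) * df).
Proof. exact: dvcomp. Qed.

Lemma dvatan f x df : is_derive x 1 f df ->
  is_derive x 1 (fun y => atan (f y)) ((1 + f x ^+ 2)^-1 * df).
Proof. exact: dvcomp. Qed.

Lemma dvln f x df : 0 < f x -> is_derive x 1 f df ->
  is_derive x 1 (fun y => ln (f y)) ((f x)^-1 * df).
Proof. by move=> f0; apply: dvcomp; exact: is_derive1_ln. Qed.

Lemma dvsqrt f x df : 0 < f x -> is_derive x 1 f df ->
  is_derive x 1 (fun y => Num.sqrt (f y)) ((2 * Num.sqrt (f x))^-1 * df).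
Proof. by move=> f0; apply: dvcomp; exact: is_derive1_sqrt. Qed.

Lemma derive_continuous f x df : is_derive x 1 f df -> {for x, continuous f}.
Proof.
by move=> h; apply: differentiable_continuous; apply/derivable1_diffP; exact: ex_derive.
Qed.

End DerivativeRules.

(** Meant for goals whose derivative is still an existential variable: the rules build it, and
    [is_derive_eq] or [derive_continuous] consumes it. Local hypotheses give the derivatives of
    abstract functions; the positivity conditions of [ln] and [sqrt] may remain as goals. *)
Ltac derivs := repeat first
  [ assumption | eassumption | eapply dvcst | eapply dvid | eapply dvD | eapply dvN | eapply dvM
  | eapply dvexp | eapply dvsin | eapply dvcos | eapply dvatan | eapply dvln
  | eapply dvsqrt ].

Section SpecialFunctions.
Context {R : realType}.
Local Notation mu := (@lebesgue_measure R).
Local Notation itg D f := (mu.-integrable D (EFin \o (f : R -> R))).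
Local Notation rint D f := (Rintegral mu D f).
Local Notation Rp := (@Rp R).

Lemma itg_expN (e : R) : 0 < e -> itg Rp (fun x => expR (- (e * x))).
Proof.
move=> e0; have e1 : e != 0 by rewrite gt_eqF.
apply: (proj1 (@rint_FTC_Rp_ge0 R (fun x => - (e^-1 * expR (- (e * x)))) _ e^-1 _ _ _ _)).
- by move=> x _; eapply is_derive_eq; [derivs|rewrite /=; field].
- move=> x _; eapply derive_continuous; derivs.
- by move=> x _; exact: expR_ge0.
- move=> x y x0 y0; rewrite opprK addrC -mulrBr ler_piMr ?invr_ge0 1?ltW//.
  have := expR_gt0 (- (e * y)); have : expR (- (e * x)) <= 1.
    by rewrite -expR0 ler_expR oppr_le0 mulr_ge0// ltW.
  lra.
Qed.

Lemma cvg_mul_bounded0 (u b : nat -> R) (M : R) : u @ \oo --> (0 : R) ->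
  (forall n, `|b n| <= M) -> (fun n => u n * b n) @ \oo --> (0 : R).
Proof.
move=> u0 bM.
have h : (fun n => `|u n| * M) @ \oo --> (0 : R).
  by rewrite -(mul0r M); apply: cvgM; [rewrite -(normr0 R); exact: cvg_norm|exact: cvg_cst].
apply: (squeeze_cvgr (f := fun n => - (`|u n| * M)) (h := fun n => `|u n| * M)) => //.
  apply: nearW => n; rewrite -ler_norml normrM.
  by rewrite ler_wpM2l.
by rewrite -oppr0; exact: cvgN.
Qed.

Lemma cvg_invn2 : (fun n : nat => (n.+2%:R : R)^-1) @ \oo --> (0 : R).
Proof.
apply: (squeeze_cvgr (f := fun=> 0) (h := fun n => n.+1%:R^-1)).
- by apply: nearW => n; rewrite invr_ge0 ler0n /= lef_pV2 ?posrE// ler_nat.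
- exact: cvg_cst.
- exact: cvg_harmonic.
Qed.

Definition poisson (e s : R) : R := e / (e ^+ 2 + s ^+ 2).

Lemma poisson_ge0 e s : 0 <= e -> 0 <= poisson e s.
Proof. by move=> e0; rewrite divr_ge0// addr_ge0// sqr_ge0. Qed.

Lemma continuous_poisson (e : R) : 0 < e -> continuous (poisson e).
Proof.
move=> e0 s; suff : {for s, continuous (fun t : R => e * (e ^+ 2 + t * t)^-1)} by [].
apply: continuousM; first exact: cst_continuous.
apply: continuousV; first by rewrite gt_eqF// ltr_pwDl// ?exprn_gt0// -expr2 sqr_ge0.
by apply: (@derive_continuous R (fun s => e ^+ 2 + s * s)); derivs.
Qed.

Lemma cvg_expN_nat (e : R) : 0 < e -> (fun n : nat => expR (- (e * n.+2%:R))) @ \oo --> (0 : R).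
Proof.
move=> e0.
apply: (squeeze_cvgr (f := fun=> 0) (h := fun n => e^-1 * n.+1%:R^-1)).
- apply: nearW => n; rewrite expR_ge0/=.
  have h : e * n.+1%:R <= expR (e * n.+2%:R).
    apply: le_trans (expR_ge1Dx _); rewrite -[leLHS]add0r lerD//.
    by rewrite ler_pM2l// ler_nat.
  rewrite expRN -invfM lef_pV2 ?posrE ?expR_gt0 ?mulr_gt0//.
- exact: cvg_cst.
- rewrite -[X in _ --> X](mulr0 e^-1); apply: cvgM; first exact: cvg_cst.
  exact: cvg_harmonic.
Qed.

Lemma itg_expN_cos (e s : R) : 0 < e -> itg Rp (fun x => expR (- (e * x)) * cos (x * s)).
Proof.
move=> e0; apply: (itg_dominated _ _ (fun x => expR (- (e * x)))) => //.
- apply: measurable_fun_Rp_continuous => x x0; eapply derive_continuous; derivs.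
- move=> x _; rewrite normrM ger0_norm ?expR_ge0// ler_piMr ?expR_ge0//.
  by rewrite ler_norml cos_geN1 cos_le1.
- exact: itg_expN.
Qed.

Lemma rint_expN_cos (e s : R) : 0 < e ->
  rint Rp (fun x => expR (- (e * x)) * cos (x * s)) = poisson e s.
Proof.
move=> e0; have d0 : e ^+ 2 + s ^+ 2 != 0.
  by rewrite gt_eqF// ltr_pwDl// ?exprn_gt0// sqr_ge0.
(* The real part of [e^((- e + i s) x) / (- e + i s)]. *)
pose F (x : R) := expR (- (e * x)) * ((s * sin (x * s) - e * cos (x * s)) / (e ^+ 2 + s ^+ 2)).
transitivity (0 - - poisson e s); last by rewrite sub0r opprK.
apply: (@rint_FTC_Rp R F).
- by move=> x _; eapply is_derive_eq; [rewrite /F; derivs|rewrite /=; field].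
- move=> x _; eapply derive_continuous; derivs.
- exact: itg_expN_cos.
- rewrite (_ : - poisson e s = F 0); last first.
    by rewrite /F /poisson mulr0 oppr0 expR0 mul0r sin0 cos0; field.
  apply: (@continuous_cvg _ _ _ _ _ (fun n : nat => (n.+2%:R : R)^-1) F 0).
    by eapply derive_continuous; rewrite /F; derivs.
  exact: cvg_invn2.
- apply: (@cvg_mul_bounded0 _ _ ((`|s| + e) / (e ^+ 2 + s ^+ 2))).
  + exact: cvg_expN_nat.
  + move=> n; rewrite normrM [`|_^-1|]ger0_norm ?invr_ge0 ?addr_ge0 ?sqr_ge0//.
    rewrite ler_wpM2r ?invr_ge0 ?addr_ge0 ?sqr_ge0//.
    apply: (le_trans (ler_normB _ _)); rewrite !normrM lerD//.
      by rewrite ler_piMr// ler_norml sin_geN1 sin_le1.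
    by rewrite (gtr0_norm e0) ler_piMr ?(ltW e0)// ler_norml cos_geN1 cos_le1.
Qed.

(** The integrand is the derivative of [atan ((phi x - c) / e)], whose increments stay below [pi]
    whatever [c] and [e] are. Uniformity in [e] is what later lets the damping be removed. *)
Lemma poisson_kernel_bound (phi w : R -> R) (c e : R) : 0 < e ->
  (forall x : R, 0 < x -> is_derive x 1 phi (w x)) ->
  (forall x : R, 0 < x -> {for x, continuous w}) ->
  (forall x : R, 0 < x -> 0 <= w x) ->
  itg Rp (fun x => w x * poisson e (c - phi x)) /\
  rint Rp (fun x => w x * poisson e (c - phi x)) <= pi.
Proof.
move=> e0 dphi cw w0; have e1 : e != 0 by rewrite gt_eqF.
apply: (@rint_FTC_Rp_ge0 R (fun x => atan (e^-1 * (phi x - c)))).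
- move=> x x0; have dx := dphi _ x0; eapply is_derive_eq; [derivs|].
  rewrite /poisson /=; field; rewrite e1 /=.
  by rewrite !gt_eqF// ltr_pwDl// ?exprn_gt0// sqr_ge0.
- move=> x x0; apply: continuousM; first exact: cw.
  apply: (@continuous_comp _ _ _ (fun x => c - phi x) (poisson e)); last exact: continuous_poisson.
  by have dx := dphi _ x0; eapply derive_continuous; derivs.
- by move=> x x0; rewrite mulr_ge0 ?w0// poisson_ge0// ltW.
- move=> x y _ _; have := atan_gtNpi2 (e^-1 * (phi x - c)).
  have := atan_ltpi2 (e^-1 * (phi y - c)); lra.
Qed.

(** The derivative of [2 * atan (sqrt t)]: one integrable majorant, singular like [t^(- 1/2)] at 0,
    for all damped Mellin and Gamma integrands. *)
Definition gamma_bound (t : R) : R := (Num.sqrt t * (1 + t))^-1.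

Lemma itg_gamma_bound : itg Rp gamma_bound.
Proof.
apply: (proj1 (@rint_FTC_Rp_ge0 R (fun x => 2 * atan (Num.sqrt x)) _ (2 * pi) _ _ _ _)).
- move=> x x0; eapply is_derive_eq; [derivs|] => //.
  have s0 : 0 < Num.sqrt x by rewrite sqrtr_gt0.
  rewrite /gamma_bound /= sqr_sqrtr ?ltW//; field.
  by rewrite !gt_eqF// addr_gt0.
- move=> x x0; apply: continuousV.
    by rewrite gt_eqF// mulr_gt0 ?sqrtr_gt0 ?addr_gt0.
  by eapply derive_continuous; derivs.
- by move=> x x0; rewrite invr_ge0 mulr_ge0 ?sqrtr_ge0// addr_ge0// ltW.
- move=> x y _ _; have := atan_gtNpi2 (Num.sqrt x).
  have := atan_ltpi2 (Num.sqrt y); lra.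
Qed.

End SpecialFunctions.

Local Open Scope complex_scope.

(** * Complex-valued integrals *)

Section ComplexIntegrals.
Context {R : realType}.
Local Notation C := R[i].
Local Notation mu := (@lebesgue_measure R).
Local Notation itg D f := (mu.-integrable D (EFin \o (f : R -> R))).
Local Notation rint D f := (Rintegral mu D f).
Local Notation Rp := (@Rp R).
Implicit Types (D : set R) (f g : R -> C) (z w : C) (r : R).

Lemma cext z w : cre z = cre w -> cim z = cim w -> z = w.
Proof. by case: z w => [a b] [c d] /= -> ->. Qed.

Lemma creD z w : cre (z + w) = cre z + cre w. Proof. by case: z w => [a b] [c d]. Qed.
Lemma cimD z w : cim (z + w) = cim z + cim w. Proof. by case: z w => [a b] [c d]. Qed.
Lemma creN z : cre (- z) = - cre z. Proof. by case: z. Qed.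
Lemma cimN z : cim (- z) = - cim z. Proof. by case: z. Qed.
Lemma creM z w : cre (z * w) = cre z * cre w - cim z * cim w.
Proof. by case: z w => [a b] [c d]. Qed.
Lemma cimM z w : cim (z * w) = cre z * cim w + cim z * cre w.
Proof. by case: z w => [a b] [c d]. Qed.
Definition creimE := (creD, cimD, creN, cimN, creM, cimM).

(** Subadditive and submultiplicative without square roots, and it dominates both components, so
    complex estimates reduce to real ones. It is equivalent to the modulus; the factors of 2 that
    accumulate below come from this choice. *)
Definition norm1 z : R := `|cre z| + `|cim z|.

Lemma norm1_ge0 z : 0 <= norm1 z. Proof. exact: addr_ge0. Qed.
Hint Resolve norm1_ge0 : core.

Lemma norm1_re z : `|cre z| <= norm1 z. Proof. by rewrite lerDl. Qed.
Lemma norm1_im z : `|cim z| <= norm1 z. Proof. by rewrite lerDr. Qed.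

Lemma norm1D z w : norm1 (z + w) <= norm1 z + norm1 w.
Proof.
rewrite /norm1 !creimE addrACA lerD//; exact: ler_normD.
Qed.

Lemma norm1N z : norm1 (- z) = norm1 z.
Proof. by rewrite /norm1 !creimE !normrN. Qed.

Lemma norm1M z w : norm1 (z * w) <= norm1 z * norm1 w.
Proof.
rewrite /norm1 !creimE mulrDl !mulrDr -!normrM.
rewrite [leRHS](_ : _ = (`|cre z * cre w| + `|cim z * cim w|) +
  (`|cre z * cim w| + `|cim z * cre w|)); last by ring.
by rewrite lerD// ?ler_normB ?ler_normD.
Qed.

Lemma norm1_real r : norm1 r%:C = `|r|.
Proof. by rewrite /norm1 /= normr0 addr0. Qed.

Lemma norm1_expi r : norm1 (expi r) <= 2.
Proof.
by rewrite /norm1 /= [leRHS](_ : _ = 1 + 1)// lerD// ler_norml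
  ?cos_geN1 ?cos_le1 ?sin_geN1 ?sin_le1.
Qed.

Lemma norm1_le_mul z w (a b : R) : norm1 z <= a -> norm1 w <= b -> norm1 (z * w) <= a * b.
Proof. by move=> za wb; apply: (le_trans (norm1M _ _)); exact: ler_pM. Qed.

Lemma norm1_mul_expi z r : norm1 (z * expi r) <= 2 * norm1 z.
Proof. by rewrite mulrC; apply: norm1_le_mul => //; exact: norm1_expi. Qed.

Lemma cnorm2_ge0 z : 0 <= cnorm2 z.
Proof. by rewrite addr_ge0// sqr_ge0. Qed.
Hint Resolve cnorm2_ge0 : core.

Lemma cnorm2M z w : cnorm2 (z * w) = cnorm2 z * cnorm2 w.
Proof. by rewrite /cnorm2 !creimE; ring. Qed.

Lemma cnorm2_real r : cnorm2 r%:C = r ^+ 2.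
Proof. by rewrite /cnorm2 /= expr0n addr0. Qed.

Lemma cnorm2_expi r : cnorm2 (expi r) = 1.
Proof. by rewrite /cnorm2 /= cos2Dsin2. Qed.

Lemma cnorm2_le_norm1 z : cnorm2 z <= norm1 z ^+ 2.
Proof.
rewrite /cnorm2 /norm1 sqrrD !real_normK ?num_real// addrAC lerDl.
by rewrite mulrn_wge0// mulr_ge0.
Qed.

Lemma norm1_le_cnorm2 z : norm1 z ^+ 2 <= 2 * cnorm2 z.
Proof.
rewrite /cnorm2 -(real_normK (num_real (cre z))) -(real_normK (num_real (cim z))) /norm1.
have := sqr_ge0 (`|cre z| - `|cim z|); nra.
Qed.

Lemma norm1_le_sqrt z : norm1 z <= 2 * Num.sqrt (cnorm2 z).
Proof.
rewrite -(ler_pXn2r (n := 2))// ?nnegrE ?mulr_ge0 ?sqrtr_ge0// exprMn sqr_sqrtr//.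
apply: (le_trans (norm1_le_cnorm2 z)); rewrite ler_wpM2r//.
by rewrite expr2 ler_peMr ?ler1n// ler1n.
Qed.

Lemma sqrt_cnorm2_le z : Num.sqrt (cnorm2 z) <= norm1 z.
Proof.
by rewrite -(ger0_norm (norm1_ge0 z)) -sqrtr_sqr ler_wsqrtr// cnorm2_le_norm1.
Qed.

(** Unfolds to [cmeasurable] on the line, but its domain is any measurable type, because kernels
    live on [R * R]. *)
Definition cmeas {d} {T : measurableType d} (D : set T) (f : T -> C) : Prop :=
  measurable_fun D (fun t => cre (f t)) /\ measurable_fun D (fun t => cim (f t)).

Section Measurability.
Context d (T : measurableType d) (D : set T).
Implicit Types (h k : T -> C) (q : T -> R).

Lemma cmeasM h k : cmeas D h -> cmeas D k -> cmeas D (fun t => h t * k t).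
Proof.
move=> [h1 h2] [k1 k2]; split.
  under eq_fun do rewrite creM.
  by apply: measurable_funB; exact: measurable_funM.
under eq_fun do rewrite cimM.
by apply: measurable_funD; exact: measurable_funM.
Qed.

Lemma cmeasB h k : cmeas D h -> cmeas D k -> cmeas D (fun t => h t - k t).
Proof.
move=> [h1 h2] [k1 k2]; split.
  by under eq_fun do rewrite creD creN; exact: measurable_funB.
by under eq_fun do rewrite cimD cimN; exact: measurable_funB.
Qed.

Lemma cmeas_cst z : cmeas D (fun=> z).
Proof. by split; exact: measurable_cst. Qed.

Lemma cmeas_real q : measurable_fun D q -> cmeas D (fun t => (q t)%:C).
Proof. by move=> mq; split => //; exact: measurable_cst. Qed.

Lemma cmeas_expi q : measurable_fun D q -> cmeas D (fun t => expi (q t)).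
Proof.
move=> mq; split => /=.
  by apply: (measurableT_comp _ mq); apply: continuous_measurable_fun; exact: continuous_cos.
by apply: (measurableT_comp _ mq); apply: continuous_measurable_fun; exact: continuous_sin.
Qed.

Lemma cmeas_cnorm2 h : cmeas D h -> measurable_fun D (fun t => cnorm2 (h t)).
Proof. by move=> [h1 h2]; apply: measurable_funD; exact: measurable_funX. Qed.

Lemma cmeas_norm1 h : cmeas D h -> measurable_fun D (fun t => norm1 (h t)).
Proof. by move=> [h1 h2]; apply: measurable_funD; exact: measurableT_comp. Qed.

End Measurability.

Lemma cmeas_fst (D1 D2 : set R) f : measurable D1 -> measurable D2 ->
  cmeas D1 f -> cmeas (D1 `*` D2) (fun p : R * R => f p.1).
Proof.
move=> m1 m2 [h1 h2]; split.
  exact: (meas2_fst _ _ (fun t => cre (f t))).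
exact: (meas2_fst _ _ (fun t => cim (f t))).
Qed.

Lemma cmeas_snd (D1 D2 : set R) f : measurable D1 -> measurable D2 ->
  cmeas D2 f -> cmeas (D1 `*` D2) (fun p : R * R => f p.2).
Proof.
move=> m1 m2 [h1 h2]; split.
  exact: (meas2_snd _ _ (fun t => cre (f t))).
exact: (meas2_snd _ _ (fun t => cim (f t))).
Qed.

Lemma cmeas_row (D1 D2 : set R) (F : R -> R -> C) x : measurable D1 -> measurable D2 ->
  cmeas (D1 `*` D2) (fun p : R * R => F p.1 p.2) -> D1 x -> cmeas D2 (F x).
Proof.
move=> m1 m2 [h1 h2] D1x; split.
  exact: (meas2_row _ _ (fun x y => cre (F x y)) x m1 m2 h1).
exact: (meas2_row _ _ (fun x y => cim (F x y)) x m1 m2 h2).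
Qed.

Lemma cmeas_col (D1 D2 : set R) (F : R -> R -> C) y : measurable D1 -> measurable D2 ->
  cmeas (D1 `*` D2) (fun p : R * R => F p.1 p.2) -> D2 y -> cmeas D1 (F ^~ y).
Proof.
move=> m1 m2 [h1 h2] D2y; split.
  exact: (meas2_col _ _ (fun x y => cre (F x y)) y m1 m2 h1).
exact: (meas2_col _ _ (fun x y => cim (F x y)) y m1 m2 h2).
Qed.

Definition cintegrable D f := itg D (fun t => cre (f t)) /\ itg D (fun t => cim (f t)).

Lemma cintegrable_dominated D f (u : R -> R) : measurable D -> cmeas D f ->
  (forall x, D x -> norm1 (f x) <= u x) -> itg D u -> cintegrable D f.
Proof.
move=> mD [m1 m2] fu iu; split; apply: (itg_dominated _ _ u) => // x Dx;
  apply: le_trans (fu x Dx); [exact: norm1_re|exact: norm1_im].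
Qed.

Lemma eq_cint D f g : (forall x, D x -> f x = g x) -> cint D f = cint D g.
Proof.
by move=> fg; congr cmk; apply: eq_rint => x Dx; rewrite fg.
Qed.

Lemma cintZl D z f : measurable D -> cintegrable D f ->
  cint D (fun x => z * f x) = z * cint D f.
Proof.
move=> mD [f1 f2]; apply: cext; rewrite !creimE /=.
  under eq_Rintegral do rewrite creM.
  by rewrite RintegralB ?RintegralZl//; exact: itgZl.
under eq_Rintegral do rewrite cimM.
by rewrite RintegralD ?RintegralZl//; exact: itgZl.
Qed.

Lemma cintZr D z f : measurable D -> cintegrable D f ->
  cint D (fun x => f x * z) = cint D f * z.
Proof.
by move=> mD jf; rewrite mulrC -cintZl//; apply: eq_cint => x _; rewrite mulrC.
Qed.

Lemma cintB D f g : measurable D -> cintegrable D f -> cintegrable D g ->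
  cint D (fun x => f x - g x) = cint D f - cint D g.
Proof.
move=> mD [f1 f2] [g1 g2]; apply: cext; rewrite !creimE /=.
  by under eq_Rintegral do rewrite creD creN; rewrite RintegralB.
by under eq_Rintegral do rewrite cimD cimN; rewrite RintegralB.
Qed.

Lemma norm1_cint_le D f (u : R -> R) : measurable D -> cmeas D f ->
  (forall x, D x -> norm1 (f x) <= u x) -> itg D u ->
  norm1 (cint D f) <= 2 * rint D u.
Proof.
move=> mD [m1 m2] fu iu; rewrite mulrDl mul1r lerD//; apply: rint_norm_le => // x Dx;
  apply: le_trans (fu x Dx); [exact: norm1_re|exact: norm1_im].
Qed.

Lemma cint_measurable (D1 D2 : set R) (F : R -> R -> C) : measurable D1 -> measurable D2 ->
  cmeas (D1 `*` D2) (fun p : R * R => F p.1 p.2) ->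
  cmeas D1 (fun x => cint D2 (F x)).
Proof.
move=> m1 m2 [h1 h2]; split => /=.
  exact: (rint_measurable _ _ (fun x y => cre (F x y))).
exact: (rint_measurable _ _ (fun x y => cim (F x y))).
Qed.

Lemma cfubini (D1 D2 : set R) (F : R -> R -> C) (u v : R -> R) :
  measurable D1 -> measurable D2 ->
  cmeas (D1 `*` D2) (fun p : R * R => F p.1 p.2) ->
  itg D1 u -> itg D2 v ->
  (forall x y, D1 x -> D2 y -> norm1 (F x y) <= u x * v y) ->
  cint D1 (fun x => cint D2 (F x)) = cint D2 (fun y => cint D1 (F ^~ y)).
Proof.
move=> m1 m2 [h1 h2] iu iv Fuv; apply: cext => /=.
  apply: (rfubini _ _ (fun x y => cre (F x y)) _ _ _ u v) => // x y D1x D2y.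
  exact: le_trans (norm1_re _) (Fuv _ _ D1x D2y).
apply: (rfubini _ _ (fun x y => cim (F x y)) _ _ _ u v) => // x y D1x D2y.
exact: le_trans (norm1_im _) (Fuv _ _ D1x D2y).
Qed.

Definition ccvg (u : nat -> C) z :=
  (fun n => cre (u n)) @ \oo --> cre z /\ (fun n => cim (u n)) @ \oo --> cim z.

Lemma ccvg_unique u z w : ccvg u z -> ccvg u w -> z = w.
Proof. by move=> [a b] [c d]; apply: cext; [apply: cvg_unique a c|apply: cvg_unique b d]. Qed.

Lemma ccvg_cst z : ccvg (fun=> z) z.
Proof. by split; exact: cvg_cst. Qed.

Lemma ccvgM u v z w : ccvg u z -> ccvg v w -> ccvg (fun n => u n * v n) (z * w).
Proof.
move=> [a b] [c d]; split.
  by rewrite creM; under eq_cvg do rewrite creM; apply: cvgB; exact: cvgM.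
by rewrite cimM; under eq_cvg do rewrite cimM; apply: cvgD; exact: cvgM.
Qed.

Lemma ccvg_real (q : nat -> R) r : q @ \oo --> r -> ccvg (fun n => (q n)%:C) r%:C.
Proof. by move=> h; split => //=; exact: cvg_cst. Qed.

Lemma ccvg_expi (q : nat -> R) r : q @ \oo --> r -> ccvg (fun n => expi (q n)) (expi r).
Proof.
move=> h; split => /=.
  by apply: (@continuous_cvg _ _ _ _ _ q cos r) => //; exact: continuous_cos.
by apply: (@continuous_cvg _ _ _ _ _ q sin r) => //; exact: continuous_sin.
Qed.

Lemma ccvg_squeeze (u : nat -> C) z (e : nat -> R) :
  (forall n, norm1 (u n - z) <= e n) -> e @ \oo --> (0 : R) -> ccvg u z.
Proof.
move=> ue e0; split; apply/cvgrPdist_le => eps eps0;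
  have := e0; move=> /cvgr0Pnorm_le /(_ _ eps0); apply: filterS => n en;
  rewrite distrC; apply: le_trans en; apply: (le_trans _ (ler_norm _));
  apply: le_trans (ue n).
  by rewrite -creN -creD norm1_re.
by rewrite -cimN -cimD norm1_im.
Qed.

Lemma cdct D (fs : nat -> R -> C) f (u : R -> R) : measurable D ->
  (forall n, cmeas D (fs n)) -> itg D u ->
  (forall n x, D x -> norm1 (fs n x) <= u x) ->
  (forall x, D x -> ccvg (fun n => fs n x) (f x)) ->
  ccvg (fun n => cint D (fs n)) (cint D f).
Proof.
move=> mD mfs iu fu cv; split => /=.
  apply: (proj2 (@rdct _ D (fun n x => cre (fs n x)) _ u mD _ iu _ _)).
  - by move=> n; case: (mfs n).
  - by move=> n x Dx; apply: le_trans (fu n x Dx); exact: norm1_re.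
  - by move=> x /cv [].
apply: (proj2 (@rdct _ D (fun n x => cim (fs n x)) _ u mD _ iu _ _)).
- by move=> n; case: (mfs n).
- by move=> n x Dx; apply: le_trans (fu n x Dx); exact: norm1_im.
- by move=> x /cv [].
Qed.

End ComplexIntegrals.
#[export] Hint Resolve norm1_ge0 cnorm2_ge0 : core.

(** * Energy of oscillatory integrals *)

Section Bessel.
Context {R : realType}.
Local Notation mu := (@lebesgue_measure R).
Local Notation itg D f := (mu.-integrable D (EFin \o (f : R -> R))).
Local Notation rint D f := (Rintegral mu D f).
Local Notation Rp := (@Rp R).
Variables (a b phi w : R -> R).
Hypothesis ia : itg Rp a.
Hypothesis ib : itg Rp b.
Hypothesis b0 : forall x : R, 0 < x -> 0 <= b x.
Hypothesis w0 : forall x : R, 0 < x -> 0 <= w x.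
Hypothesis abw : forall x : R, 0 < x -> a x ^+ 2 <= b x * w x.
Hypothesis dphi : forall x : R, 0 < x -> is_derive x 1 phi (w x).
Hypothesis cw : forall x : R, 0 < x -> {for x, continuous w}.

Let A m := rint Rp (fun x => a x * cos (m * phi x)).
Let B m := rint Rp (fun x => a x * sin (m * phi x)).
Definition trig_energy (m : R) := A m ^+ 2 + B m ^+ 2.
Let H := trig_energy.
Let N := rint Rp (fun x => `|a x|).

Let ma : measurable_fun Rp a. Proof. exact: itg_meas ia. Qed.
Let mb : measurable_fun Rp b. Proof. exact: itg_meas ib. Qed.
Let mphi : measurable_fun Rp phi.
Proof. by apply: measurable_fun_Rp_continuous => x /dphi; exact: derive_continuous. Qed.
Let mw : measurable_fun Rp w.
Proof. exact: measurable_fun_Rp_continuous. Qed.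

Let mcos : measurable_fun setT (@cos R).
Proof. apply: continuous_measurable_fun; exact: continuous_cos. Qed.
Let msin : measurable_fun setT (@sin R).
Proof. apply: continuous_measurable_fun; exact: continuous_sin. Qed.

Let Rp2 := Rp `*` Rp.
Let m1 (f : R -> R) : measurable_fun Rp f -> measurable_fun Rp2 (fun p : R * R => f p.1).
Proof. exact: meas2_fst. Qed.
Let m2 (f : R -> R) : measurable_fun Rp f -> measurable_fun Rp2 (fun p : R * R => f p.2).
Proof. exact: meas2_snd. Qed.
Let mid : measurable_fun Rp (fun x : R => x).
Proof. exact: measurable_id. Qed.

Let itrig (t : R -> R) (g : R -> R) : (forall x, `|t x| <= 1) -> measurable_fun setT t ->
  measurable_fun Rp g -> itg Rp (fun x => a x * t (g x)).
Proof. by move=> t1 mt mg; apply: itgM_bounded1 => //; exact: measurableT_comp. Qed.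

Let cos1 (x : R) : `|cos x| <= 1. Proof. by rewrite ler_norml cos_geN1 cos_le1. Qed.
Let sin1 (x : R) : `|sin x| <= 1. Proof. by rewrite ler_norml sin_geN1 sin_le1. Qed.

Let mscale m : measurable_fun Rp (fun x => m * phi x).
Proof. by apply: measurable_funM => //; exact: measurable_cst. Qed.

Let iacos m : itg Rp (fun x => a x * cos (m * phi x)).
Proof. exact: (itrig cos). Qed.
Let iasin m : itg Rp (fun x => a x * sin (m * phi x)).
Proof. exact: (itrig sin). Qed.

Let AN m : `|A m| <= N.
Proof.
apply: rint_norm_le => //; first exact: itg_meas.
- exact: integrable_norm.
- by move=> x _; rewrite normrM ler_piMr.
Qed.
Let BN m : `|B m| <= N.
Proof.
apply: rint_norm_le => //; first exact: itg_meas.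
- exact: integrable_norm.
- by move=> x _; rewrite normrM ler_piMr.
Qed.

Let ABN m (s t : R) : `|A m * cos s + B m * sin t| <= 2 * N.
Proof.
rewrite (le_trans (ler_normD _ _))// mulrDl mul1r !normrM lerD//.
  by apply: le_trans (AN m); rewrite ler_piMr.
by apply: le_trans (BN m); rewrite ler_piMr.
Qed.

Let mprod : measurable_fun Rp2 (fun p : R * R => p.1 * phi p.2).
Proof. by apply: measurable_funM; [exact: (m1 (fun x => x))|exact: m2]. Qed.

Let mA : measurable_fun Rp A.
Proof.
apply: (rint_measurable _ _ (fun m x => a x * cos (m * phi x))) => //.
by apply: measurable_funM; [exact: m2|exact: (measurableT_comp mcos mprod)].
Qed.
Let mB : measurable_fun Rp B.
Proof.
apply: (rint_measurable _ _ (fun m x => a x * sin (m * phi x))) => //.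
by apply: measurable_funM; [exact: m2|exact: (measurableT_comp msin mprod)].
Qed.

Lemma measurable_trig_energy : measurable_fun Rp H.
Proof. by apply: measurable_funD; exact: measurable_funX. Qed.

Lemma trig_energy_ge0 m : 0 <= H m.
Proof. by rewrite addr_ge0// sqr_ge0. Qed.

Let H_le m : `|H m| <= 2 * N ^+ 2.
Proof.
rewrite ger0_norm ?trig_energy_ge0// /H /trig_energy.
rewrite -(real_normK (num_real (A m))) -(real_normK (num_real (B m))).
by rewrite mulrDl mul1r lerD// lerXn2r// ?nnegrE// ?(le_trans _ (AN m)).
Qed.

Let mexp (e : R) : measurable_fun Rp (fun m => expR (- (e * m))).
Proof. by apply: measurable_fun_Rp_continuous => x x0; eapply derive_continuous; derivs. Qed.

Let iexpM (e M : R) (f : R -> R) : 0 < e -> measurable_fun Rp f -> (forall m, `|f m| <= M) ->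
  itg Rp (fun m => expR (- (e * m)) * f m).
Proof.
move=> e0 mf fM; apply: (itg_dominated _ _ (fun m => M * expR (- (e * m)))) => //.
- exact: measurable_funM.
- by move=> m _; rewrite normrM ger0_norm ?expR_ge0// mulrC ler_wpM2r ?expR_ge0.
- exact: itgZl (itg_expN _ e0).
Qed.

Local Hint Resolve iacos iasin : core.

Let Q e x := rint Rp (fun y => a y * poisson e (phi x - phi y)).

Let HE m : H m = rint Rp (fun x => a x * (A m * cos (m * phi x) + B m * sin (m * phi x))).
Proof.
rewrite (@eq_rint _ Rp _ (fun x => A m * (a x * cos (m * phi x)) + B m * (a x * sin (m * phi x)))).
  rewrite rintD ?rintZl//.
    exact: (itgZl _ _ _ _ (iacos m)).
  exact: (itgZl _ _ _ _ (iasin m)).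
by move=> x _; ring.
Qed.

Let innerE m x : A m * cos (m * phi x) + B m * sin (m * phi x) =
  rint Rp (fun y => a y * cos (m * (phi x - phi y))).
Proof.
rewrite -rintZr// -rintZr// -rintD//; last first.
- exact: (itgZr _ _ _ _ (iasin m)).
- exact: (itgZr _ _ _ _ (iacos m)).
by apply: eq_rint => y _; rewrite mulrBr cosB; ring.
Qed.

(** The square is opened one factor at a time, [HE] for the first and [innerE] for the second, which
    produces [cos (m * (phi x - phi y))]. The factor [expR (- (e * m))] makes both exchanges with
    the integral in [m] absolutely convergent, and that integral is [rint_expN_cos]. *)
Let energy_poisson e : 0 < e ->
  rint Rp (fun m => expR (- (e * m)) * H m) = rint Rp (fun x => a x * Q e x).
Proof.
move=> e0.
transitivity (rint Rp (fun m => rint Rp (fun x =>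
    expR (- (e * m)) * (a x * (A m * cos (m * phi x) + B m * sin (m * phi x)))))).
  apply: eq_rint => m _; rewrite HE rintZl//.
  apply: eq_itg (itgD _ _ _ _ (itgZl _ (A m) _ _ (iacos m)) (itgZl _ (B m) _ _ (iasin m))) => // x _.
  by ring.
rewrite (rfubini _ _ _ _ _ _ (fun m => expR (- (e * m))) (fun x => 2 * N * `|a x|)) //; last 4 first.
- apply: measurable_funM; first exact: (m1 (fun m => expR (- (e * m)))).
  apply: measurable_funM; first exact: m2.
  apply: measurable_funD; apply: measurable_funM; try exact: m1.
    exact: (measurableT_comp mcos mprod).
  exact: (measurableT_comp msin mprod).
- exact: itg_expN.
- by apply: itgZl => //; exact: integrable_norm.
- move=> m x _ _; rewrite normrM ger0_norm ?expR_ge0// ler_wpM2l ?expR_ge0//.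
  by rewrite normrM mulrC ler_wpM2r.
apply: eq_rint => x _.
transitivity (a x * rint Rp (fun m => rint Rp (fun y =>
    expR (- (e * m)) * (a y * cos (m * (phi x - phi y)))))).
  rewrite -rintZl//; last first.
    apply: (eq_itg _ (fun m => expR (- (e * m)) * (A m * cos (m * phi x) + B m * sin (m * phi x)))) => //.
      move=> m _; rewrite innerE rintZl//; apply: (itrig cos) => //.
      by apply: measurable_funM => //; apply: measurable_funB => //; exact: measurable_cst.
    apply: (iexpM _ (2 * N)) => //.
      by apply: measurable_funD; apply: measurable_funM => //;
        [apply: (measurableT_comp mcos)|apply: (measurableT_comp msin)];
        apply: measurable_funM.
  apply: eq_rint => m _; rewrite innerE rintZl//; first by ring.
  apply: (itrig cos) => //.
  by apply: measurable_funM => //; apply: measurable_funB => //; exact: measurable_cst.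
congr (_ * _).
rewrite (rfubini _ _ _ _ _ _ (fun m => expR (- (e * m))) (fun x => `|a x|)) //; last 4 first.
- apply: measurable_funM; first exact: (m1 (fun m => expR (- (e * m)))).
  apply: measurable_funM; first exact: m2.
  apply: (measurableT_comp mcos); apply: measurable_funM; first exact: (m1 (fun m => m)).
  by apply: measurable_funB; [exact: measurable_cst|exact: m2].
- exact: itg_expN.
- exact: integrable_norm.
- move=> m y _ _; rewrite normrM ger0_norm ?expR_ge0// ler_wpM2l ?expR_ge0//.
  by rewrite normrM ler_piMr.
apply: eq_rint => y _; rewrite -rint_expN_cos// -rintZl//; last exact: itg_expN_cos.
by apply: eq_rint => m _; ring.
Qed.

Let poissonN (e s : R) : poisson e (- s) = poisson e s.
Proof. by rewrite /poisson sqrrN. Qed.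

Let poisson_le (e s : R) : 0 < e -> poisson e s <= e^-1.
Proof.
move=> e0; have d0 : 0 < e ^+ 2 + s ^+ 2 by rewrite ltr_pwDl ?exprn_gt0 ?sqr_ge0.
rewrite /poisson ler_pdivrMr// mulrC ler_pdivlMr// -expr2 lerDl sqr_ge0 //.
Qed.

Let mpoisson e : 0 < e -> measurable_fun setT (poisson e : R -> R).
Proof.
move=> e0; apply: continuous_measurable_fun; exact: continuous_poisson.
Qed.

(** Schur's test with weight [w]: [|a x * a y|] is at most half of [b x * w y + b y * w x], and in
    either term the integral of [w] against the Poisson kernel costs at most [pi]. *)
Let poisson_schur e : 0 < e -> rint Rp (fun x => a x * Q e x) <= pi * rint Rp b.
Proof.
move=> e0.
pose K y := rint Rp (fun x => w x * poisson e (phi y - phi x)).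
have iK y : itg Rp (fun x => w x * poisson e (phi y - phi x)).
  by have [] := poisson_kernel_bound phi w (phi y) e.
have K_le y : K y <= pi by have [] := poisson_kernel_bound phi w (phi y) e.
have K0 y : 0 <= K y.
  by apply: Rintegral_ge0 => x; rewrite RpE => x0; rewrite mulr_ge0 ?w0 ?poisson_ge0 ?ltW.
have mpc c : measurable_fun Rp (fun y => poisson e (c - phi y)).
  by apply: (measurableT_comp (mpoisson _ e0)); apply: measurable_funB => //;
    exact: measurable_cst.
have mp2 : measurable_fun Rp2 (fun p : R * R => poisson e (phi p.1 - phi p.2)).
  by apply: (measurableT_comp (mpoisson _ e0)); apply: measurable_funB; [exact: m1|exact: m2].
have mp2' : measurable_fun Rp2 (fun p : R * R => poisson e (phi p.2 - phi p.1)).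
  by apply: (measurableT_comp (mpoisson _ e0)); apply: measurable_funB; [exact: m2|exact: m1].
have mK : measurable_fun Rp K.
  apply: (rint_measurable _ _ (fun y x => w x * poisson e (phi y - phi x))) => //.
  by apply: measurable_funM; first exact: m2.
pose f x y := b y * (w x * poisson e (phi y - phi x)).
have f0 x y : Rp x -> Rp y -> 0 <= f x y.
  by rewrite !RpE => x0 y0; rewrite mulr_ge0 ?b0// mulr_ge0 ?w0 ?poisson_ge0 ?ltW.
have ifx x : Rp x -> itg Rp (f x).
  rewrite RpE => x0; apply: (itg_dominated _ _ (fun y => (w x / e) * b y)) => //.
  - apply: measurable_funM => //; apply: measurable_funM; first exact: measurable_cst.
    by under eq_fun do rewrite -poissonN opprB; exact: mpc.
  - move=> y; rewrite RpE => y0; rewrite ger0_norm ?f0 ?RpE// /f mulrC ler_wpM2r ?b0//.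
    by rewrite ler_wpM2l ?w0// poisson_le.
  - exact: itgZl.
have fE y : rint Rp (f ^~ y) = b y * K y by rewrite -rintZl.
have ibK : itg Rp (fun y => b y * K y).
  apply: (itg_dominated _ _ (fun y => pi * b y)) => //.
  - exact: measurable_funM.
  - move=> y; rewrite RpE => y0; rewrite ger0_norm ?mulr_ge0 ?b0// mulrC.
    by rewrite ler_wpM2r ?b0.
  - exact: itgZl.
(* In the term [b y * w x] the weight sits on the outer variable [x], so the kernel bound applies
   only after Tonelli has made [x] the inner one. *)
have [S [fS iS S_le]] : exists S : R -> R, [/\ forall x, rint Rp (f x) = S x,
    itg Rp S & rint Rp S <= pi * rint Rp b].
  exists (fun x => rint Rp (f x)).
  have [iS SE] : itg Rp (fun x => rint Rp (f x)) /\
      rint Rp (fun x => rint Rp (f x)) = rint Rp (fun y => rint Rp (f ^~ y)).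
    apply: rtonelli => //.
    - by apply: measurable_funM; [exact: m2|apply: measurable_funM => //; exact: m1].
    - by move=> y _; exact: itgZl.
    - by apply: eq_itg ibK => // y _; rewrite fE.
  split; [by []|exact: iS|].
  rewrite SE -rintZl; [|exact: measurable_Rp|exact: ib].
  apply: rint_le; [exact: measurable_Rp| | |].
  - by apply: eq_itg ibK => [|y _]; [exact: measurable_Rp|rewrite fE].
  - exact: (itgZl _ _ _ measurable_Rp ib).
  - by move=> y; rewrite RpE => y0; rewrite fE mulrC; apply: ler_wpM2r; [exact: b0|exact: K_le].
have aQ x : Rp x -> `|a x * Q e x| <= 2^-1 * (pi * b x + S x).
  move=> Rx; have x0 : 0 < x by move: Rx; rewrite RpE.
  have iap : itg Rp (fun y => a y * poisson e (phi x - phi y)).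
    apply: (itg_dominated _ _ (fun y => e^-1 * `|a y|)) => //.
    - exact: measurable_funM.
    - move=> y _; rewrite normrM mulrC ler_wpM2r// ger0_norm ?poisson_ge0 ?(ltW e0)//.
      exact: poisson_le.
    - by apply: itgZl => //; exact: integrable_norm.
  rewrite -rintZl//.
  apply: (@le_trans _ _ (rint Rp (fun y => 2^-1 * (b x * (w y * poisson e (phi x - phi y)) + f x y)))).
    apply: rint_norm_le => //.
    - by apply: measurable_funM; [exact: measurable_cst|exact: measurable_funM].
    - by apply: itgZl => //; apply: itgD => //; [exact: itgZl|exact: ifx].
    - move=> y; rewrite RpE => y0.
      have p0 := poisson_ge0 e (phi x - phi y) (ltW e0).
      rewrite /f -(opprB (phi x)) poissonN mulrA normrM [X in _ * X]ger0_norm//.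
      rewrite [leRHS](_ : _ = (2^-1 * (b x * w y + b y * w x)) * poisson e (phi x - phi y)); last by ring.
      rewrite ler_wpM2r//.
      have bx := b0 x x0; have wx := w0 x x0; have by_ := b0 y y0; have wy := w0 y y0.
      have hx := abw x x0; have hy := abw y y0.
      (* Arithmetic-geometric mean in squared form, from [(b x * w x) * (b y * w y) = (b x * w y) *
         (b y * w x)]. *)
      rewrite -(ler_pXn2r (n := 2))// ?nnegrE ?mulr_ge0 ?addr_ge0 ?mulr_ge0//.
      rewrite real_normK ?num_real// exprMn.
      apply: (@le_trans _ _ ((b x * w x) * (b y * w y))).
        by apply: ler_pM => //; exact: sqr_ge0.
      have := sqr_ge0 (b x * w y - b y * w x); nra.
  rewrite rintZl//; last by apply: itgD => //; [exact: itgZl|exact: ifx].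
  rewrite ler_wpM2l ?invr_ge0// rintD//; [|exact: itgZl|exact: ifx].
  by rewrite fS lerD2r rintZl// mulrC ler_wpM2r ?b0//; exact: K_le.
have mQ : measurable_fun Rp (Q e).
  apply: (rint_measurable _ _ (fun x y => a y * poisson e (phi x - phi y))) => //.
  by apply: measurable_funM => //; exact: m2.
have iR : itg Rp (fun x => 2^-1 * (pi * b x + S x)).
  by apply: itgZl => //; apply: itgD => //; exact: itgZl.
apply: (@le_trans _ _ (rint Rp (fun x => 2^-1 * (pi * b x + S x)))).
  apply: le_trans (ler_norm _) _; apply: rint_norm_le => //; exact: measurable_funM.
rewrite rintZl//; last by apply: itgD => //; exact: itgZl.
rewrite rintD//; last exact: itgZl.
rewrite rintZl//; lra.
Qed.

(** The hypothesis [a^2 <= b * w] with [w] the derivative of [phi] encodes the substitution by [phi]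
    without performing it: in the new variable the energy of the amplitude is the integral of
    [a^2 / w], hence at most that of [b]. *)
Lemma trig_energy_bound :
  itg Rp trig_energy /\ rint Rp trig_energy <= expR 1 * pi * rint Rp b.
Proof.
have mH := measurable_trig_energy.
have iH k : itg (compact_exhaustion k) H.
  apply: (itg_bounded _ _ (2 * N ^+ 2)) => //; first exact: mu_Ik.
  by apply: (measurable_funS _ _ mH); [exact: measurable_Rp|exact: Ik_sub].
apply: itg_Rp_exhaust => // [x _|k]; first exact: trig_energy_ge0.
(* The damping rate is the inverse of the right endpoint, so [expR (- (e * m))] is at least
   [expR (- 1)] on the interval; this is the origin of the constant [expR 1]. *)
pose e : R := k.+2%:R^-1; have e0 : 0 < e by rewrite invr_gt0.
have ieH : itg Rp (fun m => expR (- (e * m)) * H m) by exact: (iexpM _ (2 * N ^+ 2)).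
rewrite -mulrA; apply: (@le_trans _ _ (expR 1 * rint Rp (fun m => expR (- (e * m)) * H m))); last first.
  by rewrite ler_wpM2l ?expR_ge0// energy_poisson// poisson_schur.
rewrite -rintZl//.
rewrite (_ : rint (compact_exhaustion k) H = rint Rp (H \_ (compact_exhaustion k))); last first.
  rewrite -Rintegral_mkcondr; congr Rintegral.
  by apply/esym/setIidr; exact: Ik_sub.
apply: rint_le => //.
- by apply: itg_restrict => //; rewrite (setIidr (@Ik_sub R k)); exact: iH.
- exact: itgZl.
- move=> m _; rewrite mulrA -expRD patchE; case: ifP => [/set_mem|_]; last first.
    by rewrite mulr_ge0 ?expR_ge0 ?trig_energy_ge0.
  rewrite /compact_exhaustion /= in_itv /= => /andP[_ mk].
  rewrite ler_peMl ?trig_energy_ge0// -[leLHS]expR0 ler_expR subr_ge0.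
  by rewrite /e ler_pdivrMl ?mulr1.
Qed.

End Bessel.

(** * The L2 pairing *)

Section L2Pairing.
Context {R : realType}.
Local Notation C := R[i].
Local Notation mu := (@lebesgue_measure R).
Local Notation itg D f := (mu.-integrable D (EFin \o (f : R -> R))).
Local Notation rint D f := (Rintegral mu D f).
Local Notation Rp := (@Rp R).
Implicit Types (f g x y : R -> C) (z : C).

Definition l2norm2 f : R := rint Rp (fun t => cnorm2 (f t)).
Definition pairing f g : C := cint Rp (fun t => f t * g t).

Lemma l2norm2_ge0 f : 0 <= l2norm2 f.
Proof. by apply: Rintegral_ge0 => t _. Qed.
Hint Resolve l2norm2_ge0 : core.

Lemma L2p_dominated f (u : R -> R) : cmeas Rp f ->
  (forall t : R, 0 < t -> cnorm2 (f t) <= u t) -> itg Rp u ->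
  L2p f /\ l2norm2 f <= rint Rp u.
Proof.
move=> mf fu iu; have i2 : itg Rp (fun t => cnorm2 (f t)).
  apply: (itg_dominated _ _ u) => //; first exact: cmeas_cnorm2.
  move=> t; rewrite RpE => t0; rewrite ger0_norm; [exact: (fu t t0)|exact: cnorm2_ge0].
split; first by split.
by apply: rint_le => // t; rewrite RpE => t0; exact: fu.
Qed.

Lemma cnorm2B_le (z1 z2 : C) : cnorm2 (z1 - z2) <= 2 * cnorm2 z1 + 2 * cnorm2 z2.
Proof.
rewrite /cnorm2 !creimE.
have := sqr_ge0 (cre z1 + cre z2); have := sqr_ge0 (cim z1 + cim z2); nra.
Qed.

Lemma L2pB f g : L2p f -> L2p g -> L2p (fun t => f t - g t).
Proof.
move=> [mf jf] [mg jg].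
apply: (proj1 (L2p_dominated _ (fun t => 2 * cnorm2 (f t) + 2 * cnorm2 (g t)) _ _ _)).
- exact: cmeasB.
- by move=> t _; exact: cnorm2B_le.
- by apply: itgD => //; exact: itgZl.
Qed.

Lemma L2pZ z f : L2p f -> L2p (fun t => z * f t) /\
  l2norm2 (fun t => z * f t) = cnorm2 z * l2norm2 f.
Proof.
move=> [mf jf]; split; last first.
  rewrite /l2norm2 -rintZl//; by apply: eq_rint => t _; rewrite cnorm2M.
split; first by apply: cmeasM => //; exact: cmeas_cst.
by apply: (eq_itg _ (fun t => cnorm2 z * cnorm2 (f t))) => // [t _|];
  [rewrite cnorm2M|exact: itgZl].
Qed.

Lemma norm1M_AMGM (a : R) (z1 z2 : C) : 0 < a ->
  norm1 (z1 * z2) <= a * cnorm2 z1 + a^-1 * cnorm2 z2.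
Proof.
move=> a0; apply: (le_trans (norm1M _ _)).
have h1 := norm1_le_cnorm2 z1; have h2 := norm1_le_cnorm2 z2.
apply: (@le_trans _ _ (2^-1 * (a * norm1 z1 ^+ 2 + a^-1 * norm1 z2 ^+ 2))).
  have ai : 0 <= a^-1 by rewrite invr_ge0 ltW.
  have := mulr_ge0 ai (sqr_ge0 (a * norm1 z1 - norm1 z2)).
  rewrite [X in 0 <= X -> _](_ : _ = a * norm1 z1 ^+ 2 + a^-1 * norm1 z2 ^+ 2 -
    2 * (norm1 z1 * norm1 z2)); last by field; rewrite gt_eqF.
  by lra.
rewrite mulrDr lerD//.
  by rewrite mulrCA ler_pM2l// ler_pdivrMl.
by rewrite mulrCA ler_pM2l ?invr_gt0// ler_pdivrMl.
Qed.

Lemma pairing_integrable f g : L2p f -> L2p g -> cintegrable Rp (fun t => f t * g t).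
Proof.
move=> [mf jf] [mg jg].
apply: (cintegrable_dominated _ _ (fun t => 1 * cnorm2 (f t) + 1^-1 * cnorm2 (g t))) => //.
- exact: cmeasM.
- by move=> t _; exact: norm1M_AMGM.
- by apply: itgD => //; exact: itgZl.
Qed.

(** Optimising over [a]: the infimum of [a * p + q / a] is twice the geometric mean of [p] and [q].
    For [p = 0] it is only approached as [a] grows, and a large explicit [a] contradicts [0 < s]. *)
Lemma discriminant_le (s p q : R) : 0 <= s -> 0 <= p -> 0 <= q ->
  (forall a : R, 0 < a -> s <= a * p + a^-1 * q) -> s ^+ 2 <= 4 * (p * q).
Proof.
move=> s0 p0 q0 h; have [->|sn] := eqVneq s 0.
  by rewrite expr0n /= mulr_ge0// mulr_ge0.
have sp : 0 < s by rewrite lt_neqAle eq_sym sn.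
move: p0; rewrite le_eqVlt => /predU1P[p0|pp].
  have q1 : 0 < q + 1 by rewrite ltr_wpDl.
  have a0 : 0 < 2 * (q + 1) / s by rewrite divr_gt0// mulr_gt0.
  by have := h _ a0; rewrite -p0 mulr0 add0r ler_pdivlMl// divfK//; lra.
(* With this weight the first term is exactly [s / 2], and the rest is the claim. *)
have a0 : 0 < s / (2 * p) by rewrite divr_gt0// mulr_gt0.
have := h _ a0; rewrite addrC -lerBlDr ler_pdivlMl//.
rewrite -(ler_pM2l pp) (_ : p * (s / (2 * p) * (s - s / (2 * p) * p)) = s ^+ 2 / 4).
  by lra.
by field; rewrite gt_eqF.
Qed.

(** Cauchy-Schwarz by optimising the weight in [norm1M_AMGM]. The two components of the integral
    double each term, so the squared bound carries [4 * 2 * 2 = 16], whence the 4. *)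
Lemma pairing_CS f g : L2p f -> L2p g ->
  norm1 (pairing f g) <= 4 * (Num.sqrt (l2norm2 f) * Num.sqrt (l2norm2 g)).
Proof.
move=> hf hg; have [mf jf] := hf; have [mg jg] := hg.
have h : (norm1 (pairing f g)) ^+ 2 <= 4 * ((2 * l2norm2 f) * (2 * l2norm2 g)).
  apply: discriminant_le; rewrite ?mulr_ge0// => a a0.
  rewrite !(mulrCA _ 2) -mulrDr.
  have := @norm1_cint_le R Rp (fun t => f t * g t)
    (fun t => a * cnorm2 (f t) + a^-1 * cnorm2 (g t)) measurable_Rp.
  rewrite rintD ?rintZl//; [apply| |]; try exact: itgZl.
  - exact: cmeasM.
  - by move=> t _; exact: norm1M_AMGM.
  - by apply: itgD => //; exact: itgZl.
have r0 : 0 <= 4 * (Num.sqrt (l2norm2 f) * Num.sqrt (l2norm2 g)).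
  by rewrite mulr_ge0// mulr_ge0 ?sqrtr_ge0.
rewrite -(ler_pXn2r (n := 2))// ?nnegrE//; last exact: norm1_ge0.
by rewrite !exprMn !sqr_sqrtr//; apply: (le_trans h); lra.
Qed.

Lemma pairingBl f1 f2 g : L2p f1 -> L2p f2 -> L2p g ->
  pairing (fun t => f1 t - f2 t) g = pairing f1 g - pairing f2 g.
Proof.
move=> h1 h2 hg; rewrite /pairing -cintB//; try exact: pairing_integrable.
by apply: eq_cint => t _; rewrite mulrBl.
Qed.

(** Every limit in [IsFRp] and [IsU] enters through this weak form. Membership of each [fs n] in L^2
    matters: [L2dist2] of a difference with infinite energy would default to 0 and convergence would
    say nothing. The operator bounds supply this membership. *)
Lemma pairing_cvg (fs : nat -> R -> C) f g : (forall n, L2p (fs n)) -> L2p f -> L2p g ->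
  L2conv fs f -> ccvg (fun n => pairing (fs n) g) (pairing f g).
Proof.
move=> hfs hf hg cv.
apply: (ccvg_squeeze _ _ (fun n => 4 * (Num.sqrt (L2dist2 (fs n) f) * Num.sqrt (l2norm2 g)))).
  move=> n; rewrite -pairingBl//; apply: pairing_CS => //; exact: L2pB.
suff : (fun n => 4 * (Num.sqrt (L2dist2 (fs n) f) * Num.sqrt (l2norm2 g))) @ \oo -->
    4 * (0 * Num.sqrt (l2norm2 g)) by rewrite mul0r mulr0.
apply: cvgM; first exact: cvg_cst.
apply: cvgM; last exact: cvg_cst.
rewrite -[X in _ --> X](sqrtr0 R).
by apply: (@continuous_cvg _ _ _ _ _ _ Num.sqrt) => //; exact: sqrt_continuous.
Qed.

Lemma pairingC f g : pairing f g = pairing g f.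
Proof. by apply: eq_cint => t _; rewrite mulrC. Qed.

End L2Pairing.
Hint Resolve l2norm2_ge0 : core.

(** * The Fourier and Mellin operators *)

Section Operators.
Context {R : realType}.
Local Notation C := R[i].
Local Notation mu := (@lebesgue_measure R).
Local Notation itg D f := (mu.-integrable D (EFin \o (f : R -> R))).
Local Notation rint D f := (Rintegral mu D f).
Local Notation Rp := (@Rp R).
Local Notation c0 := (@csqrt2pi_inv R).
Implicit Types (f g x y : R -> C) (z : C) (s : bool).

Definition sgnm s (m : R) : R := if s then m else - m.

Lemma measurable_sgnm s : measurable_fun setT (sgnm s).
Proof.
case: s; first exact: measurable_id.
by apply: continuous_measurable_fun => t; exact: opp_continuous.
Qed.

Lemma measurable_cosR : measurable_fun setT (@cos R).
Proof. by apply: continuous_measurable_fun; exact: continuous_cos. Qed.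
Lemma measurable_sinR : measurable_fun setT (@sin R).
Proof. by apply: continuous_measurable_fun; exact: continuous_sin. Qed.

Lemma cmeas_phase s (phi : R -> R) : measurable_fun Rp phi ->
  cmeas (Rp `*` Rp) (fun p : R * R => expi (sgnm s p.1 * phi p.2)).
Proof.
move=> mphi; apply: cmeas_expi; apply: measurable_funM.
  exact: (meas2_fst _ _ (sgnm s) measurable_Rp measurable_Rp
    (measurable_funTS (measurable_sgnm s))).
exact: (meas2_snd _ _ phi).
Qed.

(** * A common energy bound for the Fourier and Mellin phases *)

Section FourierBound.
Variables (y : R -> C) (b phi w : R -> R) (s : bool).
Hypothesis iy : cintegrable Rp y.
Hypothesis ib : itg Rp b.
Hypothesis b0 : forall t : R, 0 < t -> 0 <= b t.
Hypothesis w0 : forall t : R, 0 < t -> 0 <= w t.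
Hypothesis ybw : forall t : R, 0 < t -> cnorm2 (y t) <= b t * w t.
Hypothesis dphi : forall t : R, 0 < t -> is_derive t 1 phi (w t).
Hypothesis cw : forall t : R, 0 < t -> {for t, continuous w}.

Let T (m : R) : C := cint Rp (fun t => y t * expi (sgnm s m * phi t)).

(** The real and imaginary parts of [y] are two real amplitudes with the same [b] and [w]. Pointwise
    the energy of [T] is at most twice the sum of theirs, and each contributes [expR 1 * pi], which
    gives the factor 4. The sign [s] only flips the sine integrals. *)
Lemma fourier_bound : L2p T /\ l2norm2 T <= 4 * (expR 1 * pi) * rint Rp b.
Proof.
have mphi : measurable_fun Rp phi.
  by apply: measurable_fun_Rp_continuous => t /dphi; exact: derive_continuous.
have [iy1 iy2] := iy.
have my : cmeas Rp y by split; exact: itg_meas.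
pose Ep := trig_energy (fun t => cre (y t)) phi.
pose Eq := trig_energy (fun t => cim (y t)) phi.
have [iEp Ep_le] : itg Rp Ep /\ rint Rp Ep <= expR 1 * pi * rint Rp b.
  apply: trig_energy_bound => // t t0; apply: le_trans (ybw t t0).
  by rewrite lerDl sqr_ge0.
have [iEq Eq_le] : itg Rp Eq /\ rint Rp Eq <= expR 1 * pi * rint Rp b.
  apply: trig_energy_bound => // t t0; apply: le_trans (ybw t t0).
  by rewrite lerDr sqr_ge0.
have mT : cmeas Rp T.
  apply: (cint_measurable Rp Rp (fun m t => y t * expi (sgnm s m * phi t))) => //.
  by apply: cmeasM; [exact: cmeas_snd|exact: cmeas_phase].
have [] := L2p_dominated T (fun m => 2 * (Ep m + Eq m)) mT.
- move=> m _.
  have mm : measurable_fun Rp (fun t => m * phi t).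
    by apply: measurable_funM => //; exact: measurable_cst.
  have mc := measurableT_comp measurable_cosR mm.
  have ms := measurableT_comp measurable_sinR mm.
  have c1 (t : R) : `|cos t| <= 1 by rewrite ler_norml cos_geN1 cos_le1.
  have s1 (t : R) : `|sin t| <= 1 by rewrite ler_norml sin_geN1 sin_le1.
  have i1 := itgM_bounded1 _ _ _ measurable_Rp iy1 mc (fun t => c1 (m * phi t)).
  have i2 := itgM_bounded1 _ _ _ measurable_Rp iy1 ms (fun t => s1 (m * phi t)).
  have i3 := itgM_bounded1 _ _ _ measurable_Rp iy2 mc (fun t => c1 (m * phi t)).
  have i4 := itgM_bounded1 _ _ _ measurable_Rp iy2 ms (fun t => s1 (m * phi t)).
  pose e : R := if s then 1 else -1.
  have e2 : e ^+ 2 = 1 by rewrite /e; case: (s); rewrite ?sqrrN expr1n.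
  rewrite /cnorm2; have -> : cre (T m) = rint Rp (fun t => cre (y t) * cos (m * phi t)) -
      e * rint Rp (fun t => cim (y t) * sin (m * phi t)).
    rewrite -rintZl// -rintB//; last exact: itgZl.
    apply: eq_rint => t _; rewrite creM /= /e /sgnm.
    by case: (s); rewrite ?mul1r// mulNr cosN sinN; ring.
  have -> : cim (T m) = e * rint Rp (fun t => cre (y t) * sin (m * phi t)) +
      rint Rp (fun t => cim (y t) * cos (m * phi t)).
    rewrite -rintZl// -rintD//; last exact: itgZl.
    apply: eq_rint => t _; rewrite cimM /= /e /sgnm.
    by case: (s); rewrite ?mul1r// mulNr cosN sinN; ring.
  rewrite /Ep /Eq /trig_energy.
  set A1 := Rintegral _ _ _; set A2 := Rintegral _ _ _.
  set A3 := Rintegral _ _ _; set A4 := Rintegral _ _ _.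
  (* Parallelogram identities: adding the square with the opposite sign removes the cross terms, and
     that square is then dropped. *)
  have E1 : (A1 - e * A2) ^+ 2 + (A1 + e * A2) ^+ 2 = 2 * A1 ^+ 2 + 2 * A2 ^+ 2.
    by transitivity (2 * A1 ^+ 2 + 2 * (e ^+ 2) * A2 ^+ 2); [ring|rewrite e2; ring].
  have E2 : (e * A3 + A4) ^+ 2 + (e * A3 - A4) ^+ 2 = 2 * A3 ^+ 2 + 2 * A4 ^+ 2.
    by transitivity (2 * (e ^+ 2) * A3 ^+ 2 + 2 * A4 ^+ 2); [ring|rewrite e2; ring].
  have := sqr_ge0 (A1 + e * A2); have := sqr_ge0 (e * A3 - A4).
  lra.
- by apply: itgZl => //; exact: itgD.
move=> LT h; split => //; apply: (le_trans h).
rewrite rintZl//; last exact: itgD.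
rewrite rintD//; lra.
Qed.

End FourierBound.

Definition hweight (t : R) : R := powR t (- 2^-1).

Lemma hweightE (t : R) : 0 < t -> hweight t = (Num.sqrt t)^-1.
Proof. by move=> t0; rewrite /hweight powRN powR12_sqrt ?ltW. Qed.

Lemma hweight_ge0 t : 0 <= hweight t.
Proof. exact: powR_ge0. Qed.
Hint Resolve hweight_ge0 : core.

Lemma hweight_sqr (t : R) : 0 < t -> hweight t ^+ 2 = t^-1.
Proof. by move=> t0; rewrite hweightE// exprVn sqr_sqrtr// ltW. Qed.

Lemma measurable_hweight : measurable_fun Rp hweight.
Proof. by apply: measurable_funTS; exact: measurable_powR. Qed.

Lemma measurable_lnRp : measurable_fun Rp (@ln R).
Proof. by apply: measurable_funTS; exact: measurable_ln. Qed.

(** Equal to [2 * expR 1], since [cnorm2 c0 = 1 / (2 * pi)]. It is not sharp; any finite constant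
    serves. *)
Definition opbound : R := cnorm2 c0 * (4 * (expR 1 * pi)).

Lemma opbound_ge0 : 0 <= opbound.
Proof. by rewrite /opbound !mulr_ge0 ?cnorm2_ge0 ?expR_ge0 ?pi_ge0. Qed.

Definition L1n f := cmeas Rp f /\ itg Rp (fun t => norm1 (f t)).

Lemma L1n_L1p f : L1p f -> L1n f.
Proof.
move=> [mf jf]; split => //.
apply: (itg_dominated _ _ (fun t => 2 * Num.sqrt (cnorm2 (f t)))) => //.
- exact: cmeas_norm1.
- by move=> t _; rewrite ger0_norm ?norm1_ge0// norm1_le_sqrt.
- exact: itgZl.
Qed.

Lemma L1n_cintegrable f : L1n f -> cintegrable Rp f.
Proof.
by move=> [mf jf]; apply: (cintegrable_dominated _ _ (fun t => norm1 (f t))).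
Qed.

Lemma DomU_weighted x : DomU x -> L1n (fun t => x t * (hweight t)%:C).
Proof.
move=> [[mx _] jx].
have mxw : cmeas Rp (fun t => x t * (hweight t)%:C).
  by apply: cmeasM => //; apply: cmeas_real; exact: measurable_hweight.
split => //.
apply: (itg_dominated _ _ (fun t => 2 * (Num.sqrt (cnorm2 (x t)) * hweight t))) => //.
- exact: cmeas_norm1.
- move=> t _; rewrite ger0_norm ?norm1_ge0// mulrA; apply: norm1_le_mul.
    exact: norm1_le_sqrt.
  by rewrite norm1_real ger0_norm.
- exact: itgZl.
Qed.

Lemma FRp_bound x : L2p x -> L1n x ->
  L2p (FRp_int x) /\ l2norm2 (FRp_int x) <= opbound * l2norm2 x.
Proof.
move=> [mx jx] /L1n_cintegrable ix.
have [LT NT] : L2p (fun t => cint Rp (fun xi => x xi * expi (sgnm true t * xi))) /\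
    l2norm2 (fun t => cint Rp (fun xi => x xi * expi (sgnm true t * xi))) <=
    4 * (expR 1 * pi) * rint Rp (fun t => cnorm2 (x t)).
  apply: (fourier_bound x (fun t => cnorm2 (x t)) (fun t => t) (fun=> 1) true) => //.
  - by move=> t _; rewrite mulr1.
  - by move=> t _; exact: cst_continuous.
have [LF NF] := L2pZ c0 _ LT; split => //.
by rewrite /FRp_int [l2norm2 _]NF /opbound -mulrA ler_wpM2l ?cnorm2_ge0.
Qed.

(** Phase [ln] with derivative [1 / t]: the amplitude [x t * t^(- 1/2)] has squared modulus exactly
    [cnorm2 (x t) * t^-1], so [b] is again the energy density of [x]. *)
Lemma U_bound s x : DomU x ->
  L2p (U_int s x) /\ l2norm2 (U_int s x) <= opbound * l2norm2 x.
Proof.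
move=> dx; have [[mx jx] _] := dx.
have ix := L1n_cintegrable _ (DomU_weighted _ dx).
have [LT NT] : L2p (fun m => cint Rp (fun xi => (x xi * (hweight xi)%:C) * expi (sgnm s m * ln xi))) /\
    l2norm2 (fun m => cint Rp (fun xi => (x xi * (hweight xi)%:C) * expi (sgnm s m * ln xi))) <=
    4 * (expR 1 * pi) * rint Rp (fun t => cnorm2 (x t)).
  apply: (fourier_bound (fun t => x t * (hweight t)%:C) (fun t => cnorm2 (x t)) (@ln R) (fun t => t^-1) s) => //.
  - by move=> t t0; rewrite invr_ge0 ltW.
  - by move=> t t0; rewrite cnorm2M cnorm2_real hweight_sqr.
  - by move=> t t0; apply: inv_continuous; rewrite gt_eqF.
have [LF NF] := L2pZ c0 _ LT; split => //.
by rewrite /U_int [l2norm2 _]NF /opbound -mulrA ler_wpM2l ?cnorm2_ge0.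
Qed.

(** The Fubini argument shared by the symmetry of the Fourier integral, the transposition of [U],
    and the evaluation of the damped transform. The majorant [px] does not depend on [t], so
    [pg t * px u] dominates the full integrand; [q] only serves to pull [x u] out for fixed [u]. *)
Lemma kernel_duality x g (k : R -> R -> C) (px pg q : R -> R) :
  cmeas Rp x -> cmeas Rp g -> cmeas (Rp `*` Rp) (fun p : R * R => k p.1 p.2) ->
  itg Rp px -> itg Rp pg ->
  (forall t u : R, 0 < t -> 0 < u -> norm1 (x u * k t u) <= px u) ->
  (forall t u : R, 0 < t -> 0 < u -> norm1 (g t * k t u) <= pg t * q u) ->
  (forall t : R, 0 < t -> norm1 (g t) <= pg t) ->
  cint Rp (fun t => cint Rp (fun u => x u * k t u) * g t) =
  cint Rp (fun u => x u * cint Rp (fun t => g t * k t u)).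
Proof.
move=> mx mg mk ipx ipg h1 h2 h3.
transitivity (cint Rp (fun t => cint Rp (fun u => x u * k t u * g t))).
  apply: eq_cint => t Rt; have t0 : 0 < t by move: Rt; rewrite RpE.
  rewrite cintZr//; apply: (cintegrable_dominated _ _ px) => //.
    by apply: cmeasM => //; apply: (cmeas_row Rp Rp).
  by move=> u; rewrite RpE; exact: h1.
rewrite (cfubini _ _ (fun t u => x u * k t u * g t) pg px)//.
- apply: eq_cint => u Ru; have u0 : 0 < u by move: Ru; rewrite RpE.
  rewrite -cintZl//; first by apply: eq_cint => t _; rewrite -mulrA [g t * _]mulrC.
  apply: (cintegrable_dominated _ _ (fun t => pg t * q u)) => //.
  + by apply: cmeasM => //; apply: (cmeas_col Rp Rp).
  + by move=> t; rewrite RpE => t0; exact: h2.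
  + exact: itgZr.
- apply: cmeasM; last exact: (cmeas_fst _ _ g).
  by apply: cmeasM => //; exact: (cmeas_snd _ _ x).
- move=> t u; rewrite !RpE => t0 u0; rewrite mulrC; apply: norm1_le_mul; first exact: h3.
  exact: h1.
Qed.

Lemma FRp_sym x y : L1n x -> L1n y ->
  pairing (FRp_int x) y = pairing x (FRp_int y).
Proof.
move=> [mx jx] [my jy].
have H := kernel_duality x (fun t => c0 * y t) (fun t u => expi (t * u))
  (fun u => 2 * norm1 (x u)) (fun t => 2 * (norm1 c0 * norm1 (y t))) (fun=> 1).
transitivity (cint Rp (fun t => cint Rp (fun u => x u * expi (t * u)) * (c0 * y t))).
  by apply: eq_cint => t _; rewrite /FRp_int mulrCA mulrA.
rewrite H//.
- apply: eq_cint => u _; congr (_ * _); rewrite /FRp_int -cintZl//.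
    by apply: eq_cint => t _; rewrite mulrA [u * t]mulrC.
  apply: (cintegrable_dominated _ _ (fun t => 2 * norm1 (y t))) => //.
  + apply: cmeasM => //; apply: cmeas_expi; apply: measurable_funM => //; exact: measurable_cst.
  + by move=> t _; exact: norm1_mul_expi.
  + exact: itgZl.
- by apply: cmeasM => //; exact: cmeas_cst.
- exact: (cmeas_phase true (fun u => u)).
- exact: itgZl.
- by apply: itgZl => //; exact: itgZl.
- by move=> t u _ _; exact: norm1_mul_expi.
- move=> t u _ _; rewrite mulr1; apply: (le_trans (norm1_mul_expi _ _)).
  by rewrite ler_pM2l// norm1M.
- move=> t _; apply: (le_trans (norm1M _ _)).
  by rewrite ler_peMl ?mulr_ge0 ?norm1_ge0 ?ler1n.
Qed.

(** A transpose rather than an adjoint: the pairing is bilinear, so the phase keeps its sign. *)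
Definition Uadj s g (t : R) : C :=
  c0 * (hweight t)%:C * cint Rp (fun m => g m * expi (sgnm s m * ln t)).

Lemma U_duality s x g : DomU x -> L1n g ->
  pairing (U_int s x) g = pairing x (Uadj s g).
Proof.
move=> dx [mg jg].
have [mxw jxw] := DomU_weighted _ dx.
have H := kernel_duality (fun t => x t * (hweight t)%:C) (fun t => c0 * g t)
  (fun m u => expi (sgnm s m * ln u))
  (fun u => 2 * norm1 (x u * (hweight u)%:C)) (fun t => 2 * (norm1 c0 * norm1 (g t))) (fun=> 1).
transitivity (cint Rp (fun t => cint Rp (fun u => x u * (hweight u)%:C * expi (sgnm s t * ln u)) * (c0 * g t))).
  by apply: eq_cint => t _; rewrite /U_int mulrCA mulrA.
rewrite H//.
- apply: eq_cint => u _; rewrite /Uadj [in RHS](mulrC c0) -!mulrA; congr (_ * (_ * _)).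
  rewrite -cintZl//.
    by apply: eq_cint => t _; rewrite mulrA.
  apply: (cintegrable_dominated _ _ (fun t => 2 * norm1 (g t))) => //.
  + apply: cmeasM => //; apply: cmeas_expi; apply: measurable_funM; last exact: measurable_cst.
    exact: (measurable_funTS (measurable_sgnm s)).
  + by move=> t _; exact: norm1_mul_expi.
  + exact: itgZl.
- by apply: cmeasM => //; exact: cmeas_cst.
- by apply: cmeas_phase; exact: measurable_lnRp.
- exact: itgZl.
- by apply: itgZl => //; exact: itgZl.
- by move=> t u _ _; exact: norm1_mul_expi.
- move=> t u _ _; rewrite mulr1; apply: (le_trans (norm1_mul_expi _ _)).
  by rewrite ler_pM2l// norm1M.
- move=> t _; apply: (le_trans (norm1M _ _)).
  by rewrite ler_peMl ?mulr_ge0 ?norm1_ge0 ?ler1n.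
Qed.

End Operators.

(** * The transposed Mellin operator *)

Section Adjoint.
Context {R : realType}.
Local Notation C := R[i].
Local Notation mu := (@lebesgue_measure R).
Local Notation itg D f := (mu.-integrable D (EFin \o (f : R -> R))).
Local Notation rint D f := (Rintegral mu D f).
Local Notation Rp := (@Rp R).
Local Notation c0 := (@csqrt2pi_inv R).
Implicit Types (f g x y : R -> C) (z : C) (s : bool).

(** A pointwise bound for dominated convergence. Its square is a multiple of [1 / t], integrable at
    neither end of the half line, so membership of [Uadj s g] in L^2 has to come from duality. *)
Lemma Uadj_le s g : L1n g -> exists2 K : R, 0 <= K &
  forall t, norm1 (Uadj s g t) <= K * hweight t.
Proof.
move=> [mg jg].
pose K := norm1 c0 * (2 * rint Rp (fun m => 2 * norm1 (g m))).
have K0 : 0 <= K.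
  rewrite /K mulr_ge0 ?norm1_ge0// mulr_ge0//.
  by apply: Rintegral_ge0 => m _; rewrite mulr_ge0 ?norm1_ge0.
exists K => // t; rewrite /Uadj -mulrA (mulrC (hweight t)%:C) mulrA.
apply: norm1_le_mul; last by rewrite norm1_real ger0_norm ?hweight_ge0.
apply: norm1_le_mul => //; apply: norm1_cint_le => //.
- apply: cmeasM => //; apply: cmeas_expi; apply: measurable_funM; last exact: measurable_cst.
  exact: (measurable_funTS (measurable_sgnm s)).
- by move=> m _; exact: norm1_mul_expi.
- exact: itgZl.
Qed.

Lemma cmeas_Uadj s g : cmeas Rp g -> cmeas Rp (Uadj s g).
Proof.
move=> mg; apply: cmeasM.
  apply: cmeasM; first exact: cmeas_cst.
  by apply: cmeas_real; exact: measurable_hweight.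
apply: (cint_measurable Rp Rp (fun t m => g m * expi (sgnm s m * ln t))) => //.
apply: cmeasM; first exact: cmeas_snd.
apply: cmeas_expi; apply: measurable_funM.
  exact: (meas2_snd _ _ (sgnm s) measurable_Rp measurable_Rp
    (measurable_funTS (measurable_sgnm s))).
exact: (meas2_fst _ _ (@ln R) measurable_Rp measurable_Rp measurable_lnRp).
Qed.

Definition cconj z : C := cmk (cre z) (- cim z).

Lemma cmeas_cconj (D : set R) f : cmeas D f -> cmeas D (fun t => cconj (f t)).
Proof.
by move=> [h1 h2]; split => //=; apply: (measurableT_comp _ h2);
  apply: continuous_measurable_fun => t; exact: opp_continuous.
Qed.

Lemma cnorm2_cconj z : cnorm2 (cconj z) = cnorm2 z.
Proof. by rewrite /cnorm2 /= sqrrN. Qed.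

Lemma mul_cconj z : z * cconj z = (cnorm2 z)%:C.
Proof. by apply: cext; rewrite !creimE /= /cnorm2 ?expr2; ring. Qed.

Definition truncate (D : set R) f : R -> C := fun t => if t \in D then f t else 0.

Lemma cmeas_truncate (E D : set R) f : measurable E -> measurable D ->
  cmeas E f -> cmeas E (truncate D f).
Proof.
move=> mE mD [h1 h2]; split.
- rewrite (_ : (fun t => _) = (fun t => cre (f t)) \_ D); last first.
    by apply/funext => t; rewrite patchE /truncate; case: ifP.
  apply/measurable_restrict => //; apply: (measurable_funS _ _ h1) => //.
- rewrite (_ : (fun t => _) = (fun t => cim (f t)) \_ D); last first.
    by apply/funext => t; rewrite patchE /truncate; case: ifP.
  apply/measurable_restrict => //; apply: (measurable_funS _ _ h2) => //.
Qed.

Lemma cnorm2_0 : cnorm2 (0 : C) = 0.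
Proof. by rewrite /cnorm2 /= expr0n addr0. Qed.

(* Duality: testing [U_int s x] against [g] with [x] the conjugate of [Uadj s g]
   cut off to a compact set bounds the norm of [Uadj s g] there. *)
Lemma Uadj_L2p s g : L2p g -> L1n g -> L2p (Uadj s g).
Proof.
move=> hg g1; have [mg _] := g1.
pose G := Uadj s g; have mG : cmeas Rp G by exact: cmeas_Uadj.
have [K K0 GK] := Uadj_le s g g1.
have mG2 := cmeas_cnorm2 _ _ _ _ mG.
have GK2 t : cnorm2 (G t) <= (K * hweight t) ^+ 2.
  apply: (le_trans (cnorm2_le_norm1 _)); rewrite lerXn2r// ?nnegrE ?norm1_ge0//.
  by rewrite mulr_ge0 ?hweight_ge0.
have hwI k t : compact_exhaustion k t -> hweight t ^+ 2 <= k.+2%:R.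
  move=> tk; rewrite hweight_sqr; last exact: Ik_gt0 tk.
  move: tk; rewrite /compact_exhaustion /= in_itv /= => /andP[h _].
  rewrite -[leRHS]invrK lef_pV2// posrE; last by rewrite invr_gt0.
  by apply: lt_le_trans h; rewrite invr_gt0.
have iI k : itg (compact_exhaustion k) (fun t => cnorm2 (G t)).
  apply: (itg_bounded _ _ (K ^+ 2 * k.+2%:R)) => //; first exact: mu_Ik.
    by apply: (measurable_funS _ _ mG2); [exact: measurable_Rp|exact: Ik_sub].
  move=> t tk; rewrite ger0_norm ?cnorm2_ge0//; apply: (le_trans (GK2 t)).
  by rewrite exprMn ler_wpM2l ?sqr_ge0// hwI.
(* The 16 is the square of the constant in [pairing_CS]. Duality bounds [l2norm2 x ^+ 2] by a
   multiple of [l2norm2 x], and one factor is cancelled at the end. *)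
suff [jG _] : itg Rp (fun t => cnorm2 (G t)) /\
    rint Rp (fun t => cnorm2 (G t)) <= 16 * opbound * l2norm2 g by split.
apply: itg_Rp_exhaust => // k.
pose x := truncate (compact_exhaustion k) (fun t => cconj (G t)).
have x2E t : cnorm2 (x t) = ((fun t => cnorm2 (G t)) \_ (compact_exhaustion k)) t.
  by rewrite /x /truncate patchE; case: ifP; rewrite ?cnorm2_cconj ?cnorm2_0.
have ix2 : itg Rp (fun t => cnorm2 (x t)).
  apply: (eq_itg _ ((fun t => cnorm2 (G t)) \_ (compact_exhaustion k))) => //.
  by apply: itg_restrict => //; rewrite (setIidr (@Ik_sub R k)); exact: iI.
have mx : cmeas Rp x.
  by apply: cmeas_truncate => //; exact: cmeas_cconj.
have hx : L2p x by split.
have dx : DomU x.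
  split => //.
  pose B := K * k.+2%:R.
  apply: (itg_dominated _ _ ((fun=> B) \_ (compact_exhaustion k))) => //.
  - apply: measurable_funM; last exact: measurable_hweight.
    apply: (measurableT_comp _ (cmeas_cnorm2 _ _ _ _ mx)).
    by apply: continuous_measurable_fun; exact: sqrt_continuous.
  - move=> t _; rewrite patchE /x /truncate; case: ifPn => [/set_mem tk|_]; last first.
      by rewrite cnorm2_0 sqrtr0 mul0r normr0.
    rewrite ger0_norm ?mulr_ge0 ?sqrtr_ge0 ?hweight_ge0// cnorm2_cconj.
    apply: (@le_trans _ _ (K * hweight t * hweight t)).
      rewrite ler_wpM2r ?hweight_ge0//; apply: (le_trans (sqrt_cnorm2_le _)); exact: GK.
    by rewrite -mulrA -expr2 ler_wpM2l// hwI.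
  - apply: itg_restrict => //; rewrite (setIidr (@Ik_sub R k)).
    apply: (itg_bounded _ _ `|B|) => //; exact: mu_Ik.
have NxE : rint (compact_exhaustion k) (fun t => cnorm2 (G t)) = l2norm2 x.
  transitivity (rint Rp ((fun t => cnorm2 (G t)) \_ (compact_exhaustion k))).
    by rewrite -Rintegral_mkcondr; congr Rintegral; apply/esym/setIidr; exact: Ik_sub.
  by apply: eq_rint => t _; rewrite x2E.
have pE : cre (pairing x G) = l2norm2 x.
  apply: eq_rint => t _; rewrite x2E patchE /x /truncate; case: ifP => _; last by rewrite mul0r.
  by rewrite mulrC mul_cconj.
have [LU NU] := U_bound s x dx.
rewrite NxE; have [->|x0] := eqVneq (l2norm2 x) 0.
  exact: mulr_ge0 (mulr_ge0 (ler0n _ 16) opbound_ge0) (l2norm2_ge0 g).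
have xp : 0 < l2norm2 x by rewrite lt_neqAle eq_sym x0 l2norm2_ge0.
have h : l2norm2 x <= 4 * (Num.sqrt (l2norm2 (U_int s x)) * Num.sqrt (l2norm2 g)).
  rewrite -{1}pE -U_duality//; apply: le_trans (ler_norm _) _.
  by apply: (le_trans (norm1_re _)); exact: pairing_CS.
have h2 : l2norm2 x ^+ 2 <= 16 * (opbound * l2norm2 x * l2norm2 g).
  apply: (@le_trans _ _ ((4 * (Num.sqrt (l2norm2 (U_int s x)) * Num.sqrt (l2norm2 g))) ^+ 2)).
    by rewrite lerXn2r// nnegrE ?(ltW xp)// (le_trans (ltW xp)).
  rewrite !exprMn !sqr_sqrtr ?l2norm2_ge0// -natrX ler_pM2l//.
  by rewrite ler_wpM2r ?l2norm2_ge0.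
rewrite -(ler_pM2l xp) -expr2; apply: (le_trans h2); lra.
Qed.

(** The transposition formula survives the extension by continuity, whichever approximating sequence
    witnesses [IsU]; from here on the extended operator is handled only through this identity. *)
Lemma IsU_pairing x wp wm s g : IsU x wp wm -> L2p g -> L1n g ->
  pairing (if s then wp else wm) g = pairing x (Uadj s g).
Proof.
move=> [hx [hwp [hwm [xs [dxs [cx [cp cm]]]]]]] hg g1.
have L2xs n : L2p (xs n) by have [] := dxs n.
have h1 : ccvg (fun n => pairing (xs n) (Uadj s g)) (pairing x (Uadj s g)).
  by apply: pairing_cvg => //; exact: Uadj_L2p.
have h2 : ccvg (fun n => pairing (U_int s (xs n)) g) (pairing (if s then wp else wm) g).
  apply: pairing_cvg => //; first by move=> n; have [] := U_bound s _ (dxs n).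
    by case: (s).
  by case: (s).
apply: ccvg_unique h2 _.
rewrite (_ : (fun n => _) = fun n => pairing (xs n) (Uadj s g))//.
by apply/funext => n; rewrite U_duality.
Qed.

Lemma IsFRp_pairing x fx g : IsFRp x fx -> L2p g -> L1n g ->
  pairing fx g = pairing x (FRp_int g).
Proof.
move=> [hx [hfx [xs [dxs [cx cf]]]]] hg g1.
have [LF _] := FRp_bound g hg g1.
have h1 : ccvg (fun n => pairing (xs n) (FRp_int g)) (pairing x (FRp_int g)).
  by apply: pairing_cvg => // n; have [] := dxs n.
have h2 : ccvg (fun n => pairing (FRp_int (xs n)) g) (pairing fx g).
  apply: pairing_cvg => // n; have [h /L1n_L1p h'] := dxs n.
  by have [] := FRp_bound _ h h'.
apply: ccvg_unique h2 _.
rewrite (_ : (fun n => _) = fun n => pairing (xs n) (FRp_int g))//.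
by apply/funext => n; rewrite FRp_sym//; apply: L1n_L1p; have [] := dxs n.
Qed.

Definition damp (n : nat) g : R -> C := fun t => g t * (expR (- (n.+1%:R^-1 * t)))%:C.

Lemma cmeas_damp n g : cmeas Rp g -> cmeas Rp (damp n g).
Proof.
move=> mg; apply: cmeasM => //; apply: cmeas_real.
by apply: measurable_fun_Rp_continuous => t t0; eapply derive_continuous; derivs.
Qed.

Lemma exp_damp_le1 n (t : R) : 0 < t -> expR (- (n.+1%:R^-1 * t)) <= 1.
Proof. by move=> t0; rewrite -expR0 ler_expR oppr_le0 mulr_ge0// ltW. Qed.

Lemma damp_bound n g : L2p g -> L2p (damp n g) /\ l2norm2 (damp n g) <= l2norm2 g.
Proof.
move=> [mg jg]; apply: L2p_dominated => //; first exact: cmeas_damp.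
move=> t t0; rewrite cnorm2M cnorm2_real ler_piMr ?cnorm2_ge0//.
by rewrite expr_le1// ?expR_ge0 ?exp_damp_le1.
Qed.

Lemma cvg_damp (t : R) : (fun n : nat => expR (- (n.+1%:R^-1 * t))) @ \oo --> (1 : R).
Proof.
suff : (fun n : nat => expR (- (n.+1%:R^-1 * t))) @ \oo --> (expR 0 : R) by rewrite expR0.
apply: (@continuous_cvg _ _ _ _ _ (fun n : nat => - (n.+1%:R^-1 * t)) expR 0).
  exact: continuous_expR.
suff : (fun n : nat => - (n.+1%:R^-1 * t)) @ \oo --> - (0 * t) by rewrite mul0r oppr0.
apply: cvgN; apply: cvgM; last exact: cvg_cst.
exact: cvg_harmonic.
Qed.

Lemma pairing_damp_cvg f g : L2p f -> L2p g ->
  ccvg (fun n => pairing f (damp n g)) (pairing f g).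
Proof.
move=> [mf jf] [mg jg].
apply: (cdct _ _ _ (fun t => 1 * cnorm2 (f t) + 1^-1 * cnorm2 (g t))) => //.
- by move=> n; apply: cmeasM => //; exact: cmeas_damp.
- by apply: itgD => //; exact: itgZl.
- move=> n t; rewrite RpE => t0; rewrite /damp mulrA -[leRHS]mulr1.
  apply: norm1_le_mul; first exact: norm1M_AMGM.
  by rewrite norm1_real ger0_norm ?expR_ge0// exp_damp_le1.
- move=> t _; rewrite -[f t * g t]mulr1 (_ : (fun n => _) =
      fun n : nat => f t * g t * (expR (- (n.+1%:R^-1 * t)))%:C); last first.
    by apply/funext => n; rewrite /damp mulrA.
  by apply: ccvgM; [exact: ccvg_cst|apply: ccvg_real; exact: cvg_damp].
Qed.

End Adjoint.

(** * Rotation of the contour in Euler's integral *)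

Section Contour.
Context {R : realType}.
Local Notation C := R[i].
Local Notation mu := (@lebesgue_measure R).
Local Notation itg D f := (mu.-integrable D (EFin \o (f : R -> R))).
Local Notation rint D f := (Rintegral mu D f).
Local Notation Rp := (@Rp R).
Local Notation I01 := (`[0, 1]%classic : set R).

(** For fixed [t] the increment of [S t] is the integral of [t * r t l] over [l], and the factor [t]
    cancels [t^-1]; after Fubini the integral in [t] vanishes for each [l]. With [r] built from
    [t]-derivatives, this does the work of Cauchy's theorem. *)
Lemma rint_deformation (S r : R -> R -> R) (u : R -> R) :
  (forall t l : R, 0 < t -> is_derive l 1 (S t) (t * r t l)) ->
  (forall t l : R, 0 < t -> {for l, continuous (r t)}) ->
  measurable_fun (Rp `*` I01) (fun p : R * R => r p.1 p.2) ->
  itg Rp u -> (forall t l : R, 0 < t -> I01 l -> `|r t l| <= u t) ->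
  (forall l, I01 l -> rint Rp (r ^~ l) = 0) ->
  rint Rp (fun t => t^-1 * (S t 1 - S t 0)) = 0.
Proof.
move=> dS cr mr iu ru r0; have mI : measurable I01 by exact: measurable_itv.
transitivity (rint Rp (fun t => rint I01 (r t))).
  apply: eq_rint => t; rewrite RpE => t0; have tn : t != 0 by rewrite gt_eqF.
  have [ir <-] : itg I01 (fun l => t * r t l) /\
      rint I01 (fun l => t * r t l) = S t 1 - S t 0.
    apply: rint_FTC => // l _; first exact: dS.
    by apply: continuousM; [exact: cst_continuous|exact: cr].
  rewrite rintZl ?mulKf//.
  by apply: (eq_itg _ (fun l => t^-1 * (t * r t l))) => // [l _|];
    [rewrite mulKf|exact: itgZl].
rewrite (rfubini _ _ _ _ _ mr u (fun=> 1)) //.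
- by rewrite (@eq_rint _ I01 _ (fun=> 0))// /Rintegral integral0.
- apply: (itg_bounded _ _ 1) => //; last by move=> *; rewrite normr1.
  by rewrite lebesgue_measure_itv /= lte_fin ltr01 -EFinB ltry.
- by move=> t l; rewrite RpE mulr1 => t0 l01; exact: ru.
Qed.

Variables (m rho theta : R).
Hypothesis theta0 : 0 <= theta.
Hypothesis theta_lt : theta < pi / 2.

(** With [s = 1/2 + i m] and [z = expR rho * expi (- theta)], [zr l - i zi l] is [z^l], a path from
    1 to [z] in the right half plane for [l] in [[0, 1]]. [A + i B] is the logarithm of
    [P + i Q = (t z^l)^s e^(- t z^l)], [al + i be = s / t - z^l] is its [t]-derivative, and
    [p + i q] is the [t]-derivative of [P + i Q]. *)
Let zr l := expR (l * rho) * cos (l * theta).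
Let zi l := expR (l * rho) * sin (l * theta).
Let A t l := 2^-1 * (ln t + l * rho) + m * (l * theta) - t * zr l.
Let B t l := m * (ln t + l * rho) - 2^-1 * (l * theta) + t * zi l.
Let P t l := expR (A t l) * cos (B t l).
Let Q t l := expR (A t l) * sin (B t l).
Let al t l := 2^-1 * t^-1 - zr l.
Let be t l := m * t^-1 + zi l.
Let p t l := expR (A t l) * (al t l * cos (B t l) - be t l * sin (B t l)).
Let q t l := expR (A t l) * (al t l * sin (B t l) + be t l * cos (B t l)).

Let dAt (t l : R) : 0 < t -> is_derive t 1 (fun t => A t l) (al t l).
Proof. by move=> t0; eapply is_derive_eq; [rewrite /A; derivs|rewrite /al /=; ring]. Qed.
Let dBt (t l : R) : 0 < t -> is_derive t 1 (fun t => B t l) (be t l).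
Proof. by move=> t0; eapply is_derive_eq; [rewrite /B; derivs|rewrite /be /=; ring]. Qed.
(** Up to a constant, everything depends on [t z^l] only, so differentiating in [l] amounts to
    [(rho - i theta) t] times differentiating in [t]. This relation and the three that follow in [l]
    are its real and imaginary parts. *)
Let dAl (t l : R) : 0 < t -> is_derive l 1 (fun l => A t l) (t * (rho * al t l + theta * be t l)).
Proof.
move=> t0; eapply is_derive_eq; [rewrite /A /zr; derivs|rewrite /al /be /zr /zi /=; field].
by rewrite gt_eqF.
Qed.
Let dBl (t l : R) : 0 < t -> is_derive l 1 (fun l => B t l) (t * (rho * be t l - theta * al t l)).
Proof.
move=> t0; eapply is_derive_eq; [rewrite /B /zi; derivs|rewrite /al /be /zr /zi /=; field].
by rewrite gt_eqF.
Qed.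
Let dPt (t l : R) : 0 < t -> is_derive t 1 (fun t => P t l) (p t l).
Proof.
move=> t0; have h1 := dAt t l t0; have h2 := dBt t l t0.
by eapply is_derive_eq; [rewrite /P; derivs|rewrite /p /=; ring].
Qed.
Let dQt (t l : R) : 0 < t -> is_derive t 1 (fun t => Q t l) (q t l).
Proof.
move=> t0; have h1 := dAt t l t0; have h2 := dBt t l t0.
by eapply is_derive_eq; [rewrite /Q; derivs|rewrite /q /=; ring].
Qed.
Let dPl (t l : R) : 0 < t -> is_derive l 1 (P t) (t * (rho * p t l + theta * q t l)).
Proof.
move=> t0; have h1 := dAl t l t0; have h2 := dBl t l t0.
by eapply is_derive_eq; [rewrite /P; derivs|rewrite /p /q /=; ring].
Qed.
Let dQl (t l : R) : 0 < t -> is_derive l 1 (Q t) (t * (rho * q t l - theta * p t l)).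
Proof.
move=> t0; have h1 := dAl t l t0; have h2 := dBl t l t0.
by eapply is_derive_eq; [rewrite /Q; derivs|rewrite /p /q /=; ring].
Qed.

Let cAt t l : 0 < t -> {for t, continuous (fun t => A t l)}.
Proof. by move=> /(dAt t l) /derive_continuous. Qed.
Let cBt t l : 0 < t -> {for t, continuous (fun t => B t l)}.
Proof. by move=> /(dBt t l) /derive_continuous. Qed.
Let cAl t l : 0 < t -> {for l, continuous (A t)}.
Proof. by move=> /(dAl t l) /derive_continuous. Qed.
Let cBl t l : 0 < t -> {for l, continuous (B t)}.
Proof. by move=> /(dBl t l) /derive_continuous. Qed.
Let cinv t : 0 < t -> {for t, continuous (fun t : R => t^-1)}.
Proof. by move=> t0; apply: inv_continuous; rewrite gt_eqF. Qed.
Let calt t l : 0 < t -> {for t, continuous (fun t => al t l)}.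
Proof.
move=> t0; apply: continuousB; last exact: cst_continuous.
by apply: continuousM; [exact: cst_continuous|exact: cinv].
Qed.
Let cbet t l : 0 < t -> {for t, continuous (fun t => be t l)}.
Proof.
move=> t0; apply: continuousD; last exact: cst_continuous.
by apply: continuousM; [exact: cst_continuous|exact: cinv].
Qed.
Let call t l : {for l, continuous (al t)}.
Proof. by eapply derive_continuous; rewrite /al /zr; derivs. Qed.
Let cbel t l : {for l, continuous (be t)}.
Proof. by eapply derive_continuous; rewrite /be /zi; derivs. Qed.

Let ccomp (h f : R -> R) x : continuous h -> {for x, continuous f} ->
  {for x, continuous (fun y => h (f y))}.
Proof. by move=> ch cf; apply: continuous_comp => //; exact: ch. Qed.

Let cpt t l : 0 < t -> {for t, continuous (fun t => p t l)}.
Proof.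
move=> t0; apply: continuousM; first by apply: ccomp; [exact: continuous_expR|exact: cAt].
apply: continuousB; apply: continuousM; try exact: calt; try exact: cbet;
  apply: ccomp; try exact: cBt; [exact: continuous_cos|exact: continuous_sin].
Qed.
Let cqt t l : 0 < t -> {for t, continuous (fun t => q t l)}.
Proof.
move=> t0; apply: continuousM; first by apply: ccomp; [exact: continuous_expR|exact: cAt].
apply: continuousD; apply: continuousM; try exact: calt; try exact: cbet;
  apply: ccomp; try exact: cBt; [exact: continuous_sin|exact: continuous_cos].
Qed.
Let cpl t l : 0 < t -> {for l, continuous (p t)}.
Proof.
move=> t0; apply: continuousM; first by apply: ccomp; [exact: continuous_expR|exact: cAl].
apply: continuousB; apply: continuousM; try exact: call; try exact: cbel;
  apply: ccomp; try exact: cBl; [exact: continuous_cos|exact: continuous_sin].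
Qed.
Let cql t l : 0 < t -> {for l, continuous (q t)}.
Proof.
move=> t0; apply: continuousM; first by apply: ccomp; [exact: continuous_expR|exact: cAl].
apply: continuousD; apply: continuousM; try exact: call; try exact: cbel;
  apply: ccomp; try exact: cBl; [exact: continuous_sin|exact: continuous_cos].
Qed.

Let D2 := Rp `*` I01.
Let mI : measurable I01. Proof. exact: measurable_itv. Qed.
Let m1 (f : R -> R) : measurable_fun Rp f -> measurable_fun D2 (fun p : R * R => f p.1).
Proof. exact: meas2_fst. Qed.
Let m2 (f : R -> R) : continuous f -> measurable_fun D2 (fun p : R * R => f p.2).
Proof.
by move=> cf; apply: (meas2_snd _ _ f) => //; apply: measurable_funTS;
  exact: continuous_measurable_fun.
Qed.
Let czr : continuous zr.
Proof. by move=> l; eapply derive_continuous; rewrite /zr; derivs. Qed.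
Let czi : continuous zi.
Proof. by move=> l; eapply derive_continuous; rewrite /zi; derivs. Qed.
Let mlin (a : R) : measurable_fun D2 (fun p : R * R => p.2 * a).
Proof.
by apply: (m2 (fun l => l * a)) => l; eapply derive_continuous; derivs.
Qed.
Let mt : measurable_fun D2 (fun p : R * R => p.1).
Proof. by apply: (m1 (fun t => t)); exact: measurable_id. Qed.
Let mln : measurable_fun D2 (fun p : R * R => ln p.1).
Proof. exact: (m1 _ measurable_lnRp). Qed.
Let minv : measurable_fun D2 (fun p : R * R => p.1^-1).
Proof.
apply: (m1 (fun t => t^-1)); apply: measurable_fun_Rp_continuous => t t0; exact: cinv.
Qed.
Let mcst (k : R) : measurable_fun D2 (fun _ : R * R => k).
Proof. exact: measurable_cst. Qed.
Let mA : measurable_fun D2 (fun p : R * R => A p.1 p.2).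
Proof.
apply: measurable_funB; last by apply: measurable_funM => //; exact: m2.
apply: measurable_funD; apply: measurable_funM => //; exact: measurable_funD.
Qed.
Let mB : measurable_fun D2 (fun p : R * R => B p.1 p.2).
Proof.
apply: measurable_funD; last by apply: measurable_funM => //; exact: m2.
apply: measurable_funB; apply: measurable_funM => //; exact: measurable_funD.
Qed.
Let mal : measurable_fun D2 (fun p : R * R => al p.1 p.2).
Proof.
by apply: measurable_funB; [exact: measurable_funM|exact: m2].
Qed.
Let mbe : measurable_fun D2 (fun p : R * R => be p.1 p.2).
Proof.
by apply: measurable_funD; [exact: measurable_funM|exact: m2].
Qed.
Let mp : measurable_fun D2 (fun p0 : R * R => p p0.1 p0.2).
Proof.
apply: measurable_funM; first exact: (measurableT_comp (@measurable_expR R)).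
apply: measurable_funB; apply: measurable_funM => //.
  exact: (measurableT_comp measurable_cosR).
exact: (measurableT_comp measurable_sinR).
Qed.
Let mq : measurable_fun D2 (fun p0 : R * R => q p0.1 p0.2).
Proof.
apply: measurable_funM; first exact: (measurableT_comp (@measurable_expR R)).
apply: measurable_funD; apply: measurable_funM => //.
  exact: (measurableT_comp measurable_sinR).
exact: (measurableT_comp measurable_cosR).
Qed.

(** [kappa] bounds the real part of [z^l] from below and [M] bounds [|z^l|^(1/2) e^(m l theta)] from
    above, uniformly along the path; [theta < pi / 2] makes [kappa] positive. *)
Let kappa := expR (- `|rho|) * cos theta.
Let M := expR (`|rho| + `|m| * theta).

Let cos_theta : 0 < cos theta.
Proof.
by apply: cos_gt0_pihalf; rewrite theta_lt andbT (lt_le_trans _ theta0)// oppr_lt0 divr_gt0 ?pi_gt0.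
Qed.
Let kappa_gt0 : 0 < kappa.
Proof. by rewrite mulr_gt0 ?expR_gt0. Qed.

Let lrho l : I01 l -> `|l * rho| <= `|rho|.
Proof.
rewrite /= in_itv /= => /andP[l0 l1].
by rewrite normrM ger0_norm// ler_piMl.
Qed.

Let ltheta l : I01 l -> 0 <= l * theta <= theta.
Proof.
rewrite /= in_itv /= => /andP[l0 l1].
by rewrite mulr_ge0//= ler_piMl.
Qed.

Let zr_ge l : I01 l -> kappa <= zr l.
Proof.
move=> l01; have /andP[h0 h1] := ltheta _ l01.
have tpi : theta <= pi.
  by apply: (le_trans (ltW theta_lt)); rewrite ler_pdivrMr// ler_peMr ?pi_ge0// ler1n.
apply: ler_pM; rewrite ?expR_ge0 ?(ltW cos_theta)//.
  by rewrite ler_expR; have := lrho _ l01; rewrite ler_norml => /andP[].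
by rewrite leNgt ltr_cos ?in_itv /= ?h0 ?theta0 ?tpi ?(le_trans h1)// -leNgt.
Qed.

Let expA t l : 0 < t -> I01 l ->
  expR (A t l) <= M * (Num.sqrt t * expR (- (kappa * t))).
Proof.
move=> t0 l01; have /andP[h0 h1] := ltheta _ l01.
have -> : Num.sqrt t = expR (2^-1 * ln t).
  by rewrite -powR12_sqrt ?ltW// /powR gt_eqF.
rewrite /M -!expRD ler_expR /A.
have := lrho _ l01; rewrite ler_norml => /andP[_ hr].
have hm : m * (l * theta) <= `|m| * theta.
  apply: (le_trans (ler_norm _)); rewrite normrM (ger0_norm h0).
  by rewrite ler_wpM2l.
have hz : kappa * t <= t * zr l by rewrite mulrC; apply: ler_wpM2l; [exact: ltW|exact: zr_ge].
have : 2^-1 * (l * rho) <= `|rho|.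
  have := normr_ge0 rho; lra.
lra.
Qed.

Let Cab := 1 + `|m| + 2 * expR `|rho|.

Let albe t l : 0 < t -> I01 l -> `|al t l| + `|be t l| <= Cab * (t^-1 + 1).
Proof.
move=> t0 l01; have ti : 0 < t^-1 by rewrite invr_gt0.
have er : expR (l * rho) <= expR `|rho|.
  by rewrite ler_expR; apply: le_trans (ler_norm _) (lrho _ l01).
have hzr : `|zr l| <= expR `|rho|.
  rewrite normrM ger0_norm ?expR_ge0//; apply: le_trans er.
  by rewrite ler_piMr ?expR_ge0// ler_norml cos_geN1 cos_le1.
have hzi : `|zi l| <= expR `|rho|.
  rewrite normrM ger0_norm ?expR_ge0//; apply: le_trans er.
  by rewrite ler_piMr ?expR_ge0// ler_norml sin_geN1 sin_le1.
have h1 : `|al t l| <= 2^-1 * t^-1 + expR `|rho|.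
  apply: (le_trans (ler_normB _ _)); rewrite lerD//.
  by rewrite ger0_norm// mulr_ge0// ltW.
have h2 : `|be t l| <= `|m| * t^-1 + expR `|rho|.
  apply: (le_trans (ler_normD _ _)); rewrite lerD//.
  by rewrite normrM (ger0_norm (ltW ti)).
apply: (le_trans (lerD h1 h2)).
have e0 := expR_ge0 `|rho|; have m0 := normr_ge0 m.
have := mulr_ge0 e0 (ltW ti); have := mulr_ge0 m0 (ltW ti).
rewrite /Cab; lra.
Qed.

(** The square is the power needed to reach the common majorant: [sqrt t * (1 / t + 1)] equals
    [(1 + t)^2 * gamma_bound t]. *)
Lemma expN_poly_bound (k : R) : 0 < k -> exists2 K : R, 0 <= K &
  forall t : R, 0 < t -> expR (- (k * t)) * (1 + t) ^+ 2 <= K.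
Proof.
(* This [c] gives [c * (1 + t) <= 1 + k / 2 * t <= expR (k / 2 * t)], which is then squared. *)
move=> k0; pose c := Num.min 1 (k / 2).
have c0 : 0 < c by rewrite lt_min ltr01 divr_gt0.
have c1 : c <= 1 by rewrite ge_min lexx.
have ck : c <= k / 2 by rewrite ge_min lexx orbT.
exists (c ^- 2); first by rewrite invr_ge0 sqr_ge0.
move=> t t0; have h : c * (1 + t) <= expR (k / 2 * t).
  apply: le_trans (expR_ge1Dx _); by rewrite mulrDr mulr1 lerD// ler_wpM2r// ltW.
have h2 : c ^+ 2 * (1 + t) ^+ 2 <= expR (k * t).
  have -> : expR (k * t) = expR (k / 2 * t) ^+ 2.
    by rewrite expr2 -expRD; congr expR; field.
  have ct0 : 0 <= c * (1 + t) by rewrite mulr_ge0 ?(ltW c0)// addr_ge0// ltW.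
  by rewrite -exprMn; apply: lerXn2r; rewrite ?nnegrE ?expR_ge0.
rewrite expRN mulrC ler_pdivrMr ?expR_gt0// ler_pdivlMl ?exprn_gt0//.
Qed.

Let gamma_dominated (K : R) t : 0 < t -> expR (- (kappa * t)) * (1 + t) ^+ 2 <= K ->
  Num.sqrt t * expR (- (kappa * t)) * (t^-1 + 1) <= K * gamma_bound t.
Proof.
move=> t0 h; have s0 : 0 < Num.sqrt t by rewrite sqrtr_gt0.
have E : t = Num.sqrt t ^+ 2 by rewrite sqr_sqrtr// ltW.
have t1 : 0 < 1 + t by rewrite addr_gt0.
rewrite /gamma_bound ler_pdivlMr ?mulr_gt0//.
apply: le_trans h; rewrite le_eqVlt; apply/orP; left; apply/eqP.
move: (expR _) => e; move: s0 t1 E; move: (Num.sqrt t) => s s0 t1 E.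
rewrite E in t1 *; field; rewrite gt_eqF//.
Qed.

Let sqrt_exp_le (K : R) t : 0 < t -> expR (- (kappa * t)) * (1 + t) ^+ 2 <= K ->
  Num.sqrt t * expR (- (kappa * t)) <= K * t^-1.
Proof.
move=> t0 h; rewrite ler_pdivlMr//; apply: le_trans h.
rewrite [leLHS](_ : _ = expR (- (kappa * t)) * (Num.sqrt t * t)); last by ring.
rewrite ler_wpM2l ?expR_ge0//.
have s0 : 0 <= Num.sqrt t by exact: sqrtr_ge0.
have E : t = Num.sqrt t ^+ 2 by rewrite sqr_sqrtr// ltW.
move: s0 E; move: (Num.sqrt t) => s s0 E.
have : s <= 1 + t by rewrite E; have := sqr_ge0 (s - 2^-1); lra.
move=> sle; rewrite expr2; apply: ler_pM => //; [exact: ltW|lra].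
Qed.

Let trig_le (e a b x : R) : 0 <= e ->
  `|e * (a * cos x - b * sin x)| <= e * (`|a| + `|b|) /\
  `|e * (a * sin x + b * cos x)| <= e * (`|a| + `|b|).
Proof.
have c1 : `|cos x| <= 1 by rewrite ler_norml cos_geN1 cos_le1.
have s1 : `|sin x| <= 1 by rewrite ler_norml sin_geN1 sin_le1.
move=> e0; split; rewrite normrM (ger0_norm e0) ler_wpM2l//.
  by apply: (le_trans (ler_normB _ _)); rewrite !normrM lerD// ler_piMr.
by apply: (le_trans (ler_normD _ _)); rewrite !normrM lerD// ler_piMr.
Qed.

Lemma cvg_norm_le0 (v e : nat -> R) : (forall n, `|v n| <= e n) ->
  e @ \oo --> (0 : R) -> v @ \oo --> (0 : R).
Proof.
move=> ve e0; apply: (squeeze_cvgr (f := fun n => - e n) (h := e)) => //.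
  by apply: nearW => n; rewrite -ler_norml.
by rewrite -oppr0; exact: cvgN.
Qed.

(** [P] and [Q] carry [t^s] rather than [t^(s - 1)], so their modulus is of order [sqrt t] at 0; at
    infinity the exponential wins. Hence the [t]-derivatives [p] and [q] integrate to 0. *)
Let boundary0 (S : R -> R) l : I01 l -> (forall t, `|S t| <= expR (A t l)) ->
  (fun n : nat => S n.+2%:R^-1) @ \oo --> (0 : R) /\
  (fun n : nat => S n.+2%:R) @ \oo --> (0 : R).
Proof.
move=> l01 SA; have [K K0 hK] := expN_poly_bound _ kappa_gt0; split.
  apply: (cvg_norm_le0 _ (fun n => M * Num.sqrt n.+2%:R^-1)).
    move=> n; apply: (le_trans (SA _)); have n0 : 0 < n.+2%:R^-1 :> R by rewrite invr_gt0.
    apply: (le_trans (expA _ _ n0 l01)); rewrite ler_wpM2l ?expR_ge0//.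
    rewrite ler_piMr ?sqrtr_ge0// -[leRHS]expR0 ler_expR oppr_le0 mulr_ge0// ltW//.
  suff : (fun n : nat => M * Num.sqrt (n.+2%:R : R)^-1) @ \oo --> M * 0 by rewrite mulr0.
  apply: cvgM; first exact: cvg_cst.
  rewrite -[X in _ --> X](sqrtr0 R).
  apply: (@continuous_cvg _ _ _ _ _ (fun n : nat => (n.+2%:R : R)^-1) Num.sqrt 0).
    exact: sqrt_continuous.
  exact: cvg_invn2.
apply: (cvg_norm_le0 _ (fun n => M * (K * n.+2%:R^-1))).
  move=> n; apply: (le_trans (SA _)); have n0 : 0 < n.+2%:R :> R by [].
  apply: (le_trans (expA _ _ n0 l01)); rewrite ler_wpM2l ?expR_ge0//.
  by apply: sqrt_exp_le => //; exact: hK.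
suff : (fun n : nat => M * (K * (n.+2%:R : R)^-1)) @ \oo --> M * (K * 0) by rewrite !mulr0.
by do 2 (apply: cvgM; first exact: cvg_cst); exact: cvg_invn2.
Qed.

Let PA t l : `|P t l| <= expR (A t l).
Proof.
by rewrite /P normrM ger0_norm ?expR_ge0// ler_piMr ?expR_ge0// ler_norml cos_geN1 cos_le1.
Qed.
Let QA t l : `|Q t l| <= expR (A t l).
Proof.
by rewrite /Q normrM ger0_norm ?expR_ge0// ler_piMr ?expR_ge0// ler_norml sin_geN1 sin_le1.
Qed.

Let pq_le : exists2 K : R, 0 <= K & forall t l : R, 0 < t -> I01 l ->
  [/\ `|p t l| <= K * gamma_bound t, `|q t l| <= K * gamma_bound t &
      t^-1 * expR (A t l) <= K * gamma_bound t].
Proof.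
have [K K0 hK] := expN_poly_bound _ kappa_gt0.
have Cab1 : 1 <= Cab by rewrite /Cab -addrA lerDl addr_ge0// mulr_ge0 ?expR_ge0.
have M0 : 0 <= M by exact: expR_ge0.
exists (M * Cab * K); first by rewrite !mulr_ge0// (le_trans _ Cab1).
move=> t l t0 l01.
have ti : 0 < t^-1 by rewrite invr_gt0.
have main : expR (A t l) * (Cab * (t^-1 + 1)) <= M * Cab * K * gamma_bound t.
  apply: (@le_trans _ _ (M * (Num.sqrt t * expR (- (kappa * t))) * (Cab * (t^-1 + 1)))).
    rewrite ler_wpM2r ?expA// mulr_ge0 ?(le_trans _ Cab1)// addr_ge0// ltW//.
  rewrite [leLHS](_ : _ = M * Cab * (Num.sqrt t * expR (- (kappa * t)) * (t^-1 + 1))); last by ring.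
  rewrite -[leRHS]mulrA ler_wpM2l//; first by rewrite mulr_ge0// (le_trans _ Cab1).
  by apply: gamma_dominated => //; exact: hK.
have [h1 h2] := trig_le _ (al t l) (be t l) (B t l) (expR_ge0 (A t l)).
have h3 : expR (A t l) * (`|al t l| + `|be t l|) <= M * Cab * K * gamma_bound t.
  by apply: le_trans main; rewrite ler_wpM2l ?expR_ge0// albe.
split; [exact: le_trans h1 h3|exact: le_trans h2 h3|].
apply: le_trans main; rewrite mulrC ler_wpM2l ?expR_ge0//.
apply: (@le_trans _ _ (t^-1 + 1)); first by rewrite lerDl.
by rewrite ler_peMl// addr_ge0// ltW.
Qed.

Let itg_of_bound (f : R -> R) (K : R) : (forall t, 0 < t -> {for t, continuous f}) ->
  (forall t, 0 < t -> `|f t| <= K * gamma_bound t) -> itg Rp f.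
Proof.
move=> cf fK; apply: (itg_dominated _ _ (fun t => K * gamma_bound t)) => //.
- exact: measurable_fun_Rp_continuous.
- by move=> t; rewrite RpE; exact: fK.
- by apply: itgZl => //; exact: itg_gamma_bound.
Qed.

Let p_int0 l : I01 l -> itg Rp (p ^~ l) /\ rint Rp (p ^~ l) = 0.
Proof.
move=> l01; have [K K0 hK] := pq_le.
have ip : itg Rp (p ^~ l).
  by apply: (itg_of_bound _ K) => t t0; [exact: cpt|have [] := hK t l t0 l01].
have [b0 b1] := boundary0 (P ^~ l) l l01 (fun t => PA t l).
split => //; transitivity (0 - 0 : R); last by rewrite subrr.
apply: (rint_FTC_Rp (P ^~ l) (p ^~ l)) => //.
- by move=> t t0; exact: dPt.
- by move=> t t0; exact: cpt.
Qed.

Let q_int0 l : I01 l -> itg Rp (q ^~ l) /\ rint Rp (q ^~ l) = 0.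
Proof.
move=> l01; have [K K0 hK] := pq_le.
have iq : itg Rp (q ^~ l).
  by apply: (itg_of_bound _ K) => t t0; [exact: cqt|have [] := hK t l t0 l01].
have [b0 b1] := boundary0 (Q ^~ l) l l01 (fun t => QA t l).
split => //; transitivity (0 - 0 : R); last by rewrite subrr.
apply: (rint_FTC_Rp (Q ^~ l) (q ^~ l)) => //.
- by move=> t t0; exact: dQt.
- by move=> t t0; exact: cqt.
Qed.

(** One argument for both components: [(a, b)] is [(rho, theta)] for [P] and [(- theta, rho)] for
    [Q]. The division by [t] turns [t^s] back into the Gamma integrand [t^(s - 1)]. *)
Let rotated (S r : R -> R -> R) (a b : R) :
  (forall t l : R, `|S t l| <= expR (A t l)) ->
  (forall t l : R, r t l = a * p t l + b * q t l) ->
  (forall t l : R, 0 < t -> is_derive l 1 (S t) (t * r t l)) ->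
  (forall t l : R, 0 < t -> {for t, continuous (S ^~ l)}) ->
  rint Rp (fun t => t^-1 * S t 1) = rint Rp (fun t => t^-1 * S t 0).
Proof.
move=> SA rE dS cS; have [K K0 hK] := pq_le.
have iS l : I01 l -> itg Rp (fun t => t^-1 * S t l).
  move=> l01; apply: (itg_of_bound _ K) => t t0.
    by apply: continuousM; [exact: cinv|exact: cS].
  have [_ _] := hK t l t0 l01; apply: le_trans; rewrite normrM ger0_norm ?invr_ge0 ?(ltW t0)//.
  by rewrite ler_wpM2l ?invr_ge0 ?(ltW t0).
have i0 : I01 0 by rewrite /= in_itv /= lexx ler01.
have i1 : I01 1 by rewrite /= in_itv /= lexx ler01.
apply/eqP; rewrite -subr_eq0 -rintB//; [|exact: iS|exact: iS]; apply/eqP.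
rewrite -[RHS](rint_deformation S r (fun t => (`|a| + `|b|) * K * gamma_bound t)) //.
- by apply: eq_rint => t _; rewrite mulrBr.
- move=> t l t0; rewrite (_ : r t = fun l => a * p t l + b * q t l); last exact/funext.
  apply: continuousD; apply: continuousM; try exact: cst_continuous; [exact: cpl|exact: cql].
- rewrite (_ : (fun p0 : R * R => r p0.1 p0.2) =
      fun p0 => a * p p0.1 p0.2 + b * q p0.1 p0.2); last by apply/funext => p0; exact: rE.
  by apply: measurable_funD; apply: measurable_funM.
- by apply: itgZl => //; exact: itg_gamma_bound.
- move=> t l t0 l01; rewrite rE; have [h1 h2 _] := hK t l t0 l01.
  apply: (le_trans (ler_normD _ _)); rewrite (normrM a) (normrM b) -mulrA mulrDl.
  by rewrite lerD// ler_wpM2l.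
- move=> l l01; have [ip p0] := p_int0 l l01; have [iq q0] := q_int0 l l01.
  transitivity (rint Rp (fun t => a * p t l + b * q t l)); first by apply: eq_rint => t _.
  by rewrite rintD ?rintZl// ?p0 ?q0 ?mulr0 ?addr0//; exact: itgZl.
Qed.

Let base (t : R) : C := (hweight t * expR (- (expR rho * cos theta * t)))%:C *
  expi (m * ln t + t * (expR rho * sin theta)).
Let w : C := (expR (2^-1 * rho + m * theta))%:C * expi (m * rho - 2^-1 * theta).

Let inv_sqrt (t : R) : 0 < t -> t^-1 * Num.sqrt t = hweight t.
Proof.
move=> t0; have s0 : Num.sqrt t != 0 by rewrite gt_eqF// sqrtr_gt0.
by rewrite hweightE// -[X in X^-1 * _](sqr_sqrtr (ltW t0)); field.
Qed.

Let baseE t : 0 < t -> base t * w = cmk (t^-1 * P t 1) (t^-1 * Q t 1).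
Proof.
move=> t0.
have sE : Num.sqrt t = expR (2^-1 * ln t) by rewrite -powR12_sqrt ?ltW// /powR gt_eqF.
have eA : t^-1 * expR (A t 1) =
    hweight t * expR (- (expR rho * cos theta * t)) * expR (2^-1 * rho + m * theta).
  have -> : A t 1 = 2^-1 * ln t + - (expR rho * cos theta * t) + (2^-1 * rho + m * theta).
    by rewrite /A /zr !mul1r; ring.
  by rewrite !expRD -sE !mulrA inv_sqrt.
have eB : B t 1 = (m * ln t + t * (expR rho * sin theta)) + (m * rho - 2^-1 * theta).
  by rewrite /B /zi !mul1r; ring.
rewrite /P /Q !mulrA eA eB [cos (_ + (_ - _))]cosD [sin (_ + (_ - _))]sinD.
by apply: cext; rewrite /base /w !creimE /=; ring.
Qed.

(* With [s = 1/2 + i m] and [z = expR rho * expi (- theta)], [base t] is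
   [t^(s - 1) e^(- z t)] and [w] is [z^s]. *)
Lemma gamma_rotation : cint Rp base * w = cGamma (cmk 2^-1 m).
Proof.
have [K K0 hK] := expN_poly_bound _ kappa_gt0.
have d0 : 0 < expR rho * cos theta by rewrite mulr_gt0 ?expR_gt0.
have [K1 K10 hK1] := expN_poly_bound _ d0.
rewrite -cintZr//; last first.
  apply: (cintegrable_dominated _ _ (fun t => K1 * gamma_bound t * 2)) => //.
  - apply: cmeasM.
      apply: cmeas_real; apply: measurable_funM; first exact: measurable_hweight.
      by apply: measurable_fun_Rp_continuous => t t0; eapply derive_continuous; derivs.
    apply: cmeas_expi; apply: measurable_fun_Rp_continuous => t t0.
    by eapply derive_continuous; derivs.
  - move=> t; rewrite RpE => t0; apply: norm1_le_mul; last exact: norm1_expi.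
    rewrite norm1_real ger0_norm ?mulr_ge0 ?hweight_ge0 ?expR_ge0//.
    have s0 : 0 < Num.sqrt t by rewrite sqrtr_gt0.
    have t1 : 0 < 1 + t by rewrite addr_gt0.
    rewrite hweightE// /gamma_bound invfM mulrCA ler_pM2l ?invr_gt0//.
    rewrite ler_pdivlMr//; apply: le_trans (hK1 t t0); rewrite ler_pM2l ?expR_gt0//.
    by rewrite expr2 ler_peMl// ?(ltW t1)// lerDl ltW.
  - by apply: itgZr => //; apply: itgZl => //; exact: itg_gamma_bound.
rewrite (@eq_cint _ Rp _ (fun t => cmk (t^-1 * P t 1) (t^-1 * Q t 1))); last first.
  by move=> t; rewrite RpE => t0; exact: baseE.
have PE : rint Rp (fun t => t^-1 * P t 1) = rint Rp (fun t => t^-1 * P t 0).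
  apply: (rotated P (fun t l => rho * p t l + theta * q t l) rho theta) => //.
  by move=> t l t0; apply: derive_continuous (dPt t l t0).
have QE : rint Rp (fun t => t^-1 * Q t 1) = rint Rp (fun t => t^-1 * Q t 0).
  apply: (rotated Q (fun t l => rho * q t l - theta * p t l) (- theta) rho) => //.
  - by move=> t l; ring.
  - by move=> t l t0; apply: derive_continuous (dQt t l t0).
have E0 t : 0 < t -> (powR t (2^-1 - 1) * expR (- t))%:C * expi (m * ln t) =
    cmk (t^-1 * P t 0) (t^-1 * Q t 0).
  move=> t0.
  have sE : Num.sqrt t = expR (2^-1 * ln t) by rewrite -powR12_sqrt ?ltW// /powR gt_eqF.
  have eA : t^-1 * expR (A t 0) = powR t (2^-1 - 1) * expR (- t).
    rewrite (_ : 2^-1 - 1 = - 2^-1); last by field.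
    have -> : A t 0 = 2^-1 * ln t + - t.
      by rewrite /A /zr !mul0r expR0 cos0; ring.
    by rewrite expRD -sE mulrA inv_sqrt.
  have eB : B t 0 = m * ln t by rewrite /B /zi !mul0r sin0; ring.
  rewrite /P /Q !mulrA eA eB; apply: cext; rewrite !creimE /=; ring.
transitivity (cint Rp (fun t => cmk (t^-1 * P t 0) (t^-1 * Q t 0))).
  by apply: cext; rewrite /= ?PE ?QE.
by apply: eq_cint => t; rewrite RpE => t0; exact: esym (E0 t t0).
Qed.

End Contour.

(** * The multiplier *)

Section Multiplier.
Context {R : realType}.
Local Notation C := R[i].
Local Notation mu := (@lebesgue_measure R).
Local Notation itg D f := (mu.-integrable D (EFin \o (f : R -> R))).
Local Notation rint D f := (Rintegral mu D f).
Local Notation Rp := (@Rp R).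
Local Notation c0 := (@csqrt2pi_inv R).
Local Notation Ik := compact_exhaustion.
Implicit Types (f g x y : R -> C) (z : C) (s : bool).

Lemma expiD (a b : R) : expi (a + b) = expi a * expi b.
Proof. by apply: cext; rewrite !creimE /= ?cosD ?sinD//; ring. Qed.

Lemma norm1_mul_real z (r : R) : norm1 (z * r%:C) = norm1 z * `|r|.
Proof. by rewrite /norm1 !creimE /= !mulr0 subr0 add0r !normrM mulrDl. Qed.

Lemma realM (a b : R) : (a * b)%:C = a%:C * b%:C :> C.
Proof. by apply: cext; rewrite !creimE /= ; ring. Qed.

Definition gam s (m : R) : C := cGamma (cmk 2^-1 (sgnm s m)).
Definition multiplier s (m : R) : C := if s then Fpm m else Fmp m.

Lemma multiplierE s (m : R) : multiplier s m =
  c0 * expi (pi / 4) * (expR (- (pi / 2 * sgnm s m)))%:C * gam s m.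
Proof.
case: s; rewrite /multiplier /Fpm /Fmp /gam /sgnm; first by rewrite mulNr.
by rewrite mulrN opprK.
Qed.

Lemma norm1_gamma_integrand (m t : R) : 0 < t ->
  norm1 ((powR t (2^-1 - 1) * expR (- t))%:C * expi (m * ln t)) <=
  2 * (powR t (2^-1 - 1) * expR (- t)).
Proof.
move=> t0; apply: (le_trans (norm1_mul_expi _ _)).
by rewrite norm1_real ger0_norm ?mulr_ge0 ?powR_ge0 ?expR_ge0.
Qed.

Lemma measurable_gamma_weight :
  measurable_fun Rp (fun t : R => powR t (2^-1 - 1) * expR (- t)).
Proof.
apply: measurable_funM; first by apply: measurable_funTS; exact: measurable_powR.
by apply: measurable_fun_Rp_continuous => t t0; eapply derive_continuous; derivs.
Qed.

Lemma itg_gamma_weight : itg Rp (fun t : R => powR t (2^-1 - 1) * expR (- t)).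
Proof.
have [K K0 hK] := @expN_poly_bound R 1 ltr01.
apply: (itg_dominated _ _ (fun t => K * gamma_bound t)) => //.
- exact: measurable_gamma_weight.
- move=> t; rewrite RpE => t0; rewrite ger0_norm ?mulr_ge0 ?powR_ge0 ?expR_ge0//.
  have t1 : 0 < 1 + t by rewrite addr_gt0.
  have s0 : 0 < Num.sqrt t by rewrite sqrtr_gt0.
  rewrite (_ : 2^-1 - 1 = - 2^-1); last by field.
  rewrite -/(hweight t) hweightE// /gamma_bound invfM mulrCA ler_pM2l ?invr_gt0//.
  rewrite ler_pdivlMr//; apply: le_trans (hK t t0); rewrite mul1r ler_pM2l ?expR_gt0//.
  by rewrite expr2 ler_peMl// ?(ltW t1)// lerDl ltW.
- by apply: itgZl => //; exact: itg_gamma_bound.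
Qed.

(** The modulus of the integrand does not depend on [m], so one constant covers both signs and all
    [m]. *)
Lemma gam_le : exists2 K : R, 0 <= K & forall s m, norm1 (gam s m) <= K.
Proof.
exists (2 * rint Rp (fun t : R => 2 * (powR t (2^-1 - 1) * expR (- t)))).
  rewrite mulr_ge0//; apply: Rintegral_ge0 => t _.
  by rewrite mulr_ge0// mulr_ge0 ?powR_ge0 ?expR_ge0.
move=> s m; apply: norm1_cint_le => //.
- apply: cmeasM; first by apply: cmeas_real; exact: measurable_gamma_weight.
  apply: cmeas_expi; apply: measurable_funM; first exact: measurable_cst.
  exact: measurable_lnRp.
- by move=> t; rewrite RpE; exact: norm1_gamma_integrand.
- by apply: itgZl => //; exact: itg_gamma_weight.
Qed.

Lemma cmeas_gam s : cmeas Rp (gam s).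
Proof.
apply: (cint_measurable Rp Rp (fun m t =>
  (powR t (2^-1 - 1) * expR (- t))%:C * expi (sgnm s m * ln t))) => //.
apply: cmeasM; last by apply: cmeas_phase; exact: measurable_lnRp.
apply: cmeas_real.
exact: (meas2_snd _ _ (fun t : R => powR t (2^-1 - 1) * expR (- t)) measurable_Rp
  measurable_Rp measurable_gamma_weight).
Qed.

Lemma cmeas_multiplier s : cmeas Rp (multiplier s).
Proof.
have -> : multiplier s = fun m => c0 * expi (pi / 4) *
    (expR (- (pi / 2 * sgnm s m)))%:C * gam s m.
  by apply/funext => m; exact: multiplierE.
apply: cmeasM; last exact: cmeas_gam.
apply: cmeasM; first exact: cmeas_cst.
apply: cmeas_real; apply: (measurableT_comp (@measurable_expR R)).
apply: measurableT_comp => //; apply: measurable_funM; first exact: measurable_cst.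
exact: (measurable_funTS (measurable_sgnm s)).
Qed.

Lemma abs_sgnm s (m : R) : `|sgnm s m| = `|m|.
Proof. by case: s; rewrite /sgnm ?normrN. Qed.

Lemma Ik_le k (m : R) : Ik k m -> `|m| <= k.+2%:R.
Proof.
move=> mk; have m0 := Ik_gt0 _ _ mk; rewrite gtr0_norm//.
by move: mk; rewrite /compact_exhaustion /= in_itv /= => /andP[].
Qed.

(** The uniform bound on Gamma multiplies an exponential that may grow like [e^(pi m / 2)], so the
    estimate is local; this forces test functions supported in some [Ik k]. *)
Lemma multiplier_le s k : exists2 K : R, 0 <= K &
  forall m, Ik k m -> norm1 (multiplier s m) <= K.
Proof.
have [K K0 hK] := gam_le.
exists (norm1 c0 * 2 * expR (pi / 2 * k.+2%:R) * K).
  by rewrite !mulr_ge0 ?norm1_ge0 ?expR_ge0.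
move=> m mk; rewrite multiplierE; apply: norm1_le_mul => //.
apply: norm1_le_mul.
  by apply: norm1_le_mul => //; exact: norm1_expi.
rewrite norm1_real ger0_norm ?expR_ge0// ler_expR; apply: le_trans (ler_norm _) _.
rewrite normrN normrM ger0_norm ?divr_ge0 ?pi_ge0// abs_sgnm ler_wpM2l ?divr_ge0 ?pi_ge0//.
exact: Ik_le.
Qed.

Definition supp_in k g := forall t, 0 < t -> ~ Ik k t -> g t = 0.

Lemma truncated_L1n k g : L2p g -> supp_in k g -> L1n g.
Proof.
move=> [mg jg] gk; split => //.
apply: (itg_dominated _ _ (fun t => ((fun=> 1 : R) \_ (Ik k)) t + cnorm2 (g t))) => //.
- exact: cmeas_norm1.
- move=> t; rewrite RpE => t0; rewrite ger0_norm ?norm1_ge0// patchE.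
  case: ifPn => [_|/negP tk].
    have := @norm1M_AMGM R 1 1%:C (g t) ltr01.
    by rewrite mulrC norm1_mul_real normr1 mulr1 cnorm2_real expr1n invr1 !mul1r.
  rewrite gk//; last by move=> h; apply: tk; rewrite inE.
  by rewrite /norm1 /= normr0 addr0 add0r cnorm2_ge0.
- apply: itgD => //; apply: itg_restrict => //; rewrite (setIidr (@Ik_sub R k)).
  apply: (itg_bounded _ _ 1) => //; [exact: mu_Ik|by move=> *; rewrite normr1].
Qed.

Lemma L2p_bounded_mul k (h : R -> C) (K : R) f : cmeas Rp h -> 0 <= K ->
  (forall m, Ik k m -> norm1 (h m) <= K) -> supp_in k f -> L2p f ->
  L2p (fun t => h t * f t).
Proof.
move=> mh K0 hK fk [mf jf].
apply: (proj1 (L2p_dominated _ (fun t => K ^+ 2 * cnorm2 (f t)) _ _ _)).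
- exact: cmeasM.
- move=> t t0; have [tk|tk] := pselect (Ik k t).
    rewrite cnorm2M ler_wpM2r ?cnorm2_ge0//; apply: (le_trans (cnorm2_le_norm1 _)).
    by apply: lerXn2r; rewrite ?nnegrE ?norm1_ge0// hK.
  by rewrite fk// mulr0 cnorm2_0 mulr0.
- exact: itgZl.
Qed.

(** * Removal of the damping against a compactly supported test function *)

Section Limit.
Variables (s : bool) (k : nat) (g : R -> C).
Hypothesis (hg : L2p g) (gk : supp_in k g).
Let g1 : L1n g. Proof. exact: truncated_L1n gk. Qed.
Let G := Uadj s g.
Let g' (m : R) := multiplier s m * g m.
Let G' := Uadj (~~ s) g'.

Let hg' : L2p g'.
Proof.
have [K K0 hK] := multiplier_le s k.
by apply: (L2p_bounded_mul k _ K) => //; exact: cmeas_multiplier.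
Qed.
Let gk' : supp_in k g'.
Proof. by move=> t t0 tk; rewrite /g' gk// mulr0. Qed.
Let g1' : L1n g'. Proof. exact: truncated_L1n gk'. Qed.

Let Fd n := FRp_int (damp n G).

Let damp_L1n n : L1n (damp n G).
Proof.
have mG : cmeas Rp G by apply: cmeas_Uadj; have [] := g1.
have [K K0 GK] := Uadj_le s g g1.
have n0 : 0 < n.+1%:R^-1 :> R by rewrite invr_gt0.
have [K1 K10 hK] := expN_poly_bound _ n0.
split; first exact: cmeas_damp.
apply: (itg_dominated _ _ (fun t => K * K1 * gamma_bound t)) => //.
- by apply: cmeas_norm1; exact: cmeas_damp.
- move=> t; rewrite RpE => t0; rewrite ger0_norm ?norm1_ge0// /damp norm1_mul_real.
  rewrite (ger0_norm (expR_ge0 _)).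
  apply: (@le_trans _ _ (K * hweight t * expR (- (n.+1%:R^-1 * t)))).
    by rewrite ler_wpM2r ?expR_ge0// GK.
  rewrite -!mulrA ler_wpM2l//.
  have t1 : 0 < 1 + t by rewrite addr_gt0.
  rewrite hweightE// /gamma_bound invfM [leRHS]mulrCA ler_pM2l ?invr_gt0 ?sqrtr_gt0//.
  rewrite ler_pdivlMr//; apply: le_trans (hK t t0); rewrite ler_pM2l ?expR_gt0//.
  by rewrite expr2 ler_peMl// ?(ltW t1)// lerDl ltW.
- by apply: itgZl => //; exact: itg_gamma_bound.
Qed.

(* Polar coordinates [z = expR (rad xi v) * expi (- (pi / 2 - atan v))] of
   [z = xi * v - i xi], with [v = (damping rate) / xi]. *)
Let rad (xi v : R) := ln xi + ln (Num.sqrt (1 + v * v)).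
Let ang (v : R) := pi / 2 - atan v.
(** The power [z^(- s')] with [s' = 1/2 + i (sgnm s u)], inverse to the factor multiplying the
    integral in [gamma_rotation]. At [v = 0] it is the boundary value at [z = - i xi]. *)
Let wt xi v (u : R) : C :=
  (expR (- (2^-1 * rad xi v + sgnm s u * ang v)))%:C *
  expi (- (sgnm s u * rad xi v - 2^-1 * ang v)).

Let sq1 (v : R) : 0 < 1 + v * v.
Proof. by rewrite ltr_pwDl// -expr2 sqr_ge0. Qed.

Let laplace n xi u : 0 < xi ->
  cint Rp (fun t => (hweight t * expR (- (n.+1%:R^-1 * t)))%:C *
    expi (sgnm s u * ln t + t * xi)) = gam s u * wt xi (n.+1%:R^-1 / xi) u.
Proof.
move=> xi0; set a : R := n.+1%:R^-1; have a0 : 0 < a by rewrite invr_gt0.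
set v := a / xi; have v0 : 0 < v by rewrite divr_gt0.
have S0 : 0 < Num.sqrt (1 + v * v) by rewrite sqrtr_gt0.
have eR : expR (rad xi v) = xi * Num.sqrt (1 + v * v).
  by rewrite /rad expRD !lnK// posrE.
have ca : cos (atan v) = (Num.sqrt (1 + v * v))^-1 by rewrite cos_atan expr2.
have ec : expR (rad xi v) * cos (ang v) = a.
  have ca0 : cos (atan v) != 0 by rewrite ca gt_eqF// invr_gt0.
  have -> : cos (ang v) = v * cos (atan v).
    by rewrite -{2}(atanK v) /tan divfK// /ang addrC cosDpihalf sinN opprK.
  rewrite eR ca /v; field; rewrite ?gt_eqF//.
have es : expR (rad xi v) * sin (ang v) = xi.
  have -> : sin (ang v) = cos (atan v).
    by rewrite /ang addrC sinDpihalf cosN.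
  rewrite eR ca; field; rewrite ?gt_eqF//.
have ang0 : 0 <= ang v by rewrite subr_ge0 ltW// atan_ltpi2.
have anglt : ang v < pi / 2.
  by rewrite /ang gtrDl oppr_lt0 -atan0 lt_atan.
have := @gamma_rotation R (sgnm s u) (rad xi v) (ang v) ang0 anglt.
rewrite ec es -/(gam s u) => <-.
(* The rotation formula carries the factor [z^s'] on the side of the integral; it cancels against
   [wt]. *)
rewrite -mulrA -[LHS]mulr1; congr (_ * _).
rewrite /wt mulrACA -realM -expiD -expRD !subrr expR0.
by apply: cext; rewrite !creimE /= cos0 sin0; ring.
Qed.

Let sqrt_ge1 (v : R) : 1 <= Num.sqrt (1 + v * v).
Proof. by rewrite -[leLHS]sqrtr1 ler_wsqrtr// lerDl -expr2 sqr_ge0. Qed.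

Let cmeas_wt xi v : cmeas Rp (wt xi v).
Proof.
have ms : measurable_fun Rp (sgnm s) by exact: (measurable_funTS (measurable_sgnm s)).
apply: cmeasM.
  apply: cmeas_real; apply: (measurableT_comp (@measurable_expR R)).
  apply: measurableT_comp => //; apply: measurable_funD; first exact: measurable_cst.
  by apply: measurable_funM => //; exact: measurable_cst.
apply: cmeas_expi; apply: measurableT_comp => //.
apply: measurable_funB; last exact: measurable_cst.
by apply: measurable_funM => //; exact: measurable_cst.
Qed.

Let W : R := 2 * expR (k.+2%:R * (pi / 2)).

(** Uniform in the damping: [|z| >= xi] bounds [|z|^(- 1/2)] by [xi^(- 1/2)], and the angle stays in
    [[0, pi / 2]] while [u <= k + 2]. The 2 in [W] is the bound for [norm1] of a phase. *)
Let wt_le xi v u : 0 < xi -> 0 <= v -> Ik k u -> norm1 (wt xi v u) <= hweight xi * W.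
Proof.
move=> xi0 v0 uk; apply: (le_trans (norm1_mul_expi _ _)).
rewrite norm1_real ger0_norm ?expR_ge0// /W mulrCA ler_pM2l//.
have -> : hweight xi = expR (- (2^-1 * ln xi)).
  by rewrite /hweight /powR gt_eqF// mulNr.
rewrite -expRD ler_expR opprD lerD//.
  by rewrite lerN2 ler_pM2l// lerDl ln_ge0.
apply: (le_trans (ler_norm _)); rewrite normrN normrM abs_sgnm.
apply: ler_pM => //; first exact: Ik_le.
have a0 : 0 <= atan v by rewrite -atan0 le_atan.
by rewrite ger0_norm /ang ?gerBl// subr_ge0 ltW// atan_ltpi2.
Qed.

Let integrand_le (Kg : R) xi v u : 0 < xi -> 0 <= v -> 0 < u ->
  (forall m, norm1 (gam s m) <= Kg) ->
  norm1 (g u * (gam s u * wt xi v u)) <= norm1 (g u) * (Kg * (hweight xi * W)).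
Proof.
move=> xi0 v0 u0 hK; have [uk|uk] := pselect (Ik k u); last first.
  by rewrite gk// !mul0r /norm1 /= normr0 addr0 mul0r.
by apply: norm1_le_mul => //; apply: norm1_le_mul => //; exact: wt_le.
Qed.

Let FdE n xi : 0 < xi ->
  Fd n xi = c0 * c0 * cint Rp (fun u => g u * (gam s u * wt xi (n.+1%:R^-1 / xi) u)).
Proof.
move=> xi0; rewrite /Fd /FRp_int -mulrA; congr (_ * _).
have mexp : measurable_fun Rp (fun t : R => expR (- (n.+1%:R^-1 * t))).
  by apply: measurable_fun_Rp_continuous => t t0; eapply derive_continuous; derivs.
pose h t : C := (hweight t * expR (- (n.+1%:R^-1 * t)))%:C * expi (xi * t).
have mh : cmeas Rp h.
  apply: cmeasM.
    by apply: cmeas_real; apply: measurable_funM => //; exact: measurable_hweight.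
  by apply: cmeas_expi; apply: measurable_funM => //; exact: measurable_cst.
have n0 : 0 < n.+1%:R^-1 :> R by rewrite invr_gt0.
have [K1 K10 hK] := expN_poly_bound _ n0.
have weight_le t : 0 < t -> norm1 (hweight t * expR (- (n.+1%:R^-1 * t)))%:C <=
    K1 * gamma_bound t.
  move=> t0; rewrite norm1_real ger0_norm ?mulr_ge0 ?hweight_ge0 ?expR_ge0//.
  have t1 : 0 < 1 + t by rewrite addr_gt0.
  rewrite hweightE// /gamma_bound invfM [leRHS]mulrCA ler_pM2l ?invr_gt0 ?sqrtr_gt0//.
  rewrite ler_pdivlMr//; apply: le_trans (hK t t0); rewrite ler_pM2l ?expR_gt0//.
  by rewrite expr2 ler_peMl// ?(ltW t1)// lerDl ltW.
have h_le t : 0 < t -> norm1 (h t) <= 2 * (K1 * gamma_bound t).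
  move=> t0; apply: (le_trans (norm1_mul_expi _ _)); rewrite ler_pM2l//.
  exact: weight_le.
have ih : itg Rp (fun t => 2 * (K1 * gamma_bound t)).
  by apply: itgZl => //; apply: itgZl => //; exact: itg_gamma_bound.
have [mg jg] := g1.
(* In [kernel_duality] the test function [g] takes the place of [x], and the damped Fourier phase
   times [t^(- 1/2)] that of [g]; the inner integral in [t] then becomes [laplace]. *)
transitivity (cint Rp (fun t => cint Rp (fun u => g u * expi (sgnm s u * ln t)) * (c0 * h t))).
  apply: eq_cint => t _; rewrite /damp /G /Uadj /h realM.
  move: (cint _ _) (expR _)%:C (hweight t)%:C (expi _) => A B D E; ring.
rewrite (kernel_duality g (fun t => c0 * h t) (fun t u => expi (sgnm s u * ln t))
  (fun u => 2 * norm1 (g u)) (fun t => 2 * (norm1 c0 * (2 * (K1 * gamma_bound t)))) (fun=> 1)).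
- rewrite -cintZl//; last first.
    have [Kg Kg0 hKg] := gam_le.
    apply: (cintegrable_dominated _ _
      (fun u => norm1 (g u) * (Kg * (hweight xi * W)))) => //.
    + apply: cmeasM => //; apply: cmeasM; [exact: cmeas_gam|exact: cmeas_wt].
    + by move=> u; rewrite RpE => u0; apply: integrand_le => //; rewrite divr_ge0 ?ltW.
    + exact: itgZr.
  apply: eq_cint => u _; rewrite mulrCA; congr (_ * _).
  rewrite -laplace// -cintZl//; last first.
    apply: (cintegrable_dominated _ _ (fun t => 2 * (K1 * gamma_bound t))) => //.
    + apply: cmeasM.
        by apply: cmeas_real; apply: measurable_funM => //; exact: measurable_hweight.
      apply: cmeas_expi; apply: measurable_funD; apply: measurable_funM.
      * exact: measurable_cst.
      * exact: measurable_lnRp.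
      * exact: measurable_id.
      * exact: measurable_cst.
    + move=> t; rewrite RpE => t0; apply: (le_trans (norm1_mul_expi _ _)).
      by rewrite ler_pM2l// weight_le.
  by apply: eq_cint => t _; rewrite /h -!mulrA -expiD [xi * t]mulrC [t * xi + _]addrC.
- exact: mg.
- by apply: cmeasM => //; exact: cmeas_cst.
- apply: cmeas_expi; apply: measurable_funM.
    exact: (meas2_snd _ _ (sgnm s) measurable_Rp measurable_Rp
      (measurable_funTS (measurable_sgnm s))).
  exact: (meas2_fst _ _ (@ln R) measurable_Rp measurable_Rp measurable_lnRp).
- exact: itgZl.
- by do 2 apply: itgZl => //.
- by move=> t u _ _; exact: norm1_mul_expi.
- move=> t u t0 _; rewrite mulr1; apply: (le_trans (norm1_mul_expi _ _)).
  by rewrite ler_pM2l//; apply: norm1_le_mul => //; exact: h_le.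
- move=> t t0; apply: (le_trans (norm1_le_mul _ _ _ _ (lexx _) (h_le t t0))).
  by rewrite ler_peMl ?ler1n// (le_trans (norm1_ge0 (c0 * h t)))// norm1_le_mul// h_le.
Qed.

Let cvg_shrink xi : (fun n : nat => n.+1%:R^-1 / xi) @ \oo --> (0 : R).
Proof.
suff : (fun n : nat => n.+1%:R^-1 / xi) @ \oo --> 0 / xi by rewrite mul0r.
apply: cvgM; [exact: cvg_harmonic|exact: cvg_cst].
Qed.

(** The polar formulas are smooth at [v = 0], so the limit is a value: [(- i xi)^(- 1/2 - i m)]
    equals [xi^(- 1/2) e^(i pi / 4) e^(- pi m / 2) xi^(- i m)]. The sign in the last power exchanges
    the two halves of [U]. *)
Let wt_cvg xi u : 0 < xi ->
  ccvg (fun n => wt xi (n.+1%:R^-1 / xi) u)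
    ((hweight xi)%:C * (expi (pi / 4) * (expR (- (pi / 2 * sgnm s u)))%:C *
     expi (sgnm (~~ s) u * ln xi))).
Proof.
move=> xi0.
pose f1 v := expR (- (2^-1 * rad xi v + sgnm s u * ang v)).
pose f2 v := - (sgnm s u * rad xi v - 2^-1 * ang v).
have c1 : {for 0, continuous f1}.
  by eapply derive_continuous; rewrite /f1 /rad /ang; derivs; rewrite ?sqrtr_gt0.
have c2 : {for 0, continuous f2}.
  by eapply derive_continuous; rewrite /f2 /rad /ang; derivs; rewrite ?sqrtr_gt0.
have h1 : (fun n : nat => f1 (n.+1%:R^-1 / xi)) @ \oo --> f1 0.
  by apply: (@continuous_cvg _ _ _ _ _ (fun n : nat => n.+1%:R^-1 / xi) f1 0).
have h2 : (fun n : nat => f2 (n.+1%:R^-1 / xi)) @ \oo --> f2 0.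
  by apply: (@continuous_cvg _ _ _ _ _ (fun n : nat => n.+1%:R^-1 / xi) f2 0).
have E1 : f1 0 = hweight xi * expR (- (pi / 2 * sgnm s u)).
  rewrite /hweight /powR gt_eqF// -expRD /f1 /rad /ang mul0r addr0 sqrtr1 ln1 atan0.
  by congr expR; ring.
have E2 : f2 0 = pi / 4 + sgnm (~~ s) u * ln xi.
  rewrite /f2 /rad /ang mul0r addr0 sqrtr1 ln1 atan0.
  have -> : sgnm (~~ s) u = - sgnm s u by case: (s); rewrite /sgnm /= ?opprK.
  by field.
have := ccvgM _ _ _ _ (ccvg_real _ _ h1) (ccvg_expi _ _ h2).
rewrite E1 E2 realM expiD.
by rewrite -[X in ccvg _ X]mulrA [X in _ * X](_ : _ = expi (pi / 4) *
  (expR (- (pi / 2 * sgnm s u)))%:C * expi (sgnm (~~ s) u * ln xi))//; rewrite mulrA;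
  congr (_ * _); rewrite mulrC.
Qed.

Let Fd_le : exists2 K : R, 0 <= K & forall n xi, 0 < xi -> norm1 (Fd n xi) <= K * hweight xi.
Proof.
have [Kg Kg0 hKg] := gam_le; have [mg jg] := g1.
exists (norm1 c0 * norm1 c0 * (2 * rint Rp (fun u => norm1 (g u) * (Kg * W)))).
  rewrite !mulr_ge0 ?norm1_ge0//; apply: Rintegral_ge0 => u _.
  by rewrite !mulr_ge0 ?norm1_ge0 ?expR_ge0.
move=> n xi xi0; rewrite FdE// -!mulrA mulrA [leRHS]mulrA.
apply: norm1_le_mul; first exact: norm1M.
rewrite -rintZr//; last exact: itgZr.
apply: norm1_cint_le => //.
- apply: cmeasM => //; apply: cmeasM; [exact: cmeas_gam|exact: cmeas_wt].
- move=> u; rewrite RpE => u0.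
  rewrite [leRHS](_ : _ = norm1 (g u) * (Kg * (hweight xi * W))); last by ring.
  by apply: integrand_le => //; rewrite divr_ge0 ?ltW.
- by apply: itgZr => //; exact: itgZr.
Qed.

Let Fd_cvg xi : 0 < xi -> ccvg (fun n => Fd n xi) (G' xi).
Proof.
move=> xi0; have [Kg Kg0 hKg] := gam_le; have [mg jg] := g1.
have -> : G' xi = c0 * c0 * cint Rp (fun u => g u * (gam s u *
    ((hweight xi)%:C * (expi (pi / 4) * (expR (- (pi / 2 * sgnm s u)))%:C *
     expi (sgnm (~~ s) u * ln xi))))).
  (* One factor [c0] comes from [Uadj], the other from the multiplier. *)
  rewrite /G' /Uadj -!mulrA; congr (_ * _).
  have [mg' jg'] := g1'.
  have ms : measurable_fun Rp (fun u => sgnm (~~ s) u * ln xi).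
    apply: measurable_funM; last exact: measurable_cst.
    exact: (measurable_funTS (measurable_sgnm (~~ s))).
  rewrite -cintZl//; last first.
    apply: (cintegrable_dominated _ _ (fun u => 2 * norm1 (g' u))) => //.
    + by apply: cmeasM => //; exact: cmeas_expi.
    + by move=> u _; exact: norm1_mul_expi.
    + exact: itgZl.
  rewrite -cintZl//; last first.
    apply: (cintegrable_dominated _ _ (fun u => norm1 (g u) * (Kg * (hweight xi * (2 * expR (pi / 2 * k.+2%:R) * 2))))) => //.
    + apply: cmeasM => //; apply: cmeasM; first exact: cmeas_gam.
      apply: cmeasM; first exact: cmeas_cst.
      apply: cmeasM; last exact: cmeas_expi.
      apply: cmeasM; first exact: cmeas_cst.
      apply: cmeas_real; apply: (measurableT_comp (@measurable_expR R)).
      apply: measurableT_comp => //; apply: measurable_funM; first exact: measurable_cst.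
      exact: (measurable_funTS (measurable_sgnm s)).
    + move=> u; rewrite RpE => u0; have [uk|uk] := pselect (Ik k u); last first.
        by rewrite gk// !mul0r /norm1 /= normr0 addr0 mul0r.
      do 2 (apply: norm1_le_mul => //); apply: norm1_le_mul.
        by rewrite norm1_real ger0_norm ?hweight_ge0.
      apply: norm1_le_mul; last exact: norm1_expi.
      apply: norm1_le_mul; first exact: norm1_expi.
      rewrite norm1_real ger0_norm ?expR_ge0// ler_expR; apply: le_trans (ler_norm _) _.
      rewrite normrN normrM ger0_norm ?divr_ge0 ?pi_ge0// abs_sgnm ler_wpM2l ?divr_ge0 ?pi_ge0//.
      exact: Ik_le.
    + exact: itgZr.
  by apply: eq_cint => u _; rewrite /g' multiplierE; ring.
rewrite (_ : (fun n => Fd n xi) = fun n => c0 * c0 * cint Rp (fun u =>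
    g u * (gam s u * wt xi (n.+1%:R^-1 / xi) u))); last first.
  by apply/funext => n; rewrite FdE.
apply: ccvgM; first exact: ccvg_cst.
apply: (cdct _ _ _ (fun u => norm1 (g u) * (Kg * (hweight xi * W)))) => //.
- by move=> n; apply: cmeasM => //; apply: cmeasM; [exact: cmeas_gam|exact: cmeas_wt].
- exact: itgZr.
- by move=> n u; rewrite RpE => u0; apply: integrand_le => //; rewrite divr_ge0 ?ltW.
- move=> u _; apply: ccvgM; first exact: ccvg_cst.
  by apply: ccvgM; [exact: ccvg_cst|exact: wt_cvg].
Qed.


Lemma ccvgB (u v : nat -> C) z w : ccvg u z -> ccvg v w ->
  ccvg (fun n => u n - v n) (z - w).
Proof.
move=> [a b] [c d]; split.
  by rewrite creD creN; under eq_cvg do rewrite creD creN; exact: cvgB.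
by rewrite cimD cimN; under eq_cvg do rewrite cimD cimN; exact: cvgB.
Qed.

Lemma norm1_lim_le (u : nat -> C) z (e : R) : ccvg u z ->
  (forall n, norm1 (u n) <= e) -> norm1 z <= 2 * e.
Proof.
move=> [a b] ue; rewrite mulrDl mul1r lerD//.
  have h : (fun n => `|cre (u n)|) @ \oo --> `|cre z| by exact: cvg_norm.
  rewrite -(cvg_lim _ h)//; apply: limr_le; first exact: cvgP h.
  by apply: nearW => n; exact: le_trans (norm1_re _) (ue n).
have h : (fun n => `|cim (u n)|) @ \oo --> `|cim z| by exact: cvg_norm.
rewrite -(cvg_lim _ h)//; apply: limr_le; first exact: cvgP h.
by apply: nearW => n; exact: le_trans (norm1_im _) (ue n).
Qed.

(** Two limits have to be interchanged: [n] removes the damping, [j] approximates [x]. For fixed [j]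
    pointwise domination handles [n]; the error in [j] is uniform in [n] because damping and Fourier
    transform are bounded on L^2. *)
Lemma transform_pairing x fx yp ym zp zm :
  IsFRp x fx -> IsU x yp ym -> IsU fx zp zm ->
  pairing (if s then zp else zm) g =
  pairing (if ~~ s then yp else ym) (fun m => multiplier s m * g m).
Proof.
move=> hfx hUx hUfx.
rewrite (IsU_pairing fx zp zm s g hUfx hg g1) -/G.
rewrite -/g' (IsU_pairing x yp ym (~~ s) g' hUx hg' g1') -/G'.
have LG : L2p G by exact: Uadj_L2p.
have LG' : L2p G' by exact: Uadj_L2p.
have [Lx [Lfx _]] := hfx.
(* The dense sequence is the one that witnesses [IsU] for [x]. *)
have [_ [_ [_ [ys [dys [cy _]]]]]] := hUx.
have Lys j : L2p (ys j) by have [] := dys j.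
have LFd n : L2p (Fd n) /\ l2norm2 (Fd n) <= opbound * l2norm2 G.
  have [LD ND] := damp_bound n G LG.
  have [LF NF] := FRp_bound (damp n G) LD (damp_L1n n); split => //.
  by apply: (le_trans NF); rewrite ler_wpM2l ?opbound_ge0.
have aE n : pairing fx (damp n G) = pairing x (Fd n).
  by apply: IsFRp_pairing => //; have [] := damp_bound n G LG.
have a_cvg : ccvg (fun n => pairing x (Fd n)) (pairing fx G).
  rewrite (_ : (fun n => _) = fun n => pairing fx (damp n G)); last exact/funext.
  exact: pairing_damp_cvg.
(* Here [DomU] is essential: [K * xi^(- 1/2)] times [ys j] is integrable. *)
have b_cvg j : ccvg (fun n => pairing (ys j) (Fd n)) (pairing (ys j) G').
  have [K K0 hK] := Fd_le; have [my _] := Lys j.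
  have [_ jw] := DomU_weighted _ (dys j).
  apply: (cdct _ _ _ (fun t => K * norm1 (ys j t * (hweight t)%:C))) => //.
  - by move=> n; apply: cmeasM => //; have [[]] := LFd n.
  - exact: itgZl.
  - move=> n t; rewrite RpE => t0; rewrite norm1_mul_real ger0_norm ?hweight_ge0// [leRHS]mulrCA.
    by apply: norm1_le_mul; [exact: lexx|apply: hK].
  - by move=> t; rewrite RpE => t0; apply: ccvgM; [exact: ccvg_cst|exact: Fd_cvg].
pose e j := 4 * (Num.sqrt (L2dist2 (ys j) x) * Num.sqrt (opbound * l2norm2 G)).
have b_le j : norm1 (pairing (ys j) G' - pairing fx G) <= 2 * e j.
  apply: norm1_lim_le (ccvgB _ _ _ _ (b_cvg j) a_cvg) _ => n.
  have [LF NF] := LFd n.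
  rewrite -pairingBl//; apply: (le_trans (pairing_CS _ _ (L2pB _ _ (Lys j) Lx) LF)).
  by rewrite ler_pM2l// ler_wpM2l ?sqrtr_ge0// ler_wsqrtr.
have e_cvg : (fun j => 2 * e j) @ \oo --> (0 : R).
  suff : (fun j => 2 * e j) @ \oo --> 2 * (4 * (0 * Num.sqrt (opbound * l2norm2 G))).
    by rewrite mul0r !mulr0.
  do 2 (apply: cvgM; first exact: cvg_cst); apply: cvgM; last exact: cvg_cst.
  rewrite -[X in _ --> X](sqrtr0 R).
  by apply: (@continuous_cvg _ _ _ _ _ _ Num.sqrt) => //; exact: sqrt_continuous.
apply: (ccvg_unique (fun j => pairing (ys j) G')); first exact: ccvg_squeeze b_le e_cvg.
exact: pairing_cvg.
Qed.

End Limit.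

(** The cut-off to [Ik k] puts the difference in L^2, where the multiplier is bounded, and makes its
    conjugate an admissible test function; the pairing identity then says that the energy of the
    truncated difference is 0. *)
Lemma transform_ae_exhaustion s k x fx yp ym zp zm :
  IsFRp x fx -> IsU x yp ym -> IsU fx zp zm ->
  {ae mu, forall m, Rp m -> Ik k m ->
    (if s then zp else zm) m = multiplier s m * (if ~~ s then yp else ym) m}.
Proof.
move=> hfx hUx hUfx.
set z := if s then zp else zm; set y := if ~~ s then yp else ym.
have Lz : L2p z by have [_ [? [? _]]] := hUfx; rewrite /z; case: (s).
have Ly : L2p y by have [_ [? [? _]]] := hUx; rewrite /y; case: (s).
have [mz jz] := Lz; have [my jy] := Ly.
have [K K0 hK] := multiplier_le s k.
pose h := truncate (Ik k) (fun m => z m - multiplier s m * y m).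
have mh : cmeas Rp h.
  apply: cmeas_truncate => //; apply: cmeasB => //; apply: cmeasM => //.
  exact: cmeas_multiplier.
have Lh : L2p h.
  apply: (proj1 (L2p_dominated _ (fun t => 2 * cnorm2 (z t) + 2 * (K ^+ 2 * cnorm2 (y t))) _ _ _)) => //.
    move=> t t0; rewrite /h /truncate; case: ifPn => [/set_mem tk|_]; last first.
      by rewrite cnorm2_0 addr_ge0// !mulr_ge0 ?cnorm2_ge0 ?sqr_ge0.
    apply: (le_trans (cnorm2B_le _ _)); rewrite lerD2l ler_pM2l// cnorm2M.
    rewrite ler_wpM2r ?cnorm2_ge0//; apply: (le_trans (cnorm2_le_norm1 _)).
    by apply: lerXn2r; rewrite ?nnegrE ?norm1_ge0// hK.
  by apply: itgD => //; do ?[exact: itgZl]; apply: itgZl => //; exact: itgZl.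
pose g m := cconj (h m).
have mg : cmeas Rp g by exact: cmeas_cconj.
have Lg : L2p g.
  split => //; apply: (eq_itg _ (fun t => cnorm2 (h t))) => //; last by have [] := Lh.
  by move=> t _; rewrite cnorm2_cconj.
have gk : supp_in k g.
  move=> t t0 tk; rewrite /g /h /truncate; case: ifPn => [/set_mem//|_].
  by apply: cext; rewrite /= ?oppr0.
have Lg' : L2p (fun m => multiplier s m * g m).
  by apply: (L2p_bounded_mul k _ K) => //; exact: cmeas_multiplier.
have E := transform_pairing s k g Lg gk x fx yp ym zp zm hfx hUx hUfx.
have Z : rint Rp (fun t => cnorm2 (h t)) = 0.
  move/eqP: E; rewrite -/z -/y -subr_eq0 /pairing -cintB//; try exact: pairing_integrable.
  move=> /eqP /(congr1 (@cre R)) /= <-.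
  apply: eq_rint => t _; rewrite mulrA [y t * _]mulrC -mulrBl /g /h /truncate.
  case: ifPn => _; first by rewrite mul_cconj.
  by rewrite cnorm2_0 !creimE /= oppr0 !mulr0 subr0.
have Z' : (\int[mu]_(t in Rp) `|(cnorm2 (h t))%:E| = 0)%E.
  transitivity (\int[mu]_(t in Rp) (cnorm2 (h t))%:E)%E.
    by apply: eq_integral => t _; rewrite gee0_abs// lee_fin cnorm2_ge0.
  by have [_ jh] := Lh; rewrite -EFin_rint// Z.
have mh2 : measurable_fun Rp (fun t => (cnorm2 (h t))%:E).
  by apply/measurable_EFinP; exact: cmeas_cnorm2.
have /(@ae_eq_integral_abs _ _ _ mu Rp measurable_Rp _ mh2) := Z'.
apply: filterS => t ht Rt tk; have := ht Rt => /= -[].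
rewrite /h /truncate mem_set//.
move: (z t) (multiplier s t * y t) => [a b] [c d]; rewrite /cnorm2 /= => /eqP.
rewrite paddr_eq0 ?sqr_ge0// !sqrf_eq0 !subr_eq0 => /andP[/eqP -> /eqP ->].
by [].
Qed.

(** The exceptional null sets, one for each interval of the exhaustion, are countably many. *)
Lemma transform_ae s x fx yp ym zp zm :
  IsFRp x fx -> IsU x yp ym -> IsU fx zp zm ->
  {ae mu, forall m, Rp m ->
    (if s then zp else zm) m = multiplier s m * (if ~~ s then yp else ym) m}.
Proof.
move=> hfx hUx hUfx.
have /ae_foralln := fun k => transform_ae_exhaustion s k x fx yp ym zp zm hfx hUx hUfx.
apply: filterS => m hm Rm; have := Rm; rewrite RpE => /near_Ik [N _ /(_ N (leqnn N))] mN.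
exact: hm mN.
Qed.

End Multiplier.

Theorem theorem3p1 (R : realType) (x fx yp ym zp zm : R -> R[i])
  (hx : L2p x)
  (hfx : IsFRp x fx)
  (hUx : IsU x yp ym)
  (hUfx : IsU fx zp zm) :
  {ae (@lebesgue_measure R), forall m, Rp m -> zp m = Fpm m * ym m} /\
  {ae (@lebesgue_measure R), forall m, Rp m -> zm m = Fmp m * yp m}.
Proof.
split.
- exact: (transform_ae true x fx yp ym zp zm).
- exact: (transform_ae false x fx yp ym zp zm).
Qed.
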